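(* Assume in addition that $\beta$ is odd. Let $\mu>0$ and $g(t,x,\theta)=h(x)$ with $h\in L^\infty(\Omega)$ a given nonnegative function. Let $u_{stat}$ be the unique nonnegative weak solution of the stationary problem $$\mathcal A_\mu u=\operatorname{div}(\vec f(u))+h\ \text{ in }\Omega,\qquad u=0\ \text{ on }\mathbb R^d\setminus\Omega.$$ If $u_0\in\mathcal W\cap L^\infty(\Omega)$ satisfies $u_0\in[0,u_{stat}]$ a.e. in $\Omega$, then the global weak-mild solution $u$ of problem (P) satisfies $u(t)\to u_{stat}$ in $L^\gamma(\Omega)$ as $t\to\infty$, for all $\gamma\in[1,\infty)$.
   Context: Setting. $\Omega\subset\mathbb R^d$ is a bounded domain with smooth boundary, $Q_T=(0,T)\times\Omega$, $s\in(0,1)$, $p\in(2,\infty)$, $q\in(1,\infty)$, $\mu>0$. Functions on $\Omega$ vanishing at the boundary are extended by $0$ to $\mathbb R^d$. Spaces. $W^{s,q}_0(\Omega)=\{u\in W^{s,q}(\mathbb R^d): u=0 \text{ on }\mathbb R^d\setminus\Omega\}$ with norm $\|u\|_{W^{s,q}_0(\Omega)}=\big(\iint_{\mathbb R^{2d}}\frac{|u(x)-u(y)|^q}{|x-y|^{d+sq}}dx\,dy\big)^{1/q}$. $\mathcal W=W^{1,p}_0(\Omega)\cap W^{s,q}_0(\Omega)$ (sum of norms). $X_T=\{v\in L^\infty(Q_T)\cap L^\infty(0,T;\mathcal W): \partial_t v\in L^2(Q_T)\}$. Operator. $\mathcal A_\mu u=-\Delta_p u+\mu(-\Delta)^s_q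 u$, with $\Delta_p u=\operatorname{div}(|\nabla u|^{p-2}\nabla u)$ and, weakly, $\langle\mathcal A_\mu u,\varphi\rangle=\int_\Omega|\nabla u|^{p-2}\nabla u\cdot\nabla\varphi\,dx+\mu\iint_{\mathbb R^{2d}}\frac{|u(x)-u(y)|^{q-2}(u(x)-u(y))(\varphi(x)-\varphi(y))}{|x-y|^{d+sq}}dx\,dy$. Standing assumptions. $\vec f=(f_1,\dots,f_d)$ with $f_i\in W^{1,\infty}_{loc}(\mathbb R)$, $f_i(0)=0$. $\beta:\mathbb R\to\mathbb R$ is an increasing bijection, locally $\alpha$-Hölder continuous for some $\alpha\in(0,1]$, $\beta(0)=0$; for every $K>0$ there is $C_K>0$ with $\beta(t)-\beta(t')\ge C_K(t-t')$ for $-K\le t'\le t\le K$; and there is $c>0$ with $|\beta(t)|\le c(1+|t|^{p-1})$ for all $t$. Weak solution of the stationary problem: a bounded $u\in\mathcal W$ with $\langle\mathcal A_\mu u,\varphi\rangle=-\int_\Omega\vec f(u)\cdot\nabla\varphi\,dx+\int_\Omega h\varphi\,dx$ for all $\varphi\in\mathcal W$. Problem (P): $\partial_t\beta(u)+\mathcal A_\mu u=\operatorname{div}(\vec f(u))+g(t,x,u)$ in $Q_T$, $u=0$ in $(0,T)\times(\mathbb R^d\setminus\Omega)$, $u(0,\cdot)=u_0$ in $\Omega$. Weak solution of (P) on $Q_T$: $u\in X_T$ with $\beta(u)\in C([0,T];L^2(\Omega))$, $u(0,\cdot)=u_0$ a.e., and for every $t\in[0,T]$ and every $\varphi\in H^1(0,T;L^2(\Omega))\cap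 L^1(0,T;\mathcal W)$, $$\Big[\int_\Omega\beta(u)\varphi\,dx\Big]_0^t-\int_0^t\!\!\int_\Omega\beta(u)\partial_t\varphi\,dx\,d\tau+\int_0^t\big(\langle\mathcal A_\mu u,\varphi\rangle-\langle\operatorname{div}\vec f(u),\varphi\rangle\big)d\tau=\int_0^t\!\!\int_\Omega g(\tau,x,u)\varphi\,dx\,d\tau,$$ where $\langle\operatorname{div}\vec f(u),\varphi\rangle=-\int_\Omega\vec f(u)\cdot\nabla\varphi\,dx$. Mild solution. Let $A(v)=\mathcal A_\mu(\beta^{-1}(v))-\operatorname{div}\vec f(\beta^{-1}(v))$ on $D(A)=\{v\in L^1(\Omega):\beta^{-1}(v)\in\mathcal W,\ A(v)\in L^1(\Omega)\}$. For $h\in L^1(Q_T)$, $v_0\in L^1(\Omega)$, $\varepsilon>0$, an $\varepsilon$-approximate solution of $\partial_t v+A(v)=h$, $v(0)=v_0$ is given by a partition $0=t_0<\dots<t_N=T$ with $t_i-t_{i-1}<\varepsilon$, functions $h_i\in L^1(\Omega)$ with $\sum_{i=1}^N\int_{t_{i-1}}^{t_i}\|h(\tau)-h_i\|_{L^1(\Omega)}d\tau<\varepsilon$, and $U_0\in L^1(\Omega)$, $U_1,\dots,U_N\in D(A)$ with $\|U_0-v_0\|_{L^1(\Omega)}\le\varepsilon$ and $\frac{U_i-U_{i-1}}{t_i-t_{i-1}}+A(U_i)=h_i$ for $1\le i\le N$; it is the piecewise constant function $U=U_i$ on $[t_i,t_{i+1})$, $U(T)=U_N$. A mild solution of $\partial_t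 v+A(v)=h$, $v(0)=v_0$ is $v\in C([0,T];L^1(\Omega))$ such that for every $\varepsilon>0$ there is an $\varepsilon$-approximate solution $U$ with $\|U(t)-v(t)\|_{L^1(\Omega)}<\varepsilon$ for all $t\in[0,T]$. A function $u$ is a mild solution of (P) if $v=\beta(u)$ is a mild solution with $h=g(t,x,u)$ and $v_0=\beta(u_0)$. Weak-mild solution of (P) on $Q_T$: a weak solution that is also a mild solution. Global weak-mild solution: $u\in L^\infty_{loc}(0,\infty;L^\infty(\Omega))$ that is a weak-mild solution on $Q_T$ for every $T<\infty$. Under the hypotheses of the claim such a global solution exists and is unique. *)

(* Defs.v *)
From HB Require Import structures.
From mathcomp Require Import all_boot all_order all_algebra.
From mathcomp Require Import all_classical all_reals all_analysis.

Set Implicit Arguments.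
Unset Strict Implicit.
Unset Printing Implicit Defensive.

Import Order.TTheory GRing.Theory Num.Theory.
Import numFieldNormedType.Exports.

Local Open Scope classical_set_scope.
Local Open Scope ring_scope.

(** R^n is 'rV[R]_n with the product (= Borel) sigma-algebra.  Its norm as a
    normedModType is the sup norm: that one is used for the topology only,
    |x| in the formulas is [enorm] below. *)

Definition measure_rV_display : measure_display.
Proof. exact: measurable_structure.default_measure_display. Qed.

Section measurable_rV.
Variables (R : realType) (n : nat).

Let coors : 'I_n -> 'rV[R]_n -> measurableTypeR R := fun i x => x ord0 i.

Let rV_set0 : g_sigma_preimage coors set0.
Proof. exact: sigma_algebra0. Qed.

Let rV_setC A : g_sigma_preimage coors A -> g_sigma_preimage coors (~` A).
Proof. exact: sigma_algebraC. Qed.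

Let rV_bigcup (F : (set 'rV[R]_n)^nat) :
  (forall i, g_sigma_preimage coors (F i)) ->
  g_sigma_preimage coors (\bigcup_i (F i)).
Proof. exact: sigma_algebra_bigcup. Qed.

HB.instance Definition _ := @isMeasurable.Build measure_rV_display
  'rV[R]_n (g_sigma_preimage coors) rV_set0 rV_setC rV_bigcup.

Lemma measurable_coor (i : 'I_n) :
  measurable_fun [set: 'rV[R]_n] (fun x => x ord0 i : measurableTypeR R).
Proof.
move=> _ Y mY; rewrite setTI; apply: sub_sigma_algebra => /=.
rewrite -bigcup_seq/=; exists i => /=; first by rewrite mem_index_enum.
by exists Y => //; rewrite setTI.
Qed.

Lemma measurable_fun_coorP d (T : measurableType d) (f : T -> 'rV[R]_n) :
  (forall i, measurable_fun [set: T] (fun x => f x ord0 i : measurableTypeR R)) ->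
  measurable_fun [set: T] f.
Proof.
move=> mf _ A mA; rewrite setTI.
have : g_sigma_preimage (fun i => coors i \o f) (f @^-1` A).
  by rewrite g_sigma_preimage_comp; exists A => //; rewrite setTI.
apply: smallest_sub; first exact: sigma_algebra_measurable.
rewrite -bigcup_seq => B [i _ [C mC <-]].
exact: mf.
Qed.

End measurable_rV.

Section lebesgue_rV.
Variable R : realType.
Implicit Type n : nat.

Definition rV_cons n (p : measurableTypeR R * 'rV[R]_n) : 'rV[R]_n.+1 :=
  \row_i (if unlift ord0 i is Some j then p.2 ord0 j else p.1).

Definition rV_uncons n (x : 'rV[R]_n.+1) : measurableTypeR R * 'rV[R]_n :=
  (x ord0 ord0, \row_j x ord0 (lift ord0 j)).

Lemma rV_consK n : cancel (@rV_cons n) (@rV_uncons n).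
Proof.
case=> a v; rewrite /rV_cons /rV_uncons /= mxE unlift_none; congr pair.
by apply/rowP => j; rewrite !mxE liftK.
Qed.

Lemma rV_unconsK n : cancel (@rV_uncons n) (@rV_cons n).
Proof.
by move=> x; apply/rowP => i; rewrite !mxE; case: unliftP => [j|] ->; rewrite ?mxE.
Qed.

Lemma measurable_rV_cons n : measurable_fun [set: _] (@rV_cons n).
Proof.
apply: measurable_fun_coorP => i.
case: (unliftP ord0 i) => [j|] ->.
  rewrite [X in measurable_fun _ X](_ : _ = (fun x : 'rV[R]_n => x ord0 j) \o snd).
    by apply: measurableT_comp => //; exact: measurable_coor.
  by apply/funext => p; rewrite /rV_cons /= mxE liftK.
rewrite [X in measurable_fun _ X](_ : _ = fst) //.
by apply/funext => p; rewrite /rV_cons /= mxE unlift_none.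
Qed.

Lemma measurable_rV_uncons n : measurable_fun [set: _] (@rV_uncons n).
Proof.
apply/measurable_fun_pairP; split; first exact: measurable_coor.
apply: measurable_fun_coorP => i.
rewrite [X in measurable_fun _ X]
  (_ : _ = (fun x : 'rV[R]_n.+1 => x ord0 (lift ord0 i))).
  exact: measurable_coor.
by apply/funext => x; rewrite /rV_uncons /= mxE.
Qed.

Definition lebesgue_cons n (m : {sigma_finite_measure set 'rV[R]_n -> \bar R}) :
    set 'rV[R]_n.+1 -> \bar R :=
  pushforward (@lebesgue_measure R \x m)%E (@rV_cons n).

Section instances.
Variables (n : nat) (m : {sigma_finite_measure set 'rV[R]_n -> \bar R}).

Let mcons : {measure set 'rV[R]_n.+1 -> \bar R} :=
  measure_function_pushforward__canonical__measure_function_Measure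
    (@lebesgue_measure R \x m)%E (@measurable_rV_cons n).

HB.instance Definition _ := Measure.copy (lebesgue_cons m) mcons.

Let lebesgue_cons_sigma_finite : sigma_finite setT (lebesgue_cons m).
Proof.
have /sigma_finiteP[F [TF ndF Foo]] := sigma_finiteT (@lebesgue_measure R).
have /sigma_finiteP[G [TG ndG Goo]] := sigma_finiteT m.
exists (fun i => @rV_uncons n @^-1` (F i `*` G i)).
  rewrite -preimage_bigcup (_ : \bigcup_i _ = setT) ?preimage_setT//.
  apply/seteqP; split => // -[x y] _.
  have [i _ Fx] : (\bigcup_i F i) x by rewrite -TF.
  have [j _ Gy] : (\bigcup_i G i) y by rewrite -TG.
  exists (maxn i j) => //; split => /=.
    by move: x Fx; exact/subsetPset/ndF/leq_maxl.
  by move: y Gy; exact/subsetPset/ndG/leq_maxr.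
move=> i; have [mF Fi] := Foo i; have [mG Gi] := Goo i.
have mFG : measurable (F i `*` G i) by exact: measurableX.
split; first by rewrite -[X in measurable X]setTI; exact: measurable_rV_uncons.
rewrite /lebesgue_cons /pushforward -comp_preimage.
rewrite (_ : _ \o _ = id); last by apply/funext => p; rewrite /= rV_consK.
by rewrite preimage_id product_measure1E// lte_mul_pinfty// ge0_fin_numE.
Qed.

HB.instance Definition _ := @Measure_isSigmaFinite.Build _ _ _
  (lebesgue_cons m) lebesgue_cons_sigma_finite.
End instances.

(** d-dimensional Lebesgue measure, as an iterated product. *)
Fixpoint lebesgue_rV n : {sigma_finite_measure set 'rV[R]_n -> \bar R} :=
  if n is n'.+1 then lebesgue_cons (lebesgue_rV n') else \d_(0 : 'rV[R]_0).

Lemma lebesgue_rV_box n (A : 'I_n -> set (measurableTypeR R)) :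
  (forall i, measurable (A i)) ->
  lebesgue_rV n [set x | forall i, A i (x ord0 i)] =
  (\prod_(i < n) @lebesgue_measure R (A i))%E.
Proof.
elim: n A => [|n IH] A mA /=.
  rewrite big_ord0 diracE mem_set//; by case.
have mB : measurable [set x : 'rV[R]_n | forall i, A (lift ord0 i) (x ord0 i)].
  rewrite (_ : mkset _ = \bigcap_(i in [set: 'I_n])
    ((fun x : 'rV[R]_n => x ord0 i : measurableTypeR R) @^-1` A (lift ord0 i))).
    apply: fin_bigcap_measurable => // i _.
    by rewrite -[X in measurable X]setTI; exact: measurable_coor.
  by apply/seteqP; split => x /= H i; [move=> _; exact: H | exact: (H i I)].
rewrite big_ord_recl -IH//.
rewrite -product_measure1E//.
rewrite /lebesgue_cons /pushforward.
congr (_ _); apply/seteqP; split => -[a v] /=.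
  move=> H; split => /= [|i].
    by have := H ord0; rewrite mxE unlift_none.
  by have := H (lift ord0 i); rewrite mxE liftK.
by move=> [/= Ha Hv] i; rewrite mxE; case: unliftP => [j|] ->.
Qed.

End lebesgue_rV.

Section euclidean.
Variables (R : realType) (d : nat).

Definition dotp (x y : 'rV[R]_d) : R := \sum_(i < d) x ord0 i * y ord0 i.

Definition enorm (x : 'rV[R]_d) : R := Num.sqrt (dotp x x).

End euclidean.

Section smooth_functions.
Variables (R : realType) (V : normedModType R).

(** For finite-dimensional V, C^k in the sense of iterated directional
    derivatives is the usual C^k. *)
Fixpoint Ck (k : nat) (f : V -> R) : Prop :=
  if k is k'.+1 then
    (forall x v, derivable f x v) /\ (forall v, Ck k' ('D_v f))
  else continuous f.

Definition smooth (f : V -> R) : Prop := forall k, Ck k f.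

(** C_c^oo(D) *)
Definition test_function (D : set V) (phi : V -> R) : Prop :=
  [/\ smooth phi, compact (closure [set x | phi x != 0])
    & closure [set x | phi x != 0] `<=` D].

End smooth_functions.

Section Lp.
Context {dT : measure_display} {T : measurableType dT} {R : realType}.
Variables (m : {measure set T -> \bar R}) (D : set T) (r : \bar R).

(** The L^r(D) norm; r = +oo gives the essential supremum of |f| on D. *)
Definition normLp (f : T -> R) : \bar R :=
  'N[m]_r[EFin \o patch (fun=> 0) D f].

Definition in_Lp (f : T -> R) : Prop :=
  measurable_fun D f /\ (normLp f < +oo)%E.

End Lp.

Section domain.
Variables (R : realType) (d : nat).

(** The boundary is locally the graph of a C^oo function of d - 1 of the
    coordinates, with Omega on one side of it. *)
Definition smooth_boundary (Omega : set 'rV[R]_d) : Prop :=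
  forall x0, (closure Omega `\` Omega) x0 ->
  exists (i : 'I_d) (b : bool) (gamma : 'rV[R]_d.-1 -> R) (U : set 'rV[R]_d),
    [/\ smooth gamma, nbhs x0 U
      & forall x, U x ->
          (Omega x <-> 0 < (-1) ^+ b * (x ord0 i - gamma (col' i x)))].

Definition smooth_bounded_domain (Omega : set 'rV[R]_d) : Prop :=
  [/\ Omega !=set0, open Omega, connected Omega, bounded_set Omega
    & smooth_boundary Omega].

End domain.

Section structural_assumptions.
Variable R : realType.
Let leb1 := @lebesgue_measure R.

(** W^{1,oo}_loc(R), through the continuous representative. *)
Definition W1oo_loc (f : R -> R) : Prop :=
  continuous f /\
  exists f' : R -> R,
    [/\ measurable_fun setT f',
        forall K : R, exists C : R,
          {ae leb1, forall t, `|t| <= K -> `|f' t| <= C}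
      & forall phi : R -> R, test_function setT phi ->
          \int[leb1]_t (f t * derive1 phi t) = - \int[leb1]_t (f' t * phi t)].

Definition beta_assumptions (p : R) (beta : R -> R) : Prop :=
  [/\ {homo beta : t t' / t < t'} /\ bijective beta,
      exists2 alpha : R, 0 < alpha <= 1 &
        forall K : R, exists C : R, forall t t', `|t| <= K -> `|t'| <= K ->
          `|beta t - beta t'| <= C * `|t - t'| `^ alpha,
      beta 0 = 0,
      forall K : R, 0 < K -> exists2 C : R, 0 < C &
        forall t t', - K <= t' -> t' <= t -> t <= K ->
          C * (t - t') <= beta t - beta t'
    & exists2 c : R, 0 < c &
        forall t, `|beta t| <= c * (1 + `|t| `^ (p - 1))].

End structural_assumptions.

Section function_spaces.
Variables (R : realType) (d : nat) (Omega : set 'rV[R]_d).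
Let leb := lebesgue_rV R d.
Implicit Types (u : 'rV[R]_d -> R) (G : 'rV[R]_d -> 'rV[R]_d).

Definition in_L1loc u : Prop :=
  measurable_fun Omega u /\
  forall K, compact K -> K `<=` Omega -> leb.-integrable K (EFin \o u).

Definition is_weak_gradient u G : Prop :=
  [/\ in_L1loc u, forall i, in_L1loc (fun x => G x ord0 i)
    & forall phi i, test_function Omega phi ->
        \int[leb]_(x in Omega) (u x * 'D_(delta_mx ord0 i) phi x) =
        - \int[leb]_(x in Omega) (G x ord0 i * phi x)].

(** A choice of weak gradient in Omega; it is unique up to null sets, and
    equal to 0 by convention when there is none. *)
Definition weak_gradient u : 'rV[R]_d -> 'rV[R]_d :=
  xget (fun=> 0) [set G | is_weak_gradient u G].

Section first_order.
Variable p : R.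

Definition normW1 u : \bar R :=
  (normLp leb Omega p%:E u +
   normLp leb Omega p%:E (fun x => enorm (weak_gradient u x)))%E.

Definition in_W1 u : Prop :=
  [/\ measurable_fun Omega u, exists G, is_weak_gradient u G
    & (normW1 u < +oo)%E].

(** W^{1,p}_0(Omega): closure of C_c^oo(Omega) in W^{1,p}(Omega). *)
Definition in_W10 u : Prop :=
  in_W1 u /\
  exists phi : nat -> 'rV[R]_d -> R,
    (forall n, test_function Omega (phi n)) /\
    (normW1 (fun x => u x - phi n x) @[n --> \oo] --> 0%E).

End first_order.

Section fractional.
Variables (s q : R).

Definition gagliardo u : \bar R :=
  (\int[(leb \x leb)%E]_z
     (`|u z.1 - u z.2| `^ q / enorm (z.1 - z.2) `^ (d%:R + s * q))%:E)
  `^ q^-1.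

(** W^{s,q}_0(Omega), with norm [gagliardo]. *)
Definition in_Ws0 u : Prop :=
  [/\ in_Lp leb setT q%:E u, (gagliardo u < +oo)%E
    & {ae leb, forall x, ~ Omega x -> u x = 0}].

End fractional.

Variables (s p q : R).

Definition in_W u : Prop := in_W10 p u /\ in_Ws0 s q u.

Definition normW u : \bar R := (normW1 p u + gagliardo s q u)%E.

End function_spaces.

Section equation.
Variables (R : realType) (d : nat) (Omega : set 'rV[R]_d).
Variables (s p q mu : R) (f : 'I_d -> R -> R) (beta : R -> R).

Let leb1 := @lebesgue_measure R.
Let leb := lebesgue_rV R d.
Let leb_tx := (leb1 \x leb)%E.
Local Notation "'grad' u" := (weak_gradient Omega u) (at level 10, u at level 9).
Local Notation W := (in_W Omega s p q).
Local Notation normW := (normW Omega s p q).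
Local Notation Loo D := (in_Lp leb D +oo%E).

(** <A_mu u, phi> *)
Definition form_A (u phi : 'rV[R]_d -> R) : R :=
  \int[leb]_(x in Omega)
    (enorm (grad u x) `^ (p - 2) * dotp (grad u x) (grad phi x)) +
  mu * \int[(leb \x leb)%E]_z
    (`|u z.1 - u z.2| `^ (q - 2) * (u z.1 - u z.2) * (phi z.1 - phi z.2) /
     enorm (z.1 - z.2) `^ (d%:R + s * q)).

Definition flux (r : R) : 'rV[R]_d := \row_i f i r.

(** <div f(u), phi> *)
Definition form_div (u phi : 'rV[R]_d -> R) : R :=
  - \int[leb]_(x in Omega) dotp (flux (u x)) (grad phi x).

Definition weak_stationary (h u : 'rV[R]_d -> R) : Prop :=
  [/\ W u, Loo Omega u
    & forall phi, W phi ->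
        form_A u phi = form_div u phi + \int[leb]_(x in Omega) (h x * phi x)].

Definition ooitv (a b : R) : set (measurableTypeR R) := `]a, b[%classic.

Definition cylinder (T : R) : set (measurableTypeR R * 'rV[R]_d) :=
  ooitv 0 T `*` Omega.

Definition uncurried (v : R -> 'rV[R]_d -> R)
  (z : measurableTypeR R * 'rV[R]_d) : R := v z.1 z.2.

(** v \in C([0, T]; L^r(Omega)) *)
Definition in_C_Lp (T : R) (r : \bar R) (v : R -> 'rV[R]_d -> R) : Prop :=
  (forall t, 0 <= t <= T -> in_Lp leb Omega r (v t)) /\
  (forall t, 0 <= t <= T ->
    normLp leb Omega r (fun x => v t' x - v t x)
      @[t' --> within `[0, T]%classic (nbhs t)] --> 0%E).

(** w is the time derivative of v in the sense of distributions on Q_T. *)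
Definition is_time_derivative (T : R) (v w : R -> 'rV[R]_d -> R) : Prop :=
  forall psi : R * 'rV[R]_d -> R, test_function (cylinder T) psi ->
    \int[leb_tx]_(z in cylinder T) (uncurried v z * 'D_(1, 0) psi z) =
    - \int[leb_tx]_(z in cylinder T) (uncurried w z * psi z).

Definition in_X (T : R) (v : R -> 'rV[R]_d -> R) : Prop :=
  [/\ in_Lp leb_tx (cylinder T) +oo%E (uncurried v),
      exists M : R,
        {ae leb1, forall t, 0 < t < T -> W (v t) /\ (normW (v t) <= M%:E)%E}
    & exists2 w, in_Lp leb_tx (cylinder T) 2%:E (uncurried w)
        & is_time_derivative T v w].

(** phi \in H^1(0, T; L^2(Omega)), with derivative phi'; phi is taken to be the
    representative which is continuous with values in L^2(Omega). *)
Definition in_H1_L2 (T : R) (phi phi' : R -> 'rV[R]_d -> R) : Prop :=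
  [/\ in_Lp leb_tx (cylinder T) 2%:E (uncurried phi),
      in_Lp leb_tx (cylinder T) 2%:E (uncurried phi'),
      in_C_Lp T 2%:E phi
    & forall psi : R -> R, test_function `]0, T[%classic psi ->
        {ae leb, forall x, Omega x ->
          \int[leb1]_(t in ooitv 0 T) (phi t x * derive1 psi t) =
          - \int[leb1]_(t in ooitv 0 T) (phi' t x * psi t)}].

Definition in_L1_W (T : R) (phi : R -> 'rV[R]_d -> R) : Prop :=
  {ae leb1, forall t, 0 < t < T -> W (phi t)} /\
  (\int[leb1]_(t in ooitv 0 T) normW (phi t) < +oo)%E.

Section evolution.
Variables (g : R -> 'rV[R]_d -> R -> R) (u0 : 'rV[R]_d -> R).

(** u is the representative for which t |-> beta(u(t)) is continuous with
    values in L^2(Omega). *)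
Definition weak_solution (T : R) (u : R -> 'rV[R]_d -> R) : Prop :=
  [/\ in_X T u,
      in_C_Lp T 2%:E (fun t x => beta (u t x)),
      {ae leb, forall x, Omega x -> u 0 x = u0 x}
    & forall phi phi', in_H1_L2 T phi phi' -> in_L1_W T phi ->
      forall t, 0 <= t <= T ->
        \int[leb]_(x in Omega) (beta (u t x) * phi t x)
        - \int[leb]_(x in Omega) (beta (u 0 x) * phi 0 x)
        - \int[leb1]_(tau in ooitv 0 t)
            (\int[leb]_(x in Omega) (beta (u tau x) * phi' tau x))
        + \int[leb1]_(tau in ooitv 0 t)
            (form_A (u tau) (phi tau) - form_div (u tau) (phi tau))
        = \int[leb1]_(tau in ooitv 0 t)
            (\int[leb]_(x in Omega) (g tau x (u tau x) * phi tau x))].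

(** beta^-1(v), extended by 0 outside Omega *)
Definition beta_inv (v : 'rV[R]_d -> R) : 'rV[R]_d -> R :=
  patch (fun=> 0) Omega ('pinv_(fun=> 0) setT beta \o v).

(** v \in D(A) and A(v) = w in L^1(Omega) *)
Definition is_A (v w : 'rV[R]_d -> R) : Prop :=
  [/\ in_Lp leb Omega 1%E v, W (beta_inv v), in_Lp leb Omega 1%E w
    & forall phi, W phi -> Loo Omega phi ->
        leb.-integrable Omega
          (fun x => (dotp (flux (beta_inv v x)) (grad phi x))%:E) /\
        form_A (beta_inv v) phi - form_div (beta_inv v) phi =
        \int[leb]_(x in Omega) (w x * phi x)].

Definition approximate_solution (T : R) (h : R -> 'rV[R]_d -> R)
    (v0 : 'rV[R]_d -> R) (eps : R) (V : R -> 'rV[R]_d -> R) : Prop :=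
  exists (N : nat) (t_ : nat -> R) (h_ U_ : nat -> 'rV[R]_d -> R),
  [/\ [/\ t_ 0%N = 0, t_ N = T
        & forall i, (i < N)%N -> t_ i < t_ i.+1 /\ t_ i.+1 - t_ i < eps],
      (forall i, (i < N)%N -> in_Lp leb Omega 1%E (h_ i.+1)) /\
      (\sum_(i < N) \int[leb1]_(tau in ooitv (t_ i) (t_ i.+1))
         normLp leb Omega 1 (fun x => h tau x - h_ i.+1 x)%R < eps%:E)%E,
      in_Lp leb Omega 1%E (U_ 0%N) /\
      (normLp leb Omega 1 (fun x => U_ 0%N x - v0 x)%R <= eps%:E)%E,
      forall i, (i < N)%N ->
        is_A (U_ i.+1)
          (fun x => h_ i.+1 x - (U_ i.+1 x - U_ i x) / (t_ i.+1 - t_ i))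
    & (forall i tau, (i < N)%N -> t_ i <= tau < t_ i.+1 -> V tau = U_ i) /\
      V T = U_ N].

Definition mild_solution (T : R) (h : R -> 'rV[R]_d -> R)
    (v0 : 'rV[R]_d -> R) (v : R -> 'rV[R]_d -> R) : Prop :=
  [/\ in_Lp leb_tx (cylinder T) 1%E (uncurried h),
      in_Lp leb Omega 1%E v0,
      in_C_Lp T 1%E v
    & forall eps : R, 0 < eps ->
        exists2 V, approximate_solution T h v0 eps V &
          forall t, 0 <= t <= T ->
            (normLp leb Omega 1 (fun x => V t x - v t x)%R < eps%:E)%E].

Definition weak_mild_solution (T : R) (u : R -> 'rV[R]_d -> R) : Prop :=
  weak_solution T u /\
  mild_solution T (fun t x => g t x (u t x)) (fun x => beta (u0 x))
    (fun t x => beta (u t x)).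

Definition global_weak_mild_solution (u : R -> 'rV[R]_d -> R) : Prop :=
  (forall a b : R, 0 < a -> a < b ->
     in_Lp leb_tx (`[a, b]%classic `*` Omega) +oo%E (uncurried u)) /\
  (forall T : R, 0 < T -> weak_mild_solution T u).

End evolution.
End equation.

(* Main.v *)
(** Testing the difference of two stationary equations with S(u1 - u2), where S
    is a smooth approximation of the sign, shows that A is accretive in L^1.
    The p-Laplacian term is nonnegative by monotonicity.  The flux term vanishes
    in the limit because f is locally Lipschitz.  The fractional term dominates
    kappa * int_Omega |J(u1) - J(u2)|, with J(r) = |r|^(q-2) r, because u1 and u2
    vanish on a box outside Omega.

    Along the implicit Euler scheme of the mild formulation, this keeps u
    between 0 and u_stat, and makes int_Omega (beta(u_stat) - beta(u))^+ decrease
    at the rate kappa * int_Omega (J(u_stat) - J(u))^+ at least.  By uniform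
    continuity of beta this rate stays away from 0 as long as the decreasing
    integral does, which therefore tends to 0.  The local lower Lipschitz bound
    on beta turns this into convergence of u in L^1, hence in L^gamma since u
    stays bounded. *)

From HB Require Import structures.
Require Import Defs.
From mathcomp Require Import all_boot all_order all_algebra.
From mathcomp Require Import all_classical all_reals all_analysis.
From mathcomp Require Import measurable_realfun ess_sup_inf.
From mathcomp Require Import ring lra.

Set Implicit Arguments.
Unset Strict Implicit.
Unset Printing Implicit Defensive.

Import Order.TTheory GRing.Theory Num.Theory.
Import numFieldNormedType.Exports.

Local Open Scope classical_set_scope.
Local Open Scope ring_scope.

(** The approximate signs S are smooth and vanish at 0 because [in_W10] is a closure of test
    functions: if test functions approximate u, their images under S are again test functions, and
    the chain rule passes to the limit without truncations.

    The obstacle is the convection term. An Euler iterate u1 is not known to be bounded, so f is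
    Lipschitz only where u1 is close to the bounded comparison function u2. Elsewhere the flux is
    controlled only through the integrability that [is_A] grants; away from 0 the derivatives of the
    rescaled signs must therefore be dominated by the derivative of a single one. The logistic
    function has this property, and its derivative is a polynomial in itself.

    As [weak_gradient] is a choice, computing it rests on uniqueness, hence on the fundamental lemma
    of the calculus of variations.

    Iterates may be slightly negative although their limit is not; the comparison between beta and J
    therefore carries an extra term of the size of the negative part. The decay is read off one
    inequality that is linear in T, with a constant independent of T. *)

(** * Topology and Borel sets of R^n through boxes *)

Section rV_borel.
Variables (R : realType) (n : nat).
Local Notation leb := (lebesgue_rV R n).

Lemma measurable_rV_box (A : 'I_n -> set R) :
  (forall i, measurable (A i)) ->
  measurable [set x : 'rV[R]_n | forall i, A i (x ord0 i)].
Proof.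
move=> mA.
rewrite (_ : mkset _ = \bigcap_(i in [set: 'I_n])
    ((fun x : 'rV[R]_n => x ord0 i : measurableTypeR R) @^-1` A i)).
  apply: fin_bigcap_measurable => // i _.
  by have := @measurable_coor R n i measurableT (A i) (mA i); rewrite setTI.
by apply/seteqP; split => x /= H i; [move=> _; exact: H | exact: (H i I)].
Qed.

Lemma rV_ballP (x y : 'rV[R]_n) (e : R) : 0 < e ->
  ball x e y <-> forall i, `|x ord0 i - y ord0 i| < e.
Proof.
move=> e0; rewrite /ball /= /mx_ball; split.
  by move=> [_ H] i; have := H ord0 i; rewrite /ball /=.
by move=> H; split => // i j; rewrite (ord1 i) /ball /=; exact: H.
Qed.

Definition box (a b : 'I_n -> R) : set 'rV[R]_n := [set x | forall i, `]a i, b i[%classic (x ord0 i)].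
Definition cbox (a b : 'I_n -> R) : set 'rV[R]_n := [set x | forall i, `[a i, b i]%classic (x ord0 i)].

Lemma measurable_box a b : measurable (box a b).
Proof. by apply: (@measurable_rV_box (fun i => `]a i, b i[%classic)) => i; exact: measurable_itv. Qed.

Lemma box_sub_cbox a b : box a b `<=` cbox a b.
Proof.
by move=> x H i; have := H i; rewrite /= !in_itv /= => /andP[? ?]; rewrite !ltW.
Qed.

(** Corners of the box with rational centre [z.1] and half-width 1 / (z.2 + 1). The index type is
    countable, so these boxes form a countable base of the topology. *)
Definition rat_box_l (z : 'rV[rat]_n * nat) i : R := ratr (z.1 ord0 i) - z.2.+1%:R^-1.
Definition rat_box_r (z : 'rV[rat]_n * nat) i : R := ratr (z.1 ord0 i) + z.2.+1%:R^-1.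

(** Two forms of the box appear: the open one is a neighbourhood of [x], the closed one is a compact
    subset of [A], on which a locally integrable function is integrable. *)
Lemma open_rat_box (A : set 'rV[R]_n) x : open A -> A x ->
  exists2 z, box (rat_box_l z) (rat_box_r z) x & cbox (rat_box_l z) (rat_box_r z) `<=` A.
Proof.
move=> oA Ax.
have /nbhs_ballP[e /= e0 eA] : nbhs x A by exact: open_nbhs_nbhs.
(* Half-width below [e / 2]: a point of the closed box is then within [e] of [x] in every
   coordinate. *)
have [k _ /(_ k (leqnn k)) ke] := near_infty_natSinv_lt (PosNum (divr_gt0 e0 (@ltr0Sn R 1))).
rewrite /= in ke.
have k0 : 0 < k.+1%:R^-1 :> R by rewrite invr_gt0.
move: ke k0 (erefl (k.+1%:R^-1 : R)); move: {1 2 3}(k.+1%:R^-1 : R) => ek ke k0 ekE.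
have /choice[c Hc] : forall i : 'I_n, exists r : rat, `|x ord0 i - ratr r| < ek.
  move=> i; move: (x ord0 i) => xi.
  have [|r] := @rat_in_itvoo R (xi - ek) (xi + ek).
    by lra.
  rewrite in_itv /= => /andP[r1 r2]; exists r; rewrite ltr_norml; lra.
exists (\row_i c i, k) => [i|y By]; rewrite /rat_box_l /rat_box_r /=.
  by rewrite mxE -ekE in_itv /=; have := Hc i; rewrite ltr_norml => /andP[? ?]; apply/andP; split; lra.
apply: eA; apply/rV_ballP => // i.
have := By i; rewrite /rat_box_l /rat_box_r /= mxE -ekE in_itv /= => /andP[y1 y2].
by have := Hc i; rewrite !ltr_norml => /andP[? ?]; apply/andP; split; lra.
Qed.

(** The sigma-algebra is generated by the coordinates, so an open set is written as the countable
    union of the rational boxes that it contains. *)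
Lemma open_measurable_rV (A : set 'rV[R]_n) : open A -> measurable A.
Proof.
move=> oA; pose B z := box (rat_box_l z) (rat_box_r z).
pose F z := if `[< B z `<=` A >] then B z else set0.
have -> : A = \bigcup_z F z.
  apply/seteqP; split => [x Ax|x [z _]]; last first.
    by rewrite /F; case: asboolP => // BA; exact: BA.
  have [z zx zA] := open_rat_box oA Ax; exists z => //.
  by rewrite /F; case: asboolP => // -[]; exact: subset_trans (@box_sub_cbox _ _) zA.
apply: countable_bigcupT_measurable => [|z]; first exact: countableP.
by rewrite /F; case: ifP => _ //; exact: measurable_box.
Qed.

Lemma open_preimage_measurable (f : 'rV[R]_n -> R) (D : set 'rV[R]_n) :
  measurable D -> (forall a : R, open [set x | a < f x]) -> measurable_fun D f.
Proof.
move=> mD H; apply: (measurability _ (measurable_realfun.RGenOInfty.measurableE R)) => //.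
move=> /= _ [_ [a ->] <-]; apply: measurableI => //.
apply: open_measurable_rV; have := H a; congr open.
by apply/seteqP; split => x /=; rewrite in_itv /= andbT.
Qed.

Lemma continuous_measurable_rV (f : 'rV[R]_n -> R) (D : set 'rV[R]_n) :
  measurable D -> continuous f -> measurable_fun D f.
Proof.
move=> mD cf; apply: open_preimage_measurable => // a.
have -> : [set x | a < f x] = f @^-1` [set y | a < y] by [].
apply: open_comp => [x _|]; first exact: cf.
exact: open_gt.
Qed.

Lemma closed_measurable_rV (A : set 'rV[R]_n) : closed A -> measurable A.
Proof.
by move=> cA; rewrite -[A]setCK; apply: measurableC; apply: open_measurable_rV; exact: closed_openC.
Qed.

Lemma compact_measurable_rV (A : set 'rV[R]_n) : compact A -> measurable A.
Proof.
move=> /compact_closed cA; apply: closed_measurable_rV; apply: cA.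
exact: norm_hausdorff.
Qed.

Lemma compact_cbox a b : compact (cbox a b).
Proof. by apply: (@rV_compact _ _ (fun i => `[a i, b i]%classic)) => i; exact: segment_compact. Qed.

Lemma closed_cbox a b : closed (cbox a b).
Proof. by have /compact_closed := @compact_cbox a b; apply; exact: norm_hausdorff. Qed.

Lemma measurable_cbox a b : measurable (cbox a b).
Proof. exact: closed_measurable_rV (@closed_cbox a b). Qed.

Definition cube (M : R) : set 'rV[R]_n := [set x | forall i, `[- M, M]%classic (x ord0 i)].

Lemma bounded_sub_cube (A : set 'rV[R]_n) : bounded_set A ->
  exists2 M : R, 0 < M & A `<=` cube M.
Proof.
move=> [M [Mr H]]; exists (`|M| + 1); first by rewrite ltr_wpDl.
move=> x Ax i; have := H (`|M| + 1); rewrite (_ : _ < _); last first.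
  by rewrite (le_lt_trans (ler_norm _))// ltrDl.
move=> /(_ isT x Ax) /= xM.
have : `|x ord0 i| <= `|M| + 1.
  apply: le_trans xM; rewrite [leRHS]mx_normrE.
  exact: (le_bigmax_cond _ (fun i : 'I_1 * 'I_n => `|x i.1 i.2|) (j := (ord0, i))).
by rewrite /= in_itv /= ler_norml.
Qed.

Lemma measurable_cube M : measurable (cube M).
Proof. by apply: (@measurable_rV_box (fun=> `[- M, M]%classic)) => i; exact: measurable_itv. Qed.

Lemma compact_cube M : compact (cube M).
Proof. by apply: (@rV_compact _ _ (fun=> `[- M, M]%classic)) => i; exact: segment_compact. Qed.

Lemma lebesgue_cube_lty M : (leb (cube M) < +oo)%E.
Proof.
rewrite (_ : leb (cube M) = (\prod_(i < n) @lebesgue_measure R `[(- M)%R, M]%classic)%E).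
  rewrite big_const_ord; elim: (n) => [|k IH]; first by rewrite /= ltry.
  rewrite iterS lte_mul_pinfty//.
  by rewrite lebesgue_measure_itv /=; case: ifP.
apply: (@lebesgue_rV_box _ _ (fun=> `[- M, M]%classic)) => i; exact: measurable_itv.
Qed.

Lemma bounded_lebesgue_lty (A : set 'rV[R]_n) : measurable A -> bounded_set A ->
  (leb A < +oo)%E.
Proof.
move=> mA /bounded_sub_cube[M _ AM]; apply: le_lt_trans (lebesgue_cube_lty M).
by apply: le_measure => //; rewrite inE//; exact: measurable_cube.
Qed.

End rV_borel.

(** * Calculus of smooth functions *)

Section smooth_calculus.
Variables (R : realType) (V : normedModType R).
Implicit Types (f g : V -> R) (x v : V).

(** Brings directional derivatives back to the real line, where the one-variable chain rule is
    available. *)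
Lemma is_derive_line f x v (df : R) :
  is_derive x v f df <-> is_derive (0 : R) 1 (fun h : R => f (h *: v + x)) df.
Proof.
have E : 'D_v f x = 'D_1 (fun h : R => f (h *: v + x)) 0.
  rewrite /derive; set F := fun h : R => h^-1 *: _; set G := fun h : R => h^-1 *: _.
  suff -> : F = G by [].
  by apply/funext => h; rewrite /F /G /= [h *: 1]mulr1 addr0 scale0r add0r.
split=> -[H1 H2].
  by have H := (derivable1P f x v).1 H1; apply: DeriveDef => //; rewrite -E.
by have H := (derivable1P f x v).2 H1; apply: DeriveDef => //; rewrite E.
Qed.

Lemma is_derive_comp_real (s : R -> R) f x v (a b : R) :
  is_derive (f x) 1 s a -> is_derive x v f b -> is_derive x v (s \o f) (a * b).
Proof.
move=> sa /is_derive_line fb; apply/is_derive_line.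
have := @is_derive1_comp R s (fun h : R => f (h *: v + x)) 0 a b.
by rewrite scale0r add0r; apply.
Qed.

Lemma smooth_continuous f : smooth f -> continuous f.
Proof. by move=> /(_ 0%N). Qed.

Lemma smooth_derivable f x v : smooth f -> derivable f x v.
Proof. by move=> /(_ 1%N)[H _]. Qed.

Lemma smooth_is_derive f x v : smooth f -> is_derive x v f ('D_v f x).
Proof. by move=> sf; apply: DeriveDef => //; exact: smooth_derivable. Qed.

Lemma smooth_derive f v : smooth f -> smooth ('D_v f).
Proof. by move=> sf k; have [_] := sf k.+1; exact. Qed.

Lemma is_derive_smooth f (df : V -> V -> R) : continuous f ->
  (forall x v, is_derive x v f (df v x)) -> (forall v, smooth (df v)) -> smooth f.
Proof.
move=> cf fdf sdf [|k] //; split=> [x v|v]; first by have [] := fdf x v.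
rewrite (_ : 'D_v f = df v); first exact: sdf.
by apply/funext => x; have [_] := fdf x v.
Qed.

Lemma Ck_cst k (c : R) : Ck k (cst c : V -> R).
Proof.
elim: k c => [|k IH] c; first exact: cst_continuous.
split=> [x v|v]; first exact: derivable_cst.
by rewrite (_ : 'D_v _ = cst 0) //; apply/funext => x; rewrite derive_cst.
Qed.

Lemma CkD k f g : Ck k f -> Ck k g -> Ck k (fun x => f x + g x).
Proof.
elim: k f g => [|k IH] f g; first by move=> cf cg x; apply: continuousD; [exact: cf|exact: cg].
move=> [df cdf] [dg cdg]; split=> [x v|v]; first exact: derivableD.
rewrite (_ : 'D_v _ = fun x => 'D_v f x + 'D_v g x); first exact: (IH _ _ (cdf v) (cdg v)).
by apply/funext => x; rewrite -deriveD.
Qed.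

(** All orders up to [k] are assumed because [Ck k] speaks of directional derivatives only and does
    not give lower orders at once, while Leibniz's rule multiplies derivatives by the
    undifferentiated factors. *)
Lemma CkM k f g : (forall j, (j <= k)%N -> Ck j f) -> (forall j, (j <= k)%N -> Ck j g) ->
  Ck k (fun x => f x * g x).
Proof.
elim: k f g => [|k IH] f g cf cg.
  by move=> x; apply: continuousM; [exact: (cf 0%N)|exact: (cg 0%N)].
have [df cdf] := cf _ (leqnn _); have [dg cdg] := cg _ (leqnn _).
split=> [x v|v]; first exact: derivableM.
rewrite (_ : 'D_v _ = fun x => f x * 'D_v g x + g x * 'D_v f x).
  apply: CkD; apply: IH => j jk.
  - by apply: cf; exact: leqW.
  - by have [_] := cg j.+1 jk; exact.
  - by apply: cg; exact: leqW.
  - by have [_] := cf j.+1 jk; exact.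
by apply/funext => x; rewrite [LHS](deriveM (f := f) (g := g)).
Qed.

Lemma smooth_cst (c : R) : smooth (fun _ : V => c).
Proof. by move=> k; exact: (Ck_cst k c). Qed.

Lemma smoothD f g : smooth f -> smooth g -> smooth (fun x => f x + g x).
Proof. by move=> sf sg k; exact: CkD. Qed.

Lemma smoothM f g : smooth f -> smooth g -> smooth (fun x => f x * g x).
Proof. by move=> sf sg k; apply: CkM => j _; [exact: sf|exact: sg]. Qed.

Lemma smoothN f : smooth f -> smooth (fun x => - f x).
Proof.
move=> sf; rewrite (_ : (fun _ => _) = fun x => -1 * f x); last first.
  by apply/funext => x; rewrite mulN1r.
by apply: smoothM => //; exact: smooth_cst.
Qed.

Lemma smoothB f g : smooth f -> smooth g -> smooth (fun x => f x - g x).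
Proof. by move=> sf sg; apply: smoothD => //; exact: smoothN. Qed.

Lemma smooth_prod (I : Type) (r : seq I) (F : I -> V -> R) :
  (forall i, smooth (F i)) -> smooth (fun x => \prod_(i <- r) F i x).
Proof.
move=> sF; elim: r => [|i r IH].
  by under eq_fun do rewrite big_nil; exact: smooth_cst.
by under eq_fun do rewrite big_cons; exact: smoothM.
Qed.

Lemma derive_smooth_comp (s : R -> R) f v : smooth s -> smooth f ->
  'D_v (fun x => s (f x)) = fun x => 'D_1 s (f x) * 'D_v f x.
Proof.
move=> ss sf; apply/funext => x.
by have [_] := is_derive_comp_real (DeriveDef (proj1 (ss 1%N) (f x) 1) erefl) (smooth_is_derive x v sf).
Qed.

End smooth_calculus.

(** Strong induction on the order, with [s] general: differentiating replaces [s] by ['D_1 s], and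
    the product rule asks for all lower orders. *)
Lemma smooth_comp (R : realType) (V : normedModType R) (s : R -> R) (f : V -> R) :
  smooth s -> smooth f -> smooth (fun x => s (f x)).
Proof.
move=> ss sf k; elim/ltn_ind: k s ss => -[|k] IH s ss.
  by move=> x; apply: continuous_comp; [exact: smooth_continuous|exact: smooth_continuous].
split=> [x v|v].
  by have [] := is_derive_comp_real (smooth_is_derive (f x) 1 ss) (smooth_is_derive x v sf).
rewrite derive_smooth_comp//; apply: CkM => j jk.
  by apply: (IH j _ ('D_1 s)); [rewrite ltnS|exact: smooth_derive].
exact: smooth_derive.
Qed.

Lemma is_derive_smooth_real (R : realType) (s ds : R -> R) :
  (forall t : R, is_derive t 1 s (ds t)) -> smooth ds -> smooth s.
Proof.
move=> sds sm; apply: (@is_derive_smooth _ _ _ (fun v t => ds t * v)) => [t|t v|v].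
- by apply: differentiable_continuous; apply/derivable1_diffP; have [] := sds t.
- exact: (is_derive_comp_real (f := id) (sds t)).
- by apply: smoothM => //; exact: smooth_cst.
Qed.

Lemma smooth_id (R : realType) : smooth (fun t : R => t).
Proof. by apply: (@is_derive_smooth_real _ _ (fun=> 1)); exact: smooth_cst. Qed.

Lemma smooth_coor (R : realType) n (i : 'I_n) : smooth (fun x : 'rV[R]_n => x ord0 i).
Proof.
apply: (@is_derive_smooth R 'rV[R]_n (fun x => x ord0 i) (fun v _ => v ord0 i)) => [|x v|v].
- exact: coord_continuous.
- apply/is_derive_line; rewrite (_ : (fun _ => _) = fun h : R => h * v ord0 i + x ord0 i).
    by apply: is_derive_eq; rewrite /= addr0 scaler0 add0r; rewrite [LHS]mulr1.
  by apply/funext => h; rewrite !mxE.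
- exact: smooth_cst.
Qed.

Lemma is_derive_invr (R : realType) (f : R -> R) (t df : R) :
  f t != 0 -> is_derive t 1 f df -> is_derive t 1 (fun x => (f x)^-1) (- (f t) ^- 2 * df).
Proof.
by move=> ft0 [d <-]; apply: DeriveDef; [exact: derivableV|rewrite deriveV].
Qed.

(** * A smooth function that is flat at the origin *)

Section flat_function.
Variable R : realType.

(** The span of this family is stable under differentiation. *)
Definition flat j (t : R) : R := if 0 < t then t^-1 ^+ j * expR (- t^-1) else 0.

Lemma flat_le0 j t : t <= 0 -> flat j t = 0.
Proof. by rewrite /flat ltNge => ->. Qed.

Lemma flat_ge0 j t : 0 <= flat j t.
Proof.
rewrite /flat; case: ifPn => // t0.
by rewrite mulr_ge0 ?expR_ge0// exprn_ge0// invr_ge0 ltW.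
Qed.

Lemma flat0_le1 t : flat 0 t <= 1.
Proof.
rewrite /flat; case: ifPn => // t0.
by rewrite expr0 mul1r -expR0 ler_expR oppr_le0 invr_ge0 ltW.
Qed.

(** The exponential at [t^-1] dominates the term of degree j + 2 of its series. A quadratic bound is
    what makes the difference quotients at 0 vanish. *)
Lemma flat_le_sqr j t : flat j t <= (j.+2)`!%:R * t ^+ 2.
Proof.
rewrite /flat; case: ifPn => [t0|_]; last by rewrite mulr_ge0// sqr_ge0.
rewrite expRN ler_pdivrMr ?expR_gt0//.
have z0 : 0 <= t^-1 by rewrite invr_ge0 ltW.
have H : t^-1 ^+ j.+2 / (j.+2)`!%:R <= expR t^-1.
  by apply: le_trans (expR_ge1Dxn j.+1 z0); rewrite lerDr.
have -> : t^-1 ^+ j = t^-1 ^+ j.+2 * t ^+ 2.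
  by rewrite -addn2 exprD exprVn -mulrA -exprMn mulVf ?gt_eqF// expr1n mulr1.
move: H; rewrite ler_pdivrMr ?ltr0n ?fact_gt0// => H.
by rewrite [leRHS]mulrAC ler_wpM2r ?sqr_ge0// mulrC.
Qed.

Lemma is_derive_flat j (t : R) : is_derive t 1 (flat j) (flat j.+2 t - j%:R * flat j.+1 t).
Proof.
have [t0|t0|->] := ltgtP t 0.
- rewrite !flat_le0 ?ltW// mulr0 subr0.
  apply: (near_eq_is_derive (f := cst 0)).
  by near=> y; rewrite flat_le0// ltW//; near: y; exact: lt_nbhsl.
- rewrite {2 3}/flat t0.
  apply: (near_eq_is_derive (f := fun t : R => t^-1 ^+ j * expR (- t^-1) : R)).
    by near=> y; rewrite /flat ifT//; near: y; exact: lt_nbhsr.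
  have tn0 : t != 0 by rewrite gt_eqF.
  have dV : is_derive t 1 (fun t : R => t^-1) (- t^-2).
    by rewrite -[X in is_derive _ _ _ X]mulr1; exact: is_derive_invr.
  have dE : is_derive t 1 (fun t : R => expR (- t^-1)) (expR (- t^-1) * t^-2).
    apply: (is_derive_comp_real (s := expR) (f := fun t : R => - t^-1)).
    by apply: is_derive_eq; rewrite opprK.
  have dX : is_derive t 1 (fun t : R => t^-1 ^+ j) (j%:R * t^-1 ^+ j.-1 * (- t^-2)).
    apply: (is_derive_comp_real (s := fun t : R => t ^+ j) (f := fun t : R => t^-1)).
    apply: DeriveDef; first exact: exprn_derivable.
    by rewrite exp_derive /GRing.scale /= mulr1.
  have -> : t^-1 ^+ j.+2 * expR (- t^-1) - j%:R * (t^-1 ^+ j.+1 * expR (- t^-1)) =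
      t^-1 ^+ j *: (expR (- t^-1) * t^-2) + expR (- t^-1) *: (j%:R * t^-1 ^+ j.-1 * (- t^-2)).
    rewrite /GRing.scale /= -exprVn; case: j dX => [|j] _ /=; rewrite ?exprS; ring.
  exact: is_deriveM.
- rewrite !flat_le0// mulr0 subr0.
  have cv : (h^-1 *: ((flat j \o shift 0) (h *: (1 : R)) - flat j 0) @[h --> (0:R)^']) --> (0:R).
    apply: (@cvg_to_0_linear _ _ (j.+2)`!%:R 1) => // h /andP[h0 _].
    rewrite /= [h *: 1]mulr1 addr0 (flat_le0 j (lexx 0)) subr0.
    rewrite [_ *: _]/GRing.scale /= normrM normfV mulrC ler_pdivrMr//.
    rewrite ger0_norm ?flat_ge0// -mulrA -expr2 real_normK ?num_real//.
    exact: flat_le_sqr.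
  by apply: DeriveDef; [apply/cvg_ex; exists 0|exact/cvg_lim].
Unshelve. all: by end_near. Qed.

Lemma smooth_flat j : smooth (flat j).
Proof.
move=> k; elim/ltn_ind: k j => -[|k] IH j.
  by move=> t; apply: differentiable_continuous; apply/derivable1_diffP; have [] := is_derive_flat j t.
have dflat t v : is_derive t v (flat j) ((flat j.+2 t - j%:R * flat j.+1 t) * v).
  exact: (@is_derive_comp_real R R (flat j) id t v _ v (is_derive_flat j t) _).
split=> [t v|v]; first by have [] := dflat t v.
have -> : 'D_v (flat j) = fun t => v * flat j.+2 t + (- (v * j%:R)) * flat j.+1 t.
  by apply/funext => t; have [_ ->] := dflat t v; ring.
have CkZ (c : R) i : Ck k (fun t => c * flat i t).
  apply: CkM => l lk; first exact: smooth_cst.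
  exact: IH.
exact: (CkD (CkZ _ _) (CkZ _ _)).
Qed.

End flat_function.


Lemma test_function_supp (R : realType) (V : normedModType R) (D K : set V) (f : V -> R) :
  smooth f -> compact K -> K `<=` D -> (forall x, ~ K x -> f x = 0) -> test_function D f.
Proof.
move=> sf cK KD f0.
have clK : closed K by apply: compact_closed cK; exact: norm_hausdorff.
have sub : closure [set x | f x != 0] `<=` K.
  rewrite (closure_id K).1//; apply: closure_subset => x /=.
  by apply: contra_neqP => /f0.
split=> //; last exact: subset_trans KD.
exact: subclosed_compact (@closed_closure _ _) cK sub.
Qed.

(** * Smooth bumps on boxes *)

Section box_bumps.
Variables (R : realType) (n : nat).
Implicit Types a b : 'I_n -> R.

(** The factor [k.+1] steepens the ramps, so the bumps converge pointwise to the indicator of the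
    open box and test functions come to determine integrals over boxes. *)
Definition box_bump a b (k : nat) (x : 'rV[R]_n) : R :=
  \prod_(i < n) (flat 0 (k.+1%:R * (x ord0 i - a i)) * flat 0 (k.+1%:R * (b i - x ord0 i))).

Lemma smooth_bump a b k : smooth (box_bump a b k).
Proof.
apply: smooth_prod => i; apply: smoothM.
- apply: (smooth_comp (@smooth_flat R 0%N)); apply: smoothM; first exact: smooth_cst.
  by apply: smoothB; [exact: smooth_coor|exact: smooth_cst].
- apply: (smooth_comp (@smooth_flat R 0%N)); apply: smoothM; first exact: smooth_cst.
  by apply: smoothB; [exact: smooth_cst|exact: smooth_coor].
Qed.

Lemma bump_ge0 a b k x : 0 <= box_bump a b k x.
Proof. by apply: prodr_ge0 => i _; rewrite mulr_ge0 ?flat_ge0. Qed.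

Lemma bump_le1 a b k x : box_bump a b k x <= 1.
Proof.
suff : 0 <= box_bump a b k x <= 1 by case/andP.
rewrite /box_bump; elim/big_rec: _ => [|i y _ /andP[y0 y1]]; first by rewrite ler01 lexx.
rewrite mulr_ge0 ?mulr_ge0 ?flat_ge0//= mulr_ile1 ?mulr_ge0 ?flat_ge0//.
by rewrite mulr_ile1 ?flat_ge0 ?flat0_le1.
Qed.

Lemma bump_out a b k x : ~ box a b x -> box_bump a b k x = 0.
Proof.
move=> /existsNP[i /negP]; rewrite /= in_itv /= negb_and -!leNgt => H.
apply/eqP/prodf_eq0; exists i => //; rewrite mulf_eq0.
by case/orP: H => H; apply/orP; [left|right]; apply/eqP/flat_le0; rewrite pmulr_rle0// subr_le0.
Qed.

Lemma bump_test a b k (D : set 'rV[R]_n) : cbox a b `<=` D -> test_function D (box_bump a b k).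
Proof.
move=> abD; apply: (test_function_supp _ (@compact_cbox R n a b)) => //.
  exact: smooth_bump.
by move=> x nx; apply: bump_out => /box_sub_cbox.
Qed.

Lemma flat0_cvg1 (c : R) : 0 < c -> flat 0 (k.+1%:R * c) @[k --> \oo] --> (1 : R).
Proof.
move=> c0.
have -> : (fun k : nat => flat 0 (k.+1%:R * c)) = (fun k : nat => expR (- (k.+1%:R^-1 * c^-1))).
  apply/funext => k; rewrite /flat mulr_gt0// expr0 mul1r invfM//.
rewrite -[X in _ --> X]expR0; apply: continuous_cvg; first exact: continuous_expR.
have : k.+1%:R^-1 * c^-1 @[k --> \oo] --> (0 * c^-1 : R) by apply: cvgMl; exact: cvg_harmonic.
by rewrite mul0r => /cvgN; rewrite oppr0.
Qed.

Lemma cvg_prod_ord (m : nat) (F : 'I_m -> nat -> R) (l : 'I_m -> R) :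
  (forall i, F i k @[k --> \oo] --> l i) ->
  (\prod_(i < m) F i k) @[k --> \oo] --> \prod_(i < m) l i.
Proof.
elim: m F l => [|m IH] F l H.
  rewrite big_ord0; under eq_fun do rewrite big_ord0; exact: cvg_cst.
rewrite big_ord_recl; under eq_fun do rewrite big_ord_recl.
by apply: cvgM => //; apply: IH => i; exact: H.
Qed.

Lemma bump_cvg a b x : box_bump a b k x @[k --> \oo] --> (\1_(box a b) x : R).
Proof.
have [xb|xb] := pselect (box a b x); last first.
  rewrite indicE memNset//; under eq_fun do rewrite bump_out//.
  exact: cvg_cst.
rewrite indicE mem_set// (_ : 1%:R = \prod_(i < n) (1 * 1)); last first.
  by rewrite big1// => i _; rewrite mulr1.
apply: cvg_prod_ord => i; have := xb i; rewrite /= in_itv /= => /andP[? ?].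
by apply: cvgM; apply: flat0_cvg1; rewrite subr_gt0.
Qed.

End box_bumps.

(** * The logistic function *)

Section logistic.
Variable R : realType.

Definition logistic (t : R) : R := (1 + expR (- t))^-1.

Lemma logistic_gt0 t : 0 < logistic t.
Proof. by rewrite invr_gt0 addr_gt0 ?expR_gt0. Qed.

Lemma logistic_lt1 t : logistic t < 1.
Proof. by rewrite invf_lt1 ?addr_gt0 ?expR_gt0// ltrDl expR_gt0. Qed.

Lemma is_derive_logistic (t : R) : is_derive t 1 logistic (logistic t * (1 - logistic t)).
Proof.
have n0 : 1 + expR (- t) != 0 by rewrite gt_eqF// addr_gt0 ?expR_gt0.
have dE : is_derive t 1 (fun t : R => 1 + expR (- t)) (- expR (- t)).
  have d1 : is_derive t 1 (fun t : R => expR (- t)) (expR (- t) * -1).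
    exact: (is_derive_comp_real (s := expR) (f := fun t : R => - t)).
  by rewrite -mulrN1 -[X in is_derive _ _ _ X]add0r; exact: is_deriveD.
have -> : logistic t * (1 - logistic t) = - (1 + expR (- t)) ^- 2 * - expR (- t).
  by rewrite /logistic; field.
exact: is_derive_invr.
Qed.

(** The derivative is a polynomial in [logistic] itself, so regularity bootstraps by strong
    induction. *)
Lemma smooth_logistic : smooth logistic.
Proof.
move=> k; elim/ltn_ind: k => -[|k] IH.
  by move=> t; apply: differentiable_continuous; apply/derivable1_diffP; have [] := is_derive_logistic t.
have dl (t v : R) : is_derive t v logistic ((logistic t * (1 - logistic t)) * v).
  exact: (@is_derive_comp_real R R logistic id t v _ v (is_derive_logistic t) _).
split=> [t v|v]; first by have [] := dl t v.
have -> : 'D_v logistic = fun t => v * (logistic t * (1 + (-1) * logistic t)).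
  by apply/funext => t; have [_ ->] := dl t v; ring.
have C1 j : Ck j (fun _ : R => 1 : R) by exact: smooth_cst.
apply: CkM => j jk; first exact: smooth_cst.
apply: CkM => i ij; first by apply: IH; rewrite ltnS (leq_trans ij).
apply: CkD; first exact: C1.
apply: CkM => l li; first exact: smooth_cst.
by apply: IH; rewrite ltnS (leq_trans li)// (leq_trans ij).
Qed.

End logistic.

(** * Supports and test functions *)

Section integral_support.
Context d (T : measurableType d) (R : realType) (mu : {measure set T -> \bar R}).
Variables (D K : set T).
Hypotheses (mD : measurable D) (mK : measurable K) (KD : K `<=` D).

Lemma patch_supp (f : T -> \bar R) : (forall x, D x -> ~ K x -> f x = 0%E) -> f \_ D = f \_ K.
Proof.
move=> f0; apply/funext => x; rewrite !patchE.
have [Kx|nKx] := pselect (K x); first by rewrite !mem_set//; exact: KD.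
rewrite (memNset nKx); have [Dx|nDx] := pselect (D x); last by rewrite memNset.
by rewrite mem_set// f0.
Qed.

Lemma integrable_supp (f : T -> \bar R) : (forall x, D x -> ~ K x -> f x = 0%E) ->
  mu.-integrable K f -> mu.-integrable D f.
Proof. by move=> f0; rewrite (integrable_mkcond _ mK) (integrable_mkcond _ mD) patch_supp. Qed.

Lemma integral_supp (f : T -> \bar R) : (forall x, D x -> ~ K x -> f x = 0%E) ->
  (\int[mu]_(x in D) f x = \int[mu]_(x in K) f x)%E.
Proof. by move=> f0; rewrite integral_mkcond patch_supp// -integral_mkcond. Qed.

Lemma Rintegral_supp (f : T -> R) : (forall x, D x -> ~ K x -> f x = 0) ->
  \int[mu]_(x in D) f x = \int[mu]_(x in K) f x.
Proof. by move=> f0; rewrite /Rintegral integral_supp// => x Dx nK; rewrite f0. Qed.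

End integral_support.

Section test_functions.
Variables (R : realType) (n : nat).
Local Notation leb := (lebesgue_rV R n).
Variable Omega : set 'rV[R]_n.
Hypothesis oO : open Omega.
Implicit Types phi psi : 'rV[R]_n -> R.

Lemma test_function_suppP phi : test_function Omega phi ->
  exists K, [/\ compact K, K `<=` Omega & forall x, ~ K x -> phi x = 0].
Proof.
move=> [_ cK KO]; exists (closure [set x | phi x != 0]); split => // x nx.
by apply: contrapT => /eqP px; apply: nx; exact: subset_closure.
Qed.

Lemma continuous_supp_bounded phi (K : set 'rV[R]_n) : continuous phi -> compact K ->
  (forall x, ~ K x -> phi x = 0) -> exists2 M : R, 0 <= M & forall x, `|phi x| <= M.
Proof.
move=> cphi cK phi0.
have cphiK : {within K, continuous phi} by apply: continuous_subspaceT.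
have [K0|/set0P[x0 Kx0]] := eqVneq K set0.
  by exists 0 => // x; rewrite phi0 ?normr0// K0.
have [M [_ HM]] := compact_bounded (continuous_compact cphiK cK).
exists (`|M| + 1); first by rewrite addr_ge0.
move=> x; have [Kx|nKx] := pselect (K x); last by rewrite phi0// normr0 addr_ge0.
by apply: (HM (`|M| + 1)); [rewrite (le_lt_trans (ler_norm _))// ltrDl|exists x].
Qed.

Lemma test_function_bounded phi : test_function Omega phi ->
  exists2 M : R, 0 <= M & forall x, `|phi x| <= M.
Proof.
move=> tphi; have [K [cK _ phi0]] := test_function_suppP tphi.
apply: continuous_supp_bounded cK phi0.
by have [/smooth_continuous] := tphi.
Qed.

Lemma derive_supp phi v (K : set 'rV[R]_n) : compact K -> (forall x, ~ K x -> phi x = 0) ->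
  forall x, ~ K x -> 'D_v phi x = 0.
Proof.
move=> cK phi0 x nKx.
have clK : closed K by have /compact_closed := cK; apply; exact: norm_hausdorff.
have : \forall y \near x, cst (0:R) y = phi y.
  near=> y; rewrite /= phi0//; near: y.
  have : nbhs x (~` K) by apply: open_nbhs_nbhs; split => //; exact: closed_openC.
  exact.
by move=> /near_eq_is_derive/(_ (is_derive_cst (0 : R) x v))[_ ->].
Unshelve. all: by end_near. Qed.

Lemma test_function_derive phi v : test_function Omega phi -> test_function Omega ('D_v phi).
Proof.
move=> tphi; have [K [cK KO phi0]] := test_function_suppP tphi.
have [sphi _ _] := tphi.
apply: (test_function_supp (smooth_derive v sphi) cK KO).
exact: derive_supp.
Qed.

Lemma test_functionM phi psi : smooth phi -> test_function Omega psi ->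
  test_function Omega (fun x => phi x * psi x).
Proof.
move=> sphi tpsi; have [K [cK KO psi0]] := test_function_suppP tpsi.
have [spsi _ _] := tpsi.
apply: (test_function_supp (smoothM sphi spsi) cK KO) => x nKx.
by rewrite psi0// mulr0.
Qed.

Lemma test_function_measurable (D : set 'rV[R]_n) phi : measurable D ->
  test_function Omega phi -> measurable_fun D phi.
Proof.
by move=> mD [/smooth_continuous c _ _]; exact: continuous_measurable_rV.
Qed.

Let mO : measurable Omega := open_measurable_rV oO.

Lemma L1loc_mul_test (g phi : 'rV[R]_n -> R) : in_L1loc Omega g -> test_function Omega phi ->
  leb.-integrable Omega (fun x => (g x * phi x)%:E).
Proof.
move=> [mg ig] tphi; have [K [cK KO phi0]] := test_function_suppP tphi.
have mK := compact_measurable_rV cK.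
have [M M0 HM] := test_function_bounded tphi.
apply: (integrable_supp mO mK) => // [x _ nK|]; first by rewrite phi0// mulr0.
apply: (@le_integrable _ _ _ _ _ mK _ (fun x => M%:E * (EFin \o g) x)%E).
- apply/measurable_EFinP; apply: measurable_funM.
    by apply: measurable_funS mg.
  exact: test_function_measurable.
- move=> x Kx; rewrite /= lee_fin normrM mulrC normrM ler_wpM2r//.
  by rewrite (ger0_norm M0).
- by apply: integrableZl => //; exact: ig.
Qed.

End test_functions.

(** * Fundamental lemma of the calculus of variations *)

Section fundamental_lemma.
Variables (R : realType) (n : nat).
Local Notation leb := (lebesgue_rV R n).

Definition boxes : set (set 'rV[R]_n) := [set A | exists a b, A = box a b].

Lemma setI_box (a b a' b' : 'I_n -> R) : box a b `&` box a' b' =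
  box (fun i => Num.max (a i) (a' i)) (fun i => Num.min (b i) (b' i)).
Proof.
apply/seteqP; split => [x [H H'] i|x H].
  have := H i; have := H' i; rewrite /= !in_itv /= => /andP[? ?] /andP[? ?].
  by rewrite gt_max lt_min; apply/andP; split; apply/andP.
by split => i; have := H i; rewrite /= !in_itv /= gt_max lt_min => /andP[/andP[? ?] /andP[? ?]];
  apply/andP.
Qed.

Lemma setI_closed_boxes : setI_closed boxes.
Proof. by move=> _ _ [a [b ->]] [a' [b' ->]]; rewrite setI_box; eexists; eexists. Qed.

(** Boxes are stable under intersection; that they also generate the sigma-algebra is what the
    Dynkin argument of [fundamental_lemma] requires. *)
Lemma measurable_rV_boxesE : @measurable _ 'rV[R]_n = <<s boxes>>.
Proof.
apply/seteqP; split; last first.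
  apply: smallest_sub; first exact: sigma_algebra_measurable.
  by move=> _ [a [b ->]]; exact: measurable_box.
apply: smallest_sub; first exact: smallest_sigma_algebra.
rewrite -bigcup_seq => A [i _].
suff mc : measurable_fun [set: g_sigma_algebraType boxes]
    (fun x : g_sigma_algebraType boxes => (x : 'rV[R]_n) ord0 i : R).
  by move=> [Y mY <-]; exact: (mc measurableT Y mY).
apply: (measurability _ (measurable_realfun.RGenOInfty.measurableE R)) => //.
move=> /= _ [_ [a ->] <-]; rewrite setTI.
(* A half-space is exhausted by boxes that are cut off at -k and k in the other coordinates, and at
   k above. *)
pose F (k : nat) := box (fun j => if j == i then a else - k%:R) (fun _ : 'I_n => k%:R : R).
have -> : (fun x : 'rV[R]_n => x ord0 i) @^-1` `]a, +oo[ = \bigcup_k F k.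
  apply/seteqP; split => [x /=|x [k _ /(_ i)]].
    rewrite in_itv /= andbT => ax.
    have [M M0 xM] := bounded_sub_cube (compact_bounded (@compact_set1 _ x)).
    have [k Hk] : exists k : nat, M < k%:R.
      by exists (Num.bound M); rewrite archi_boundP// ltW.
    exists k => // j; have := xM x erefl j.
    rewrite /= !in_itv /= => /andP[x1 x2]; apply/andP; split; last lra.
    by case: eqP => [->//|_]; lra.
  by rewrite /= !in_itv /= eqxx andbT => /andP[].
apply: bigcup_measurable => k _; apply: sub_sigma_algebra.
by eexists; eexists.
Qed.

Variable Omega : set 'rV[R]_n.
Hypothesis oO : open Omega.
Let mO : measurable Omega := open_measurable_rV oO.

(** The bumps of the box are admissible tests, and dominated convergence replaces them by the
    indicator of the box. *)
Lemma fundamental_lemma_box (g : 'rV[R]_n -> R) a b : in_L1loc Omega g ->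
  (forall phi, test_function Omega phi -> \int[leb]_(x in Omega) (g x * phi x) = 0) ->
  cbox a b `<=` Omega -> (\int[leb]_(x in box a b) (g x)%:E = 0)%E.
Proof.
move=> lg H abO; have [mg ig] := lg.
have ig' := ig _ (@compact_cbox _ _ a b) abO.
have mC := @measurable_cbox _ _ a b; have mB := @measurable_box _ _ a b.
have mgC : measurable_fun (cbox a b) g by exact: measurable_funS mg.
have E k : (\int[leb]_(x in cbox a b) (g x * box_bump a b k x)%:E = 0)%E.
  have tb := bump_test k abO.
  move: (H _ tb); rewrite (@Rintegral_supp _ _ _ leb _ (cbox a b))//; last first.
    by move=> x _ nx; rewrite bump_out ?mulr0// => /box_sub_cbox.
  rewrite /Rintegral => /eqP; rewrite fine_eq0 => [/eqP//|].
  apply: integrable_fin_num => //.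
  by apply: integrableS (L1loc_mul_test oO lg tb).
have : (\int[leb]_(x in cbox a b) (g x * box_bump a b k x)%:E)%E @[k --> \oo] -->
    (\int[leb]_(x in cbox a b) (g x * \1_(box a b) x)%:E)%E.
  apply: (@dominated_cvg _ _ _ leb _ mC _ _ (fun x => `|g x|%:E)) => //.
  - move=> k; apply/measurable_EFinP; apply: measurable_funM => //.
    by apply: continuous_measurable_rV => //; apply: smooth_continuous; exact: smooth_bump.
  - move=> x _; apply: cvg_EFin; first by exact: nearW.
    by apply: cvgM; [exact: cvg_cst|exact: bump_cvg].
  - by apply: integrable_abse ig'.
  - move=> k x _; rewrite lee_fin normrM ler_piMr// ger0_norm ?bump_ge0//.
    exact: bump_le1.
under eq_fun do rewrite E.
move=> /(cvg_unique _ (cvg_cst _)) -> //.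
transitivity (\int[leb]_(x in cbox a b) (g x * \1_(box a b) x)%:E)%E; last first.
  exact/esym.
rewrite (integral_supp leb (@box_sub_cbox _ _ a b) (f := fun x => (g x * \1_(box a b) x)%:E)); last first.
  by move=> x _ nB; rewrite indicE memNset// mulr0.
by apply: eq_integral => x xB; rewrite indicE xB mulr1.
Qed.

(** Inside a closed box contained in [Omega], the measurable sets over which [g] has integral zero
    form a Dynkin system containing the boxes, hence are all measurable sets. Countably many such
    boxes cover [Omega]. *)
Lemma fundamental_lemma (g : 'rV[R]_n -> R) : in_L1loc Omega g ->
  (forall phi, test_function Omega phi -> \int[leb]_(x in Omega) (g x * phi x) = 0) ->
  {ae leb, forall x, Omega x -> g x = 0}.
Proof.
move=> lg H; have [mg ig] := lg.
have main a b : cbox a b `<=` Omega -> {ae leb, forall x, box a b x -> g x = 0}.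
  move=> abO.
  have mB := @measurable_box _ _ a b; have mC := @measurable_cbox _ _ a b.
  have igB : leb.-integrable (box a b) (EFin \o g).
    by apply: integrableS (ig _ (@compact_cbox _ _ a b) abO) => //; exact: box_sub_cbox.
  have P0 E : measurable E -> (\int[leb]_(x in E `&` box a b) (g x)%:E = 0)%E.
    move=> mE; have := mE; rewrite measurable_rV_boxesE.
    apply: (dynkin_induction (P := fun E => (\int[leb]_(x in E `&` box a b) (g x)%:E = 0)%E)
        measurable_rV_boxesE setI_closed_boxes).
    - by rewrite setTI fundamental_lemma_box.
    - move=> _ [a' [b' ->]].
      rewrite setI_box.
      apply: fundamental_lemma_box => //; apply: subset_trans abO => x Hx i.
      by have := Hx i; rewrite /= !in_itv /= ge_max le_min => /andP[/andP[? ?] /andP[? ?]]; apply/andP.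
    - move=> S mS S0.
      have : (\int[leb]_(x in box a b) (g x)%:E = 0)%E by rewrite fundamental_lemma_box.
      rewrite -{1}(setTI (box a b)) -(setvU S) setIUl.
      rewrite integral_setU//; first by rewrite S0 adde0.
      - by apply: measurableI => //; exact: measurableC.
      - exact: measurableI.
      - by rewrite -setIUl setvU setTI; exact: measurable_int igB.
      - by apply/disj_setPS => x [[nS _] [/nS]].
    - move=> F mF tF F0; rewrite setI_bigcupl integral_bigcup//.
      + by rewrite eseries0// => k _ _; exact: F0.
      + exact: trivIset_setIr.
      + by move=> k; exact: measurableI.
      + apply: integrableS igB => //; rewrite -setI_bigcupl.
        - by apply: measurableI => //; exact: bigcup_measurable.
        - exact: subIsetr.
  have /(_ (cst 0%E)) := @integral_ae_eq _ _ _ leb _ mB _ _ igB.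
  move=> /(_ (measurable_cst _)) H'.
  have : ae_eq leb (box a b) (EFin \o g) (cst 0%E).
    apply: H' => E EB mE; rewrite integral0.
    by have := P0 _ mE; rewrite (setIidl EB).
  by apply: filterS => x /= gx Bx; have := gx Bx => -[].
suff : leb.-negligible [set x | ~ (Omega x -> g x = 0)] by [].
(* The exceptional sets are collected over the rational boxes whose closure lies in [Omega]: a
   countable union of null sets. *)
pose N z := if `[< cbox (rat_box_l R z) (rat_box_r R z) `<=` Omega >] then
  box (rat_box_l R z) (rat_box_r R z) `&` [set x | g x <> 0] else set0.
have nN : leb.-negligible (\bigcup_k (if unpickle k is Some z then N z else set0)).
  apply: negligible_bigcup => k; case: unpickle => [z|]; last exact: negligible_set0.
  rewrite /N; case: asboolP => [zO|_]; last exact: negligible_set0.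
  apply: negligibleS (main _ _ zO) => x /= [Bx gx] /(_ Bx).
  exact: gx.
apply: negligibleS nN => x /= /not_implyP[Ox gx].
have [z zx zO] := open_rat_box oO Ox.
by exists (pickle z) => //; rewrite pickleK /N; case: asboolP.
Qed.

End fundamental_lemma.

(** * Integration by parts for test functions *)

Section integration_by_parts.
Variable R : realType.
Local Notation leb1 := (@lebesgue_measure R).

Lemma rV_cons_continuous_r n (a : R) : continuous (fun v : 'rV[R]_n => rV_cons (a, v)).
Proof.
move=> v; suff H (e : R) : 0 < e ->
    \forall w \near nbhs v, ball (rV_cons (a, v)) e (rV_cons (a, w)).
  by apply/(@cvg_ballP _ _ _ (nbhs v) (nbhs_filter v)).
move=> e0; near=> w.
have /(rV_ballP _ _ e0) wv : ball v e w by near: w; exact: (nbhsx_ballx v e e0).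
apply/rV_ballP => // i; rewrite !mxE; case: unliftP => [j _|_]; last by rewrite subrr normr0.
exact: wv.
Unshelve. all: by end_near. Qed.

Lemma rV_cons_continuous_l n (v : 'rV[R]_n) : continuous (fun a : R => rV_cons (a, v)).
Proof.
move=> a; suff H (e : R) : 0 < e ->
    \forall b \near nbhs a, ball (rV_cons (a, v)) e (rV_cons (b, v)).
  by apply/(@cvg_ballP _ _ _ (nbhs a) (nbhs_filter a)).
move=> e0; near=> b; apply/rV_ballP => // i; rewrite !mxE; case: unliftP => [j _|_]; first by rewrite subrr normr0.
by rewrite /=; near: b; exact: (nbhsx_ballx a e e0).
Unshelve. all: by end_near. Qed.

Lemma cube_rV_cons n (M a : R) (v : 'rV[R]_n) :
  cube M (rV_cons (a, v)) -> `[- M, M]%classic a /\ cube M v.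
Proof.
move=> H; split=> [|i]; first by have := H ord0; rewrite mxE unlift_none.
by have := H (lift ord0 i); rewrite mxE liftK.
Qed.

Lemma integral_rV_cons n (f : 'rV[R]_n.+1 -> \bar R) :
  (lebesgue_rV R n.+1).-integrable setT f ->
  (leb1 \x lebesgue_rV R n)%E.-integrable setT (f \o @rV_cons R n) /\
  (\int[lebesgue_rV R n.+1]_x f x = \int[(leb1 \x lebesgue_rV R n)%E]_z f (rV_cons z))%E.
Proof.
move=> /integrableP[mf fi].
have ip : (leb1 \x lebesgue_rV R n)%E.-integrable setT (f \o @rV_cons R n).
  apply/integrableP; split; first exact: measurableT_comp mf (@measurable_rV_cons R n).
  move: fi; rewrite -[X in (\int[X]_(_ in _) _)%E]/(pushforward (leb1 \x lebesgue_rV R n)%E (@rV_cons R n)).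
  rewrite ge0_integral_pushforward//; first exact: measurable_rV_cons.
  exact: measurableT_comp.
split=> //; have := @integral_pushforward _ _ _ _ R _ (@measurable_rV_cons R n) (leb1 \x lebesgue_rV R n)%E setT f mf.
by rewrite preimage_setT; apply.
Qed.

Lemma continuous_supp_integrable n (f : 'rV[R]_n -> R) M : continuous f ->
  (forall x, ~ cube M x -> f x = 0) ->
  (lebesgue_rV R n).-integrable setT (EFin \o f).
Proof.
move=> cf f0; have mC := @measurable_cube R n M.
apply: (@integrable_supp _ _ _ _ setT (@cube R n M)) => // [x _ nx|]; first by rewrite /= f0.
apply: measurable_bounded_integrable => //.
- exact: lebesgue_cube_lty.
- exact: continuous_measurable_rV.
- have [B _ HB] := continuous_supp_bounded cf (@compact_cube R n M) f0.
  by exists B; split; [rewrite num_real|move=> x Bx y _ /=; rewrite (le_trans (HB y))// ltW].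
Qed.

Lemma integral_derive_real (F G : R -> R) (M : R) : continuous G ->
  (forall t : R, is_derive t 1 F (G t)) ->
  (forall t, ~ `[- M, M]%classic t -> F t = 0) ->
  (forall t, ~ `[- M, M]%classic t -> G t = 0) ->
  (\int[leb1]_t (G t)%:E = 0)%E.
Proof.
move=> cG dF F0 G0.
(* At [- N] and [N] the primitive [F] vanishes, whatever the sign of [M]. *)
pose N := `|M| + 1.
have MN : M < N by rewrite /N (le_lt_trans (ler_norm M))// ltrDl.
have N0 : - N < N by rewrite gtrN// /N ltr_wpDl.
have sub : `[- M, M]%classic `<=` `[- N, N]%classic.
  by move=> t /=; rewrite !in_itv /= => /andP[? ?]; apply/andP; split; lra.
rewrite (@integral_supp _ _ _ leb1 setT `[- N, N]%classic)//; last first.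
  by move=> t _ nt; rewrite G0// => /sub.
have cF : continuous F.
  by move=> t; apply: differentiable_continuous; apply/derivable1_diffP; have [] := dF t.
rewrite (@continuous_FTC2 _ G F)//.
- rewrite !F0 ?sube0//= in_itv /=; apply/negP; rewrite negb_and -!ltNge.
    by apply/orP; left; lra.
  by apply/orP; right; lra.
- exact: continuous_subspaceT.
- split; first by move=> t _; have [] := dF t.
  + by apply: cvg_at_right_filter; exact: cF.
  + by apply: cvg_at_left_filter; exact: cF.
- by move=> t _; rewrite derive1E; have [] := dF t.
Qed.

(** Induction on the dimension by Fubini. The inner integral is over the first coordinate if the
    derivative is taken along it, and over the remaining coordinates otherwise. *)
Lemma integral_derive_cube n (F G : 'rV[R]_n -> R) i M : continuous G ->
  (forall x, is_derive x (delta_mx ord0 i) F (G x)) ->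
  (forall x, ~ cube M x -> F x = 0) ->
  (forall x, ~ cube M x -> G x = 0) ->
  (\int[lebesgue_rV R n]_x (G x)%:E = 0)%E.
Proof.
elim: n F G i => [|n IH] F G i cG dF F0 G0; first by case: i dF.
have [iG ->] := integral_rV_cons (continuous_supp_integrable cG G0).
case: (unliftP ord0 i) dF => [j|] -> dF.
- rewrite -(integral12_prod_meas1 iG) integral0_eq// => a _.
  rewrite /fubini_F /=.
  apply: (IH (fun v => F (rV_cons (a, v))) (fun v => G (rV_cons (a, v))) j).
  + move=> v; apply: (@continuous_comp _ _ _ (fun v => rV_cons (a, v)) G).
      exact: rV_cons_continuous_r.
    exact: cG.
  + move=> v; have /is_derive_line := dF (rV_cons (a, v)) => dFl; apply/is_derive_line.
    rewrite (_ : (fun _ => _) = fun h : R => F (h *: delta_mx ord0 (lift ord0 j) + rV_cons (a, v)))//.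
    apply/funext => h; congr F; apply/rowP => k; rewrite !mxE.
    case: (unliftP ord0 k) => [l|] -> /=; rewrite ?mxE ?(inj_eq lift_inj)//.
    by rewrite mulr0 add0r.
  + by move=> v nv; rewrite F0// => /cube_rV_cons[].
  + by move=> v nv; rewrite G0// => /cube_rV_cons[].
- rewrite -(integral21_prod_meas1 iG) integral0_eq// => v _.
  rewrite /fubini_G /=.
  apply: (@integral_derive_real (fun a => F (rV_cons (a, v))) (fun a => G (rV_cons (a, v))) M).
  + move=> a; apply: (@continuous_comp _ _ _ (fun a => rV_cons (a, v)) G).
      exact: rV_cons_continuous_l.
    exact: cG.
  + move=> a; have /is_derive_line := dF (rV_cons (a, v)) => dFl; apply/is_derive_line.
    rewrite (_ : (fun _ => _) = fun h : R => F (h *: delta_mx ord0 ord0 + rV_cons (a, v)))//.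
    apply/funext => h; congr F; apply/rowP => k; rewrite !mxE.
    case: (unliftP ord0 k) => [l|] -> /=; rewrite ?eqxx ?mulr1//.
      by rewrite mulr0 add0r.
    by rewrite [h *: 1]mulr1.
  + by move=> a na; rewrite F0// => /cube_rV_cons[].
  + by move=> a na; rewrite G0// => /cube_rV_cons[].
Qed.

Variables (n : nat) (Omega : set 'rV[R]_n).
Hypothesis oO : open Omega.
Local Notation leb := (lebesgue_rV R n).
Let mO : measurable Omega := open_measurable_rV oO.

Lemma continuous_L1loc (f : 'rV[R]_n -> R) : continuous f -> in_L1loc Omega f.
Proof.
move=> cf; split; first exact: continuous_measurable_rV.
move=> K cK KO; have mK := compact_measurable_rV cK.
apply: measurable_bounded_integrable => //.
- by apply: bounded_lebesgue_lty => //; exact: compact_bounded.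
- exact: continuous_measurable_rV.
- have /compact_bounded := continuous_compact (continuous_subspaceT cf) cK.
  move=> [B [Br HB]]; exists B; split=> // x Bx y Ky /=.
  by apply: (HB x Bx); exists y.
Qed.

(** The two sides differ by the integral of a derivative of [phi * psi], which is supported in a
    cube and therefore has integral zero. *)
Lemma test_weak_gradient (phi : 'rV[R]_n -> R) : test_function Omega phi ->
  is_weak_gradient Omega phi (fun x => \row_i 'D_(delta_mx ord0 i) phi x).
Proof.
move=> tphi; have [sphi _ _] := tphi; split.
- by apply: continuous_L1loc; exact: smooth_continuous.
- move=> i; rewrite (_ : (fun _ => _) = 'D_(delta_mx ord0 i) phi); last first.
    by apply/funext => x; rewrite mxE.
  by apply: continuous_L1loc; apply: smooth_continuous; exact: smooth_derive.
move=> psi i tpsi; have [spsi _ _] := tpsi.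
set e := delta_mx ord0 i.
under [in RHS]eq_Rintegral do rewrite mxE -/e.
have i1 := L1loc_mul_test oO (continuous_L1loc (smooth_continuous sphi)) (test_function_derive e tpsi).
have i2 := L1loc_mul_test oO (continuous_L1loc (smooth_continuous (smooth_derive e sphi))) tpsi.
apply/eqP; rewrite -subr_eq0 opprK -RintegralD//.
have [K [cK KO psi0]] := test_function_suppP tpsi.
have tF := test_functionM sphi tpsi; have [sF _ _] := tF.
have [M M0 KM] := bounded_sub_cube (compact_bounded cK).
have psiM x : ~ cube M x -> psi x = 0 by move=> nx; apply: psi0 => /KM.
have cM := @compact_cube R n M.
have psiM' x : ~ cube M x -> 'D_e psi x = 0 by exact: derive_supp.
rewrite /Rintegral; apply/eqP; rewrite -[RHS]/(fine 0%E); congr fine.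
rewrite (_ : \int[_]_(_ in _) _ = \int[leb]_x (phi x * 'D_e psi x + 'D_e phi x * psi x)%:E)%E.
  apply: (@integral_derive_cube _ (fun x => phi x * psi x) _ i M).
  + apply: smooth_continuous; apply: smoothD; apply: smoothM => //; exact: smooth_derive.
  + move=> x; have := is_deriveM (smooth_is_derive x e sphi) (smooth_is_derive x e spsi).
    by rewrite /GRing.scale /= [psi x * _]mulrC.
  + by move=> x nx; rewrite psiM// mulr0.
  + by move=> x nx; rewrite psiM// psiM'// !mulr0 addr0.
apply/esym; apply: integral_supp => // x _ nx.
have npx : ~ K x by move=> /KO.
by rewrite psi0// (derive_supp e cK psi0)// !mulr0 addr0.
Qed.

End integration_by_parts.

(** * Limits equal to zero and inequalities between powers *)

Section ereal_limits.
Context (R : realType) (T : Type) (F : set_system T) {FF : Filter F}.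

Lemma cvge0P (u : T -> \bar R) : (forall t, 0 <= u t)%E ->
  (u @ F --> 0%E) <-> (forall e : R, 0 < e -> \forall t \near F, (u t < e%:E)%E).
Proof.
move=> u0; split=> [/(fine_cvgP u)[uf uc] e e0|H].
  near=> t; have ut : u t \is a fin_num by near: t.
  rewrite -(fineK ut) lte_fin (le_lt_trans (ler_norm _))//.
  by near: t; move/cvgr0_norm_lt : uc; exact.
apply/(fine_cvgP u); split.
  by near=> t; rewrite ge0_fin_numE// (@lt_trans _ _ 1%:E) ?ltry//; near: t; exact: H.
apply/cvgr0Pnorm_lt => e e0; near=> t.
have ute : (u t < e%:E)%E by near: t; exact: H.
rewrite /= ger0_norm ?fine_ge0// -lte_fin fineK// ge0_fin_numE//.
by rewrite (lt_trans ute) ?ltry.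
Unshelve. all: by end_near. Qed.

Lemma cvge0_le (u v : T -> \bar R) (C : R) : (forall t, 0 <= u t)%E ->
  (forall t, u t <= C%:E * v t)%E -> v @ F --> 0%E -> u @ F --> 0%E.
Proof.
move=> u0 uv v0.
apply: (@squeeze_cvge _ _ _ _ (cst 0%E) _ (fun t => C%:E * v t)%E).
- by apply: nearW => t; rewrite u0 uv.
- exact: cvg_cst.
- by rewrite -(mule0 C%:E); apply: cvgeZl.
Qed.

Lemma cvge0D (u v : T -> \bar R) : u @ F --> 0%E -> v @ F --> 0%E ->
  (fun t => u t + v t)%E @ F --> 0%E.
Proof. by move=> u0 v0; rewrite -(adde0 0%E); apply: cvgeD. Qed.

End ereal_limits.

Section powR_extra.
Variable R : realType.
Implicit Types a b p : R.

Lemma powR_normD p a b : 0 <= p ->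
  `|a + b| `^ p <= 2 `^ p * (`|a| `^ p + `|b| `^ p).
Proof.
move=> p0.
wlog ab : a b / `|a| <= `|b|.
  move=> H; have [/H//|/ltW/H] := leP `|a| `|b|.
  by rewrite addrC [X in _ <= _ * X]addrC.
have : `|a + b| <= 2 * `|b|.
  by rewrite (le_trans (ler_normD _ _))// mulr_natl mulr2n lerD2r.
move=> /(ge0_ler_powR p0) => /(_ (normr_ge0 _)) H.
rewrite (le_trans (H _))// ?nnegrE ?mulr_ge0// powRM// ler_wpM2l ?powR_ge0//.
by rewrite lerDr powR_ge0.
Qed.

Lemma le_powR p a b : 0 <= p -> 0 <= a -> a <= b -> a `^ p <= b `^ p.
Proof.
by move=> p0 a0 ab; apply: ge0_ler_powR => //; rewrite nnegrE// (le_trans a0).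
Qed.

(** If [a] exceeds [e] in absolute value, multiplying by the (p-1)-th power of |a| / e can only
    increase it. This replaces Hölder's inequality when L^1 is compared with L^p on a set of finite
    measure. *)
Lemma norm_le_powR p a (e : R) : 1 <= p -> 0 < e ->
  `|a| <= e + (e `^ (p - 1))^-1 * `|a| `^ p.
Proof.
move=> p1 e0; have p0 : 0 < p by lra.
have ep : 0 < e `^ (p - 1) by rewrite powR_gt0.
have [ae|ea] := leP `|a| e.
  by rewrite (le_trans ae)// lerDl mulr_ge0 ?powR_ge0// invr_ge0 ltW.
rewrite -(mulr_powRB1 (normr_ge0 a) p0) ler_wpDl ?(ltW e0)//.
rewrite mulrCA ler_peMr// mulrC ler_pdivlMr// mul1r le_powR//; [lra|exact: ltW|exact: ltW].
Qed.

End powR_extra.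

(** * Convergence in L^p *)

(** The p-th power of the L^p norm, preferred to the norm because pointwise bounds integrate
    directly. *)
HB.lock Definition Lint d (T : measurableType d) (R : realType)
    (mu : {measure set T -> \bar R}) (D : set T) (p : R) (f : T -> R) : \bar R :=
  (\int[mu]_(x in D) (`|f x| `^ p)%:E)%E.

Lemma LintE d (T : measurableType d) (R : realType) (mu : {measure set T -> \bar R})
  (D : set T) p (f : T -> R) : Lint mu D p f = (\int[mu]_(x in D) (`|f x| `^ p)%:E)%E.
Proof. by rewrite Lint.unlock. Qed.

Section Lp_convergence.
Context d (T : measurableType d) (R : realType) (mu : {measure set T -> \bar R}).
Variable D : set T.
Hypothesis mD : measurable D.
Implicit Types f g : T -> R.
Local Notation Lint := (Lint mu D).

Lemma Lint_ge0 p f : (0 <= Lint p f)%E.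
Proof. by rewrite LintE; apply: integral_ge0 => x _; rewrite lee_fin powR_ge0. Qed.

Lemma measurable_powR_norm p f : measurable_fun D f ->
  measurable_fun D (fun x => `|f x| `^ p).
Proof.
move=> mf; apply: (measurableT_comp (measurable_powR p)).
exact: (measurableT_comp (@normr_measurable R setT)).
Qed.

Lemma measurable_Lint p f : measurable_fun D f ->
  measurable_fun D (fun x => (`|f x| `^ p)%:E).
Proof. by move=> mf; apply/measurable_EFinP; exact: measurable_powR_norm. Qed.

Lemma normLpE p f : 0 < p -> normLp mu D p%:E f = (Lint p f `^ p^-1)%E.
Proof.
move=> p0; rewrite /normLp unlock LintE [in RHS]integral_mkcond; congr (_ `^ _)%E.
apply: eq_integral => x _; rewrite patchE -poweR_EFin -abse_EFin /=.
rewrite /patch; case: ifPn => // _.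
by rewrite normr0 powR0// gt_eqF.
Qed.

Lemma Lint_normLp p f : 0 < p -> Lint p f = (normLp mu D p%:E f `^ p)%E.
Proof.
move=> p0; rewrite normLpE// -poweRrM mulVf ?gt_eqF// poweRe1//.
exact: Lint_ge0.
Qed.

Lemma normLp_lty p f : 0 < p -> (normLp mu D p%:E f < +oo)%E <-> (Lint p f < +oo)%E.
Proof.
move=> p0; split=> H; first by rewrite Lint_normLp//; exact: poweR_lty.
by rewrite normLpE//; exact: poweR_lty.
Qed.

Lemma normLp_cvg0 (I : Type) (F : set_system I) (FF : Filter F) p (f : I -> T -> R) : 0 < p ->
  ((fun i => normLp mu D p%:E (f i)) @ F --> 0%E) <-> ((fun i => Lint p (f i)) @ F --> 0%E).
Proof.
move=> p0.
have main (u : I -> \bar R) (r : R) : 0 < r -> (forall i, 0 <= u i)%E ->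
    u @ F --> 0%E -> (fun i => u i `^ r)%E @ F --> 0%E.
  move=> r0 u0 /cvge0P - /(_ u0) H; apply/cvge0P => [i|e e0]; first exact: poweR_ge0.
  have e'0 : 0 < (e / 2) `^ r^-1 by rewrite powR_gt0//; lra.
  apply: filterS (H _ e'0) => i /ltW ui.
  apply: (@le_lt_trans _ _ (((e / 2) `^ r^-1)%:E `^ r)%E).
    apply: gt0_ler_poweR => //; first exact: ltW.
      by rewrite in_itv /= u0 leey.
    by rewrite in_itv /= lee_fin powR_ge0 leey.
  rewrite poweR_EFin -powRrM mulVf ?gt_eqF// powRr1 ?divr_ge0 ?ltW//.
  by rewrite lte_fin ltr_pdivrMr// ltr_pMr// ltr1n.
split=> H.
  under eq_fun do rewrite Lint_normLp//.
  by apply: main => // i; exact: Lnorm_ge0.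
under eq_fun do rewrite normLpE//.
by apply: main; rewrite ?invr_gt0// => i; exact: Lint_ge0.
Qed.

Lemma le_Lint p f g : 0 <= p -> measurable_fun D f -> measurable_fun D g ->
  (forall x, D x -> `|f x| <= `|g x|) -> (Lint p f <= Lint p g)%E.
Proof.
move=> p0 mf mg fg; rewrite !LintE; apply: ge0_le_integral => //.
- exact: measurable_Lint.
- exact: measurable_Lint.
- by move=> x Dx; rewrite lee_fin le_powR// fg.
Qed.

Lemma LintZ p (c : R) f : 0 <= p -> measurable_fun D f ->
  Lint p (fun x => c * f x) = ((`|c| `^ p)%:E * Lint p f)%E.
Proof.
move=> p0 mf; rewrite !LintE.
under eq_integral do rewrite normrM powRM// EFinM.
rewrite ge0_integralZl_EFin ?powR_ge0//.
exact: measurable_Lint.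
Qed.

Lemma LintN p f : Lint p (fun x => - f x) = Lint p f.
Proof. by rewrite !LintE; under eq_integral do rewrite normrN. Qed.

Lemma LintD p f g : 0 <= p -> measurable_fun D f -> measurable_fun D g ->
  (Lint p (fun x => f x + g x)%R <= (2 `^ p)%:E * (Lint p f + Lint p g))%E.
Proof.
move=> p0 mf mg; rewrite !LintE -ge0_integralD//.
- rewrite -ge0_integralZl_EFin ?powR_ge0//; first last.
  + by apply: emeasurable_funD; exact: measurable_Lint.
  + by move=> x _; rewrite adde_ge0// lee_fin powR_ge0.
  apply: ge0_le_integral => //.
  + by apply: measurable_Lint; exact: measurable_funD.
  + by apply: measurable_funeM; apply: emeasurable_funD; exact: measurable_Lint.
  + by move=> x _; rewrite -EFinD -EFinM lee_fin powR_normD.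
- exact: measurable_Lint.
- exact: measurable_Lint.
Qed.

Lemma LintD_lty p f g : 0 <= p -> measurable_fun D f -> measurable_fun D g ->
  (Lint p f < +oo)%E -> (Lint p g < +oo)%E -> (Lint p (fun x => f x + g x)%R < +oo)%E.
Proof.
move=> p0 mf mg fi gi; apply: le_lt_trans (LintD p0 mf mg) _.
by rewrite lte_mul_pinfty ?lee_fin ?powR_ge0// lte_add_pinfty.
Qed.

Lemma LintB_lty p f g : 0 <= p -> measurable_fun D f -> measurable_fun D g ->
  (Lint p f < +oo)%E -> (Lint p g < +oo)%E -> (Lint p (fun x => f x - g x)%R < +oo)%E.
Proof.
move=> p0 mf mg fi gi.
have mNg : measurable_fun D (fun x => - g x) by exact: measurableT_comp.
have Ngi : (Lint p (fun x => - g x)%R < +oo)%E by rewrite LintN.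
exact: (LintD_lty p0 mf mNg fi Ngi).
Qed.

Lemma Lint_cvg0D p (f g : (T -> R)^nat) : 0 <= p ->
  (forall n, measurable_fun D (f n)) -> (forall n, measurable_fun D (g n)) ->
  Lint p (f n) @[n --> \oo] --> 0%E -> Lint p (g n) @[n --> \oo] --> 0%E ->
  Lint p (fun x => f n x + g n x)%R @[n --> \oo] --> 0%E.
Proof.
move=> p0 mf mg f0 g0.
apply: (@cvge0_le R nat \oo _ _ (fun n => Lint p (f n) + Lint p (g n))%E (2 `^ p)) => [n|n|].
- exact: Lint_ge0.
- exact: LintD.
- exact: (cvge0D f0 g0).
Qed.

Lemma integrable_Lint p f : measurable_fun D f -> (Lint p f < +oo)%E <->
  mu.-integrable D (fun x => (`|f x| `^ p)%:E).
Proof.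
move=> mf; rewrite LintE; split=> [H|/integrableP[_ H]].
  apply/integrableP; split; first exact: measurable_Lint.
  by under eq_integral do rewrite gee0_abs ?lee_fin ?powR_ge0//.
rewrite (le_lt_trans _ H)//; apply: ge0_le_integral => //.
- exact: measurable_Lint.
- by apply: measurableT_comp => //; exact: measurable_Lint.
- by move=> x _; exact: lee_abs.
Qed.

Hypothesis muD : (mu D < +oo)%E.

Lemma integrable_cst_fin (c : R) : mu.-integrable D (fun=> c%:E).
Proof.
apply: (measurable_bounded_integrable mD muD (f := cst c)) => //.
by exists `|c|; split; [rewrite num_real|move=> x cx y _ /=; exact: ltW].
Qed.

Lemma Lint_integrable p f : 1 <= p -> measurable_fun D f -> (Lint p f < +oo)%E ->
  mu.-integrable D (EFin \o f).
Proof.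
move=> p1 mf /(integrable_Lint _ mf) H.
apply: (le_integrable mD _ _ (integrableD mD (integrable_cst_fin 1) H)).
  exact/measurable_EFinP.
move=> x _; rewrite /= lee_fin (le_trans (norm_le_powR _ p1 ltr01))// powR1 invr1 mul1r.
exact: ler_norm.
Qed.

Lemma Lint_cvg0_L1 p (f : (T -> R)^nat) : 1 <= p ->
  (forall n, measurable_fun D (f n)) -> Lint p (f n) @[n --> \oo] --> 0%E ->
  (\int[mu]_(x in D) `|f n x|%:E)%E @[n --> \oo] --> 0%E.
Proof.
move=> p1 mf f0.
have f1_ge0 n : (0 <= \int[mu]_(x in D) `|f n x|%:E)%E by apply: integral_ge0.
apply/(cvge0P f1_ge0) => e e0.
pose m := fine (mu D).
have m0 : 0 <= m by rewrite fine_ge0.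
have mE : mu D = m%:E by rewrite fineK// ge0_fin_numE.
(* Chosen so that the constant part, integrated over [D], contributes at most [e / 4]; the added 1
   covers the case of measure zero. *)
pose k := e / 4 / (m + 1).
have k0 : 0 < k by rewrite !divr_gt0//; lra.
pose c := (k `^ (p - 1))^-1.
have c0 : 0 <= c by rewrite invr_ge0 powR_ge0.
have H := (cvge0P (fun n => Lint_ge0 p (f n))).1 f0 (e / 4 / (c + 1)).
have : 0 < e / 4 / (c + 1) by rewrite !divr_gt0//; lra.
move=> /H; apply: filterS => n fn.
have mabs : measurable_fun D (fun x => `|f n x|%:E).
  by apply/measurable_EFinP; apply: measurableT_comp.
apply: (@le_lt_trans _ _ (k%:E * mu D + c%:E * Lint p (f n))%E).
  rewrite LintE -integral_cst// -ge0_integralZl_EFin//; first last.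
  - exact: measurable_Lint.
  rewrite -ge0_integralD//; first last.
  - by apply: measurable_funeM; exact: measurable_Lint.
  - by move=> x _; rewrite -EFinM lee_fin mulr_ge0 ?powR_ge0.
  - by move=> x _; rewrite lee_fin ltW.
  apply: ge0_le_integral => //.
  - by apply: emeasurable_funD => //; apply: measurable_funeM; exact: measurable_Lint.
  - by move=> x _; rewrite lee_fin; exact: norm_le_powR.
have ffin : Lint p (f n) \is a fin_num.
  by rewrite ge0_fin_numE ?Lint_ge0// (lt_trans fn)// ltry.
move: fn; rewrite mE -(fineK ffin) -!EFinM -EFinD !lte_fin => fn.
have L0 : 0 <= fine (Lint p (f n)) by rewrite fine_ge0// Lint_ge0.
have h1 : k * m <= e / 4.
  rewrite /k mulrAC ler_pdivrMr; last lra.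
  by rewrite ler_wpM2l//; lra.
have h2 : c * fine (Lint p (f n)) <= e / 4.
  apply: (@le_trans _ _ ((c + 1) * (e / 4 / (c + 1)))).
    by apply: ler_pM => //; [lra|exact: ltW].
  by rewrite mulrC divfK//; lra.
lra.
Qed.

End Lp_convergence.

Section Lp_products.
Context d (T : measurableType d) (R : realType) (mu : {measure set T -> \bar R}).
Variable D : set T.
Hypothesis mD : measurable D.
Local Notation Lint := (Lint mu D).

Lemma Lint_norm p (f : T -> R) : Lint p (fun x => `|f x|) = Lint p f.
Proof. by rewrite !LintE; under eq_integral do rewrite normr_id. Qed.

Lemma Lint_tail_cvg0 p (G : T -> R) : 0 < p -> measurable_fun D G -> (Lint p G < +oo)%E ->
  Lint p (fun x => Num.max (`|G x| - K%:R) 0) @[K --> \oo] --> 0%E.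
Proof.
move=> p0 mG iG.
have mt (K : nat) : measurable_fun D (fun x => Num.max (`|G x| - K%:R) 0).
  apply: measurable_maxr => //; apply: measurable_funB => //.
  exact: measurableT_comp.
have <- : (\int[mu]_(x in D) 0%:E = 0)%E by rewrite integral0.
under eq_fun do rewrite LintE.
apply: (@dominated_cvg _ _ _ mu D mD _ _ (fun x => (`|G x| `^ p)%:E)) => //.
- by move=> K; apply: measurable_Lint => //; exact: mt.
- move=> x _; apply: cvg_near_cst.
  near=> K; suff -> : Num.max (`|G x| - K%:R) 0 = 0 by rewrite normr0 powR0// gt_eqF.
  apply/max_idPr; rewrite subr_le0; near: K; exact: nbhs_infty_ger.
- exact/integrable_Lint.
- move=> K x _; rewrite /= lee_fin ger0_norm ?powR_ge0//.
  apply: le_powR; [exact: ltW|exact: normr_ge0|].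
  by rewrite ger0_norm ?le_max ?lexx ?orbT// ge_max normr_ge0 andbT gerBl.
Unshelve. all: by end_near. Qed.

(** Serves the chain rule, for products of a fixed L^p function [G] with bounded factors that are
    small in L^p. Splitting [G] at a level [K] bounds the product by [L * K * w] plus [B] times the
    excess of |G| over [K]; no almost everywhere convergent subsequence has to be extracted. *)
Lemma Lint_cvg0_mul p (k w : (T -> R)^nat) (G : T -> R) (B L : R) : 0 < p ->
  (forall m, measurable_fun D (k m)) -> (forall m, measurable_fun D (w m)) ->
  measurable_fun D G -> 0 <= B -> 0 <= L ->
  (forall m x, D x -> `|k m x| <= B) -> (forall m x, D x -> `|k m x| <= L * `|w m x|) ->
  Lint p (w m) @[m --> \oo] --> 0%E -> (Lint p G < +oo)%E ->
  Lint p (fun x => k m x * G x) @[m --> \oo] --> 0%E.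
Proof.
move=> p0 mk mw mG B0 L0 kB kL w0 iG.
have pge0 : 0 <= p by exact: ltW.
apply/cvge0P => [m|e e0]; first exact: Lint_ge0.
pose tail K x := Num.max (`|G x| - K) 0.
have mt (K : R) : measurable_fun D (tail K).
  apply: measurable_maxr => //; apply: measurable_funB => //.
  exact: measurableT_comp.
have bound (K : R) m : 0 <= K ->
    (Lint p (fun x => k m x * G x)%R <=
     (2 `^ p)%:E * (((L * K) `^ p)%:E * Lint p (w m) + (B `^ p)%:E * Lint p (tail K)))%E.
  move=> K0; have -> : (((L * K) `^ p)%:E * Lint p (w m) = Lint p (fun x => (L * K)%R * `|w m x|)%R)%E.
    rewrite LintZ//; last by apply: measurableT_comp.
    by rewrite Lint_norm ger0_norm ?mulr_ge0.
  have -> : ((B `^ p)%:E * Lint p (tail K) = Lint p (fun x => B * tail K x)%R)%E.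
    by rewrite LintZ// ger0_norm.
  apply: le_trans (LintD mu mD pge0 _ _); last 2 first.
  - by apply: measurable_funM => //; exact: measurableT_comp.
  - exact: measurable_funM.
  apply: le_Lint => //.
  - exact: measurable_funM.
  - apply: measurable_funD; apply: measurable_funM => //; exact: measurableT_comp.
  - move=> x Dx; rewrite normrM [leRHS]ger0_norm; last first.
      by rewrite addr_ge0 ?mulr_ge0// /tail le_max lexx orbT.
    have [GK|GK] := leP `|G x| K.
      rewrite (@le_trans _ _ (L * `|w m x| * K))//.
        by apply: ler_pM => //; exact: kL.
      by rewrite mulrAC lerDl mulr_ge0// /tail le_max lexx orbT.
    rewrite /tail max_l ?subr_ge0 ?(ltW GK)//.
    have -> : `|k m x| * `|G x| = `|k m x| * K + `|k m x| * (`|G x| - K) by ring.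
    apply: lerD.
      by rewrite mulrAC ler_wpM2r//; exact: kL.
    by rewrite ler_wpM2r ?subr_ge0 ?(ltW GK)//; exact: kB.
have small (c : R) (v : nat -> \bar R) (r : R) : 0 <= c -> (forall m, 0 <= v m)%E ->
    v @ \oo --> 0%E -> 0 < r -> \forall m \near \oo, (c%:E * v m < r%:E)%E.
  move=> c0 v0 cv r0; have cv0 m : (0 <= c%:E * v m)%E by rewrite mule_ge0.
  exact: (cvge0P cv0).1 (cvge0_le cv0 (fun m => lexx _) cv) r r0.
have e2 : 0 < e / 2 by rewrite divr_gt0.
have Lw m : (0 <= Lint p (w m))%E by exact: Lint_ge0.
have Lt (K : nat) : (0 <= Lint p (tail K%:R))%E by exact: Lint_ge0.
have cB : 0 <= 2 `^ p * B `^ p by rewrite mulr_ge0 ?powR_ge0.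
(* The level [K] is fixed first through the tail of [G]; only then is [m] sent to infinity. *)
have [K _ /(_ K (leqnn K)) HK] := small _ _ _ cB Lt (Lint_tail_cvg0 p0 mG iG) e2.
have cL : 0 <= 2 `^ p * (L * K%:R) `^ p by rewrite mulr_ge0 ?powR_ge0.
apply: filterS (small _ _ _ cL Lw w0 e2) => m Hm.
apply: le_lt_trans (bound K%:R m (ler0n _ _)) _.
rewrite ge0_muleDr ?mule_ge0 ?lee_fin ?powR_ge0// !muleA -!EFinM (splitr e) EFinD.
exact: lteD.
Qed.

Lemma Lint_sum_lty (I : Type) (s : seq I) p (f : I -> T -> R) : 0 < p ->
  (forall i, measurable_fun D (f i)) -> (forall i, Lint p (f i) < +oo)%E ->
  (Lint p (fun x => \sum_(i <- s) f i x)%R < +oo)%E.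
Proof.
move=> p0 mf fi; elim: s => [|i s IH].
  rewrite !LintE (eq_integral (cst 0%E)) ?integral0 ?ltry// => x _.
  by rewrite big_nil normr0 powR0// gt_eqF.
rewrite (_ : (fun x => _) = fun x => f i x + \sum_(i <- s) f i x); last first.
  by apply/funext => x; rewrite big_cons.
exact: (LintD_lty mD (ltW p0) (mf i) (measurable_sum s mf) (fi i) IH).
Qed.

Lemma Lint_cvg0_sum (I : Type) (s : seq I) p (f : nat -> I -> T -> R) : 0 < p ->
  (forall m i, measurable_fun D (f m i)) ->
  (forall i, Lint p (f m i) @[m --> \oo] --> 0%E) ->
  Lint p (fun x => \sum_(i <- s) f m i x)%R @[m --> \oo] --> 0%E.
Proof.
move=> p0 mf fi; elim: s => [|i s IH].
  rewrite (_ : (fun m => _) = cst 0%E); first exact: cvg_cst.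
  apply/funext => m; rewrite !LintE (eq_integral (cst 0%E)) ?integral0// => x _.
  by rewrite big_nil normr0 powR0// gt_eqF.
rewrite (_ : (fun m => _) = fun m => Lint p (fun x => f m i x + \sum_(i <- s) f m i x)); last first.
  by apply/funext => m; f_equal; apply/funext => x; rewrite big_cons.
exact: (Lint_cvg0D mD (ltW p0) (fun m => mf m i) (fun m => measurable_sum s (mf m)) (fi i) IH).
Qed.

Lemma Rintegral_L1_cvg (f : (T -> R)^nat) (g h : T -> R) (M : R) :
  (forall k, mu.-integrable D (EFin \o f k)) -> mu.-integrable D (EFin \o g) ->
  measurable_fun D h -> 0 <= M -> (forall x, D x -> `|h x| <= M) ->
  (\int[mu]_(x in D) `|g x - f k x|%:E)%E @[k --> \oo] --> 0%E ->
  (\int[mu]_(x in D) (f k x * h x)) @[k --> \oo] --> (\int[mu]_(x in D) (g x * h x) : R).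
Proof.
move=> fi gi mh M0 hM cv.
have hi (u : T -> R) : mu.-integrable D (EFin \o u) -> mu.-integrable D (fun x => (u x * h x)%:E).
  move=> ui; apply: (le_integrable mD _ _ (integrableZl mD M ui)).
    apply/measurable_EFinP; apply: measurable_funM => //.
    by have /measurable_EFinP := measurable_int _ ui.
  by move=> x Dx; rewrite /= lee_fin !normrM mulrC ler_wpM2r// (ger0_norm M0) hM.
apply/cvgrPdist_lt => e e0.
have e'0 : 0 < e / (M + 1) by rewrite divr_gt0//; lra.
have ige0 k : (0 <= \int[mu]_(x in D) `|g x - f k x|%:E)%E by exact: integral_ge0.
apply: filterS ((cvge0P ige0).1 cv _ e'0) => k Hk.
rewrite -RintegralB//; [|exact: hi|exact: hi].
have ii : mu.-integrable D (fun x => (g x * h x - f k x * h x)%:E).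
  exact: (integrableB mD (hi _ gi) (hi _ (fi k))).
apply: le_lt_trans (le_normr_Rintegral mD ii) _.
have ii' : mu.-integrable D (fun x => (g x - f k x)%:E) by exact: (integrableB mD gi (fi k)).
have fin : (\int[mu]_(x in D) `|g x - f k x|%:E)%E \is a fin_num.
  by rewrite ge0_fin_numE ?integral_ge0// (lt_trans Hk)// ltry.
apply: (@le_lt_trans _ _ (M * \int[mu]_(x in D) `|g x - f k x|)).
  rewrite -RintegralZl//; last exact: integrable_norm.
  apply: le_Rintegral => //.
  - exact: integrable_norm.
  - apply: (@integrableZl _ _ _ mu D mD M (fun x => `|g x - f k x|%:E)).
    exact: integrable_norm.
  - by move=> x Dx; rewrite -mulrBl normrM mulrC ler_wpM2r// hM.
move: Hk; rewrite -(fineK fin) lte_fin -[fine _]/(\int[mu]_(x in D) `|g x - f k x|) => Hk.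
have I0 : 0 <= \int[mu]_(x in D) `|g x - f k x| by apply: Rintegral_ge0.
move: Hk; rewrite ltr_pdivlMr; last lra.
apply: le_lt_trans; rewrite mulrC ler_wpM2l//; lra.
Qed.

End Lp_products.

(** * Euclidean norm and integrals of real functions *)

Section enorm_theory.
Variables (R : realType) (n : nat).
Implicit Types v w : 'rV[R]_n.

Lemma enorm_ge0 v : 0 <= enorm v.
Proof. exact: sqrtr_ge0. Qed.

Lemma dotp_ge0 v : 0 <= dotp v v.
Proof. by apply: sumr_ge0 => i _; rewrite -expr2 sqr_ge0. Qed.

Lemma sqr_enorm v : enorm v ^+ 2 = dotp v v.
Proof. by rewrite sqr_sqrtr// dotp_ge0. Qed.

Lemma coor_le_enorm v i : `|v ord0 i| <= enorm v.
Proof.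
rewrite -(@ler_pXn2r _ 2) ?nnegrE ?enorm_ge0// sqr_enorm real_normK ?num_real//.
rewrite /dotp (bigD1 i)//= -expr2 lerDl; apply: sumr_ge0 => j _.
by rewrite -expr2 sqr_ge0.
Qed.

Lemma enorm_le_sum v : enorm v <= \sum_(i < n) `|v ord0 i|.
Proof.
have s0 : 0 <= \sum_(i < n) `|v ord0 i| by apply: sumr_ge0.
rewrite -(@ler_pXn2r _ 2) ?nnegrE ?enorm_ge0// sqr_enorm /dotp.
suff : 0 <= \sum_(i < n) `|v ord0 i| /\
    \sum_(i < n) v ord0 i * v ord0 i <= (\sum_(i < n) `|v ord0 i|) ^+ 2 by case.
elim/big_rec2: _ => [|i y x _ [y0 xy]]; first by rewrite expr0n.
split; first by rewrite addr_ge0.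
rewrite sqrrD real_normK ?num_real// -expr2 -addrA lerD2l (le_trans xy)// lerDr.
by rewrite mulrn_wge0// mulr_ge0.
Qed.

Lemma measurable_enorm d (T : measurableType d) (D : set T) (F : T -> 'rV[R]_n) :
  (forall i, measurable_fun D (fun x => F x ord0 i)) -> measurable_fun D (fun x => enorm (F x)).
Proof.
move=> mF; apply: (measurableT_comp (f := @Num.sqrt R)).
  apply: continuous_measurable_fun; exact: sqrt_continuous.
by apply: measurable_sum => i; exact: measurable_funM.
Qed.

End enorm_theory.

Section Rintegral_extra.
Context d (T : measurableType d) (R : realType) (mu : {measure set T -> \bar R}).
Variable D : set T.
Hypothesis mD : measurable D.

Lemma integrableD_real (f g : T -> R) : mu.-integrable D (fun x => (f x)%:E) ->
  mu.-integrable D (fun x => (g x)%:E) -> mu.-integrable D (fun x => (f x + g x)%:E).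
Proof. exact: integrableD. Qed.

Lemma integrableB_real (f g : T -> R) : mu.-integrable D (fun x => (f x)%:E) ->
  mu.-integrable D (fun x => (g x)%:E) -> mu.-integrable D (fun x => (f x - g x)%:E).
Proof. exact: integrableB. Qed.

Lemma integrableN_real (f : T -> R) : mu.-integrable D (fun x => (f x)%:E) ->
  mu.-integrable D (fun x => (- f x)%:E).
Proof. exact: integrableN. Qed.

Lemma integrableZ_real (c : R) (f : T -> R) : mu.-integrable D (fun x => (f x)%:E) ->
  mu.-integrable D (fun x => (c * f x)%:E).
Proof. exact: integrableZl. Qed.

Lemma integrable_norm_real (f : T -> R) : mu.-integrable D (fun x => (f x)%:E) ->
  mu.-integrable D (fun x => `|f x|%:E).
Proof. exact: integrable_norm. Qed.

Lemma measurable_integrable_real (f : T -> R) : mu.-integrable D (fun x => (f x)%:E) ->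
  measurable_fun D f.
Proof. by move=> /measurable_int /measurable_EFinP. Qed.

Lemma le_integrable_real (f g : T -> R) : measurable_fun D f ->
  mu.-integrable D (fun x => (g x)%:E) -> (forall x, D x -> `|f x| <= g x) ->
  mu.-integrable D (fun x => (f x)%:E).
Proof.
move=> mf ig fg; apply: (le_integrable mD _ _ ig); first exact/measurable_EFinP.
by move=> x Dx; rewrite /= lee_fin (le_trans (fg x Dx))// ler_norm.
Qed.

Lemma ae_eq_integrable_real (f g : T -> R) : measurable_fun D g ->
  mu.-integrable D (fun x => (f x)%:E) -> {ae mu, forall x, D x -> f x = g x} ->
  mu.-integrable D (fun x => (g x)%:E).
Proof.
move=> mg /integrableP[mf fi] fg; apply/integrableP; split; first exact/measurable_EFinP.
rewrite (_ : (\int[mu]_(x in D) `|(g x)%:E| = \int[mu]_(x in D) `|(f x)%:E|)%E)//.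
apply: ge0_ae_eq_integral => //.
- by apply: measurableT_comp => //; exact/measurable_EFinP.
- exact: measurableT_comp.
- by apply: filterS fg => x H Dx; rewrite H.
Qed.

Lemma ae_eq_Rintegral (f g : T -> R) : measurable_fun D f -> measurable_fun D g ->
  {ae mu, forall x, D x -> f x = g x} -> \int[mu]_(x in D) f x = \int[mu]_(x in D) g x.
Proof.
move=> mf mg fg; rewrite /Rintegral; congr fine.
apply: ae_eq_integral => //; [exact/measurable_EFinP|exact/measurable_EFinP|].
by apply: filterS fg => x H Dx; rewrite H.
Qed.

Lemma ae_Rintegral_ge0 (f : T -> R) : measurable_fun D f ->
  {ae mu, forall x, D x -> 0 <= f x} -> 0 <= \int[mu]_(x in D) f x.
Proof.
move=> mf f0; rewrite (@ae_eq_Rintegral f (fun x => `|f x|))//.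
- by apply: Rintegral_ge0 => x _.
- exact: measurableT_comp.
- by apply: filterS f0 => x H Dx; rewrite ger0_norm// H.
Qed.

Lemma ae_le_Rintegral (f g : T -> R) : mu.-integrable D (fun x => (f x)%:E) ->
  mu.-integrable D (fun x => (g x)%:E) ->
  {ae mu, forall x, D x -> f x <= g x} -> \int[mu]_(x in D) f x <= \int[mu]_(x in D) g x.
Proof.
move=> fi gi fg; rewrite -subr_ge0 -RintegralB//; apply: ae_Rintegral_ge0.
  by apply: measurable_funB; exact: measurable_integrable_real.
by apply: filterS fg => x H Dx; rewrite subr_ge0 H.
Qed.

Lemma Rintegral_dominated_cvg (f_ : (T -> R)^nat) (f g : T -> R) :
  (forall k, measurable_fun D (f_ k)) -> measurable_fun D f ->
  {ae mu, forall x, D x -> f_ k x @[k --> \oo] --> f x} ->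
  mu.-integrable D (fun x => (g x)%:E) ->
  {ae mu, forall x, D x -> forall k, `|f_ k x| <= g x} ->
  mu.-integrable D (fun x => (f x)%:E) /\
  (\int[mu]_(x in D) f_ k x) @[k --> \oo] --> (\int[mu]_(x in D) f x : R).
Proof.
move=> mf_ mf cv ig dom.
have [] := @dominated_convergence _ _ _ mu D mD (fun k x => (f_ k x)%:E) (fun x => (f x)%:E)
  (fun x => (g x)%:E).
- by move=> k; exact/measurable_EFinP.
- exact/measurable_EFinP.
- apply: filterS cv => x H Dx; apply: cvg_EFin; first exact: nearW.
  exact: H.
- by [].
- by apply: filterS dom => x H k Dx; rewrite /= lee_fin H.
move=> fi _ ci; split => //.
have fin : (\int[mu]_(x in D) (f x)%:E)%E \is a fin_num by exact: integrable_fin_num.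
move: ci; rewrite -[X in _ --> X](fineK fin) => /fine_cvgP[_].
exact.
Qed.

End Rintegral_extra.

Lemma ae_le_integrable_real d (T : measurableType d) (R : realType)
    (mu : {measure set T -> \bar R}) (D : set T) (f g : T -> R) : measurable D ->
  measurable_fun D f -> mu.-integrable D (fun x => (g x)%:E) ->
  {ae mu, forall x, D x -> `|f x| <= g x} -> mu.-integrable D (fun x => (f x)%:E).
Proof.
move=> mD mf ig fg; apply/integrableP; split; first exact/measurable_EFinP.
have /integrableP[mg] := ig; apply: le_lt_trans.
apply: ae_ge0_le_integral => //.
- by apply: measurableT_comp => //; exact/measurable_EFinP.
- exact: measurableT_comp.
- apply: filterS fg => x H Dx; rewrite /= lee_fin.
  by rewrite (le_trans (H Dx))// ler_norm.
Qed.


(** * Uniqueness of weak gradients *)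

Section weak_gradients.
Variables (R : realType) (n : nat) (Omega : set 'rV[R]_n).
Hypothesis oO : open Omega.
Local Notation leb := (lebesgue_rV R n).
Let mO : measurable Omega := open_measurable_rV oO.
Implicit Types (u v : 'rV[R]_n -> R) (G H : 'rV[R]_n -> 'rV[R]_n).

Lemma L1locB u v : in_L1loc Omega u -> in_L1loc Omega v -> in_L1loc Omega (fun x => u x - v x).
Proof.
move=> [mu iu] [mv iv]; split; first exact: measurable_funB.
move=> K cK KO; have mK := compact_measurable_rV cK.
exact: (integrableB mK (iu _ cK KO) (iv _ cK KO)).
Qed.

Lemma is_weak_gradientB u v G H : is_weak_gradient Omega u G -> is_weak_gradient Omega v H ->
  is_weak_gradient Omega (fun x => u x - v x) (fun x => G x - H x).
Proof.
move=> [lu lG Gu] [lv lH Hv].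
have GHE i : (fun x => (G x - H x) ord0 i) = fun x => G x ord0 i - H x ord0 i.
  by apply/funext => x; rewrite !mxE.
split; first exact: L1locB.
  by move=> i; rewrite GHE; exact: L1locB.
move=> phi i tphi.
have tD := test_function_derive (delta_mx ord0 i) tphi.
under eq_Rintegral do rewrite mulrBl.
under [in RHS]eq_Rintegral do rewrite !mxE mulrBl.
rewrite RintegralB//; [|exact: L1loc_mul_test..].
rewrite RintegralB//; [|exact: (L1loc_mul_test oO (lG i))|exact: (L1loc_mul_test oO (lH i))].
by rewrite Gu// Hv// opprB addrC opprK.
Qed.

Lemma ae_forall_ord (m : nat) (P : 'I_m -> 'rV[R]_n -> Prop) :
  (forall i, {ae leb, forall x, P i x}) -> {ae leb, forall x, forall i, P i x}.
Proof.
by move=> H; apply: filter_forall.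
Qed.

(** Each coordinate of the difference has integral zero against all test functions, so
    [fundamental_lemma] applies. *)
Lemma weak_gradient_unique u G H : is_weak_gradient Omega u G -> is_weak_gradient Omega u H ->
  {ae leb, forall x, Omega x -> G x = H x}.
Proof.
move=> [lu lG Gu] [_ lH Hu].
have : {ae leb, forall x, forall i, Omega x -> G x ord0 i - H x ord0 i = 0}.
  apply: ae_forall_ord => i; apply: (fundamental_lemma oO); first exact: L1locB.
  move=> phi tphi; under eq_Rintegral do rewrite mulrBl.
  rewrite RintegralB//; [|exact: (L1loc_mul_test oO (lG i))|exact: (L1loc_mul_test oO (lH i))].
  by apply/eqP; rewrite subr_eq0 -eqr_opp -Gu// -Hu.
apply: filterS => x Hx Ox; apply/rowP => i; apply/eqP.
by rewrite -subr_eq0 Hx.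
Qed.

Lemma weak_gradient_is u G : is_weak_gradient Omega u G ->
  is_weak_gradient Omega u (weak_gradient Omega u).
Proof.
move=> uG; rewrite /weak_gradient.
have := @xgetPex _ (fun=> 0) [set G | is_weak_gradient Omega u G] (ex_intro _ G uG).
exact.
Qed.

Lemma weak_gradientP u G : is_weak_gradient Omega u G ->
  {ae leb, forall x, Omega x -> weak_gradient Omega u x = G x}.
Proof.
move=> uG; apply: weak_gradient_unique (uG).
exact: weak_gradient_is uG.
Qed.

End weak_gradients.

(** * The space W^{1,p}_0 and its chain rule *)

Section sobolev.
Variables (R : realType) (n : nat) (Omega : set 'rV[R]_n).
Hypotheses (oO : open Omega) (bO : bounded_set Omega).
Local Notation leb := (lebesgue_rV R n).
Let mO : measurable Omega := open_measurable_rV oO.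
Let fO : (leb Omega < +oo)%E := bounded_lebesgue_lty mO bO.
Local Notation Lint := (Lint leb Omega).
Local Notation "'d_' i" := (@derive R 'rV[R]_n R ^~ (delta_mx ord0 i)) (at level 8, i at level 2, only parsing).
Variable p : R.
Hypothesis p1 : 1 <= p.
Let p0 : 0 < p. Proof. exact: lt_le_trans p1. Qed.
Implicit Types (u v : 'rV[R]_n -> R) (G H : 'rV[R]_n -> 'rV[R]_n).

(** Membership in W^{1,p}_0 with an explicit gradient and coordinatewise convergence. In this form
    differences and compositions can be handled without mentioning the chosen [weak_gradient]. *)
Definition approx_W10 u G : Prop :=
  [/\ measurable_fun Omega u, forall i, measurable_fun Omega (fun x => G x ord0 i),
      (Lint p u < +oo)%E, forall i, (Lint p (fun x => G x ord0 i) < +oo)%E &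
      exists phi : nat -> 'rV[R]_n -> R,
      [/\ forall k, test_function Omega (phi k),
          Lint p (fun x => u x - phi k x) @[k --> \oo] --> 0%E &
          forall i, Lint p (fun x => G x ord0 i - 'D_(delta_mx ord0 i) (phi k) x) @[k --> \oo] --> 0%E]].

Lemma Lint_in_L1loc u : measurable_fun Omega u -> (Lint p u < +oo)%E -> in_L1loc Omega u.
Proof.
move=> mu iu; split=> // K cK KO.
apply: (integrableS mO _ KO); first exact: compact_measurable_rV.
exact: Lint_integrable p1 mu iu.
Qed.

Lemma test_Lint phi : test_function Omega phi -> (Lint p phi < +oo)%E.
Proof.
move=> tphi; have mphi := test_function_measurable mO tphi.
have [M M0 HM] := test_function_bounded tphi.
apply: (@le_lt_trans _ _ (Lint p (cst M))).
  by apply: le_Lint => //; [exact: ltW|move=> x _; rewrite (ger0_norm M0)].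
rewrite LintE (integral_cst leb mO (`|M| `^ p)%:E).
by rewrite lte_mul_pinfty// lee_fin powR_ge0.
Qed.

Lemma test_measurable phi : test_function Omega phi -> measurable_fun Omega phi.
Proof. exact: test_function_measurable. Qed.

Lemma test_integrable phi : test_function Omega phi -> leb.-integrable Omega (EFin \o phi).
Proof.
move=> tphi; apply: (Lint_integrable mO fO p1); first exact: test_measurable.
exact: test_Lint.
Qed.

Lemma Lint_cvg_Rintegral (f : ('rV[R]_n -> R)^nat) g h : (forall k, test_function Omega (f k)) ->
  measurable_fun Omega g -> (Lint p g < +oo)%E -> test_function Omega h ->
  Lint p (fun x => g x - f k x) @[k --> \oo] --> 0%E ->
  \int[leb]_(x in Omega) (f k x * h x) @[k --> \oo] --> (\int[leb]_(x in Omega) (g x * h x) : R).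
Proof.
move=> tf mg ig th gf0.
have [M M0 HM] := test_function_bounded th.
apply: (@Rintegral_L1_cvg _ _ _ leb Omega mO f g h M) => //.
- by move=> k; exact: test_integrable.
- exact: (Lint_integrable mO fO p1).
- exact: test_measurable.
apply: (Lint_cvg0_L1 mO fO p1 _ gf0) => k.
by apply: measurable_funB => //; exact: test_measurable.
Qed.

(** Integration by parts holds for the approximating test functions, and both sides pass to the
    limit because L^p convergence on a bounded set implies L^1 convergence. *)
Lemma approx_is_weak_gradient u G : approx_W10 u G -> is_weak_gradient Omega u G.
Proof.
move=> [mu mG iu iG [phi [tphi uphi Gphi]]]; split.
- exact: Lint_in_L1loc.
- by move=> i; exact: Lint_in_L1loc.
move=> psi i tpsi.
have tD := test_function_derive (delta_mx ord0 i) tpsi.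
have c1 := Lint_cvg_Rintegral tphi mu iu tD uphi.
have c2 := Lint_cvg_Rintegral (fun k => test_function_derive (delta_mx ord0 i) (tphi k)) (mG i) (iG i) tpsi (Gphi i).
have E : (fun k => \int[leb]_(x in Omega) (phi k x * 'D_(delta_mx ord0 i) psi x)) =
         (fun k => - \int[leb]_(x in Omega) ('D_(delta_mx ord0 i) (phi k) x * psi x)).
  apply/funext => k; have [_ _ ->//] := test_weak_gradient oO (tphi k).
  by congr (- _); apply: eq_Rintegral => x _; rewrite mxE.
move: c1; rewrite E => c1.
by apply: (cvg_unique _ c1) => //; exact: cvgN.
Qed.

Lemma Lint_coor H i : (forall j, measurable_fun Omega (fun x => H x ord0 j)) ->
  (Lint p (fun x => H x ord0 i) <= Lint p (fun x => enorm (H x)))%E.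
Proof.
move=> mH; apply: le_Lint => //; [exact: ltW|exact: measurable_enorm|].
by move=> x _; rewrite [leRHS]ger0_norm ?enorm_ge0//; exact: coor_le_enorm.
Qed.

Lemma Lint_enorm H : (forall j, measurable_fun Omega (fun x => H x ord0 j)) ->
  (Lint p (fun x => enorm (H x)) <= Lint p (fun x => \sum_(i < n) `|H x ord0 i|)%R)%E.
Proof.
move=> mH; apply: le_Lint => //; [exact: ltW|exact: measurable_enorm| |].
  by apply: measurable_sum => i; exact: measurableT_comp.
move=> x _; rewrite !ger0_norm ?enorm_ge0//; first exact: enorm_le_sum.
exact: sumr_ge0.
Qed.

Lemma Lint_ae_eq f g : measurable_fun Omega f -> measurable_fun Omega g ->
  {ae leb, forall x, Omega x -> f x = g x} -> Lint p f = Lint p g.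
Proof.
move=> mf mg fg; rewrite !LintE; apply: ge0_ae_eq_integral => //.
- exact: measurable_Lint.
- exact: measurable_Lint.
- by apply: filterS fg => x fgx Dx; rewrite fgx.
Qed.

Lemma is_weak_gradient_measurable u G : is_weak_gradient Omega u G ->
  measurable_fun Omega u /\ (forall i, measurable_fun Omega (fun x => G x ord0 i)).
Proof. by move=> [[mu _] lG _]; split=> // i; have [] := lG i. Qed.

(** Frees the norm from the choice of gradient: any weak gradient agrees with the chosen one almost
    everywhere. *)
Lemma normW1E u G : is_weak_gradient Omega u G ->
  normW1 Omega p u = ((Lint p u) `^ p^-1 + (Lint p (fun x => enorm (G x))) `^ p^-1)%E.
Proof.
move=> uG; rewrite /normW1 !normLpE//; congr (_ + _ `^ _)%E.
have [mu mG] := is_weak_gradient_measurable uG.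
have [_ mG'] := is_weak_gradient_measurable (weak_gradient_is uG).
apply: Lint_ae_eq; [exact: measurable_enorm|exact: measurable_enorm|].
by apply: filterS (weak_gradientP oO uG) => x H /H ->.
Qed.

Lemma in_W10_approx u G : is_weak_gradient Omega u G -> in_W10 Omega p u -> approx_W10 u G.
Proof.
move=> uG [[mu _ nu] [phi [tphi cphi]]].
have [_ mG] := is_weak_gradient_measurable uG.
move: nu; rewrite (normW1E uG) => nu.
have iG : (Lint p (fun x => enorm (G x)) < +oo)%E.
  apply: (@lty_poweRy _ _ p^-1); first by rewrite invr_neq0// gt_eqF.
  by apply: le_lt_trans nu; rewrite leeDr// poweR_ge0.
split => //.
- apply: (@lty_poweRy _ _ p^-1); first by rewrite invr_neq0// gt_eqF.
  by apply: le_lt_trans nu; rewrite leeDl// poweR_ge0.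
- by move=> i; apply: le_lt_trans iG; exact: Lint_coor.
pose Dphi k x := \row_i 'D_(delta_mx ord0 i) (phi k) x.
have wB k := is_weak_gradientB oO uG (test_weak_gradient oO (tphi k)).
have mB k : forall i, measurable_fun Omega (fun x => (G x - Dphi k x) ord0 i).
  by have [_] := is_weak_gradient_measurable (wB k).
move: cphi; under eq_fun do rewrite (normW1E (wB _)).
move=> cphi.
have sq (a b : nat -> \bar R) : (forall k, 0 <= a k)%E -> (forall k, 0 <= b k)%E ->
    (fun k => a k + b k)%E @ \oo --> 0%E -> a @ \oo --> 0%E /\ b @ \oo --> 0%E.
  move=> a0 b0 ab; split; apply: (squeeze_cvge _ (cvg_cst 0%E) ab).
    by apply: nearW => k; rewrite a0/= leeDl.
  by apply: nearW => k; rewrite b0/= leeDr.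
have [c1 c2] := sq _ _ (fun k => poweR_ge0 _ _) (fun k => poweR_ge0 _ _) cphi.
exists phi; split => //.
  have := (@normLp_cvg0 _ _ _ leb Omega nat \oo _ p (fun k x => u x - phi k x) p0).1.
  by under eq_fun do rewrite normLpE//; apply.
move=> i.
have c3 : Lint p (fun x => enorm (G x - Dphi k x)) @[k --> \oo] --> 0%E.
  have := (@normLp_cvg0 _ _ _ leb Omega nat \oo _ p (fun k x => enorm (G x - Dphi k x)) p0).1.
  by under eq_fun do rewrite normLpE//; apply.
apply: (squeeze_cvge _ (cvg_cst 0%E) c3); apply: nearW => k; rewrite Lint_ge0/=.
apply: le_trans (Lint_coor i (mB k)).
by rewrite le_eqVlt; apply/orP; left; apply/eqP; f_equal; apply/funext => x; rewrite !mxE.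
Qed.

Lemma approx_in_W10 u G : approx_W10 u G -> in_W10 Omega p u.
Proof.
move=> ap; have uG := approx_is_weak_gradient ap.
have [mu mG iu iG [phi [tphi uphi Gphi]]] := ap.
split.
  split => //; first by exists G.
  rewrite (normW1E uG) lte_add_pinfty// poweR_lty//.
  apply: le_lt_trans (Lint_enorm mG) _; apply: Lint_sum_lty => // i.
    exact: measurableT_comp.
  by rewrite Lint_norm.
exists phi; split => //.
pose Dphi k x := \row_i 'D_(delta_mx ord0 i) (phi k) x.
have wB k := is_weak_gradientB oO uG (test_weak_gradient oO (tphi k)).
have mB k : forall i, measurable_fun Omega (fun x => (G x - Dphi k x) ord0 i).
  by have [_] := is_weak_gradient_measurable (wB k).
under eq_fun do rewrite (normW1E (wB _)).
have toL (f : nat -> 'rV[R]_n -> R) : Lint p (f k) @[k --> \oo] --> 0%E ->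
    (Lint p (f k) `^ p^-1)%E @[k --> \oo] --> 0%E.
  by move=> H; under eq_fun do rewrite -normLpE//; exact/normLp_cvg0.
apply: cvge0D; first exact: toL.
apply: (toL (fun k x => enorm (G x - Dphi k x))).
have c : Lint p (fun x => \sum_(i < n) `|(G x - Dphi k x) ord0 i|)%R @[k --> \oo] --> 0%E.
  apply: Lint_cvg0_sum => // [k i|i]; first exact: measurableT_comp.
  under eq_fun do rewrite Lint_norm.
  have -> : (fun k => Lint p (fun x => (G x - Dphi k x) ord0 i)) =
    (fun k => Lint p (fun x => G x ord0 i - 'D_(delta_mx ord0 i) (phi k) x)).
    by apply/funext => k; f_equal; apply/funext => x; rewrite !mxE.
  exact: Gphi.
apply: (squeeze_cvge _ (cvg_cst 0%E) c); apply: nearW => k; rewrite Lint_ge0/=.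
exact: Lint_enorm.
Qed.

Lemma approx_W10B u v G H : approx_W10 u G -> approx_W10 v H ->
  approx_W10 (fun x => u x - v x) (fun x => G x - H x).
Proof.
move=> [mu mG iu iG [phi [tphi uphi Gphi]]] [mv mH iv iH [psi [tpsi vpsi Hpsi]]].
have GHE i : (fun x => (G x - H x) ord0 i) = fun x => G x ord0 i - H x ord0 i.
  by apply/funext => x; rewrite !mxE.
have pge0 := ltW p0.
have mphi k := test_measurable (tphi k); have mpsi k := test_measurable (tpsi k).
have mDphi k i := test_measurable (test_function_derive (delta_mx ord0 i) (tphi k)).
have mDpsi k i := test_measurable (test_function_derive (delta_mx ord0 i) (tpsi k)).
split.
- exact: measurable_funB.
- by move=> i; rewrite GHE; exact: measurable_funB.
- exact: LintB_lty.
- by move=> i; rewrite GHE; exact: LintB_lty.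
have diff (f g : 'rV[R]_n -> R) (f_ g_ : nat -> 'rV[R]_n -> R) :
    measurable_fun Omega f -> measurable_fun Omega g ->
    (forall k, measurable_fun Omega (f_ k)) -> (forall k, measurable_fun Omega (g_ k)) ->
    Lint p (fun x => f x - f_ k x) @[k --> \oo] --> 0%E ->
    Lint p (fun x => g x - g_ k x) @[k --> \oo] --> 0%E ->
    Lint p (fun x => (f x - g x) - (f_ k x - g_ k x)) @[k --> \oo] --> 0%E.
  move=> mf mg mf_ mg_ cf cg.
  have -> : (fun k => Lint p (fun x => (f x - g x) - (f_ k x - g_ k x))) =
      (fun k => Lint p (fun x => (f x - f_ k x) + - (g x - g_ k x))).
    by apply/funext => k; f_equal; apply/funext => x; ring.
  apply: (Lint_cvg0D mO pge0 (f := fun k x => f x - f_ k x) (g := fun k x => - (g x - g_ k x))) => //.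
  - by move=> k; exact: measurable_funB.
  - by move=> k; apply: measurableT_comp => //; exact: measurable_funB.
  - by under eq_fun do rewrite LintN.
exists (fun k x => phi k x - psi k x); split.
- move=> k; have [K [cK KO f0]] := test_function_suppP (tphi k).
  have [K' [cK' KO' f0']] := test_function_suppP (tpsi k).
  have [s1 _ _] := tphi k; have [s2 _ _] := tpsi k.
  apply: (test_function_supp (smoothB s1 s2) (compactU cK cK')).
    by move=> x [/KO|/KO'].
  by move=> x nx; rewrite f0 ?f0' ?subrr// => ?; apply: nx; [right|left].
- exact: diff.
- move=> i.
  have -> : (fun k => Lint p (fun x => (G x - H x) ord0 i - 'D_(delta_mx ord0 i) (fun x => phi k x - psi k x) x)) =
      (fun k => Lint p (fun x => (G x ord0 i - H x ord0 i) -
         ('D_(delta_mx ord0 i) (phi k) x - 'D_(delta_mx ord0 i) (psi k) x))).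
    apply/funext => k; f_equal; apply/funext => x; rewrite !mxE; congr (_ - _).
    have [s1 _ _] := tphi k; have [s2 _ _] := tpsi k.
    by apply: (deriveB (f := phi k) (g := psi k)); exact: smooth_derivable.
  exact: diff.
Qed.

(** The approximating functions are [S] of the given ones; they remain test functions because [S] is
    smooth with [S 0 = 0]. The Lipschitz bound on the derivative of [S] controls the error made
    inside it. *)
Lemma approx_W10_comp u G (S : R -> R) (B L : R) : smooth S -> S 0 = 0 ->
  0 <= B -> 0 <= L ->
  (forall t, `|'D_1 S t| <= B) -> (forall s t, `|S s - S t| <= B * `|s - t|) ->
  (forall s t, `|'D_1 S s - 'D_1 S t| <= L * `|s - t|) ->
  approx_W10 u G -> approx_W10 (fun x => S (u x)) (fun x => 'D_1 S (u x) *: G x).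
Proof.
move=> sS S0 B0 L0 SB SL S'L [mu mG iu iG [phi [tphi uphi Gphi]]].
have pge0 := ltW p0.
have mS : measurable_fun setT S by apply: continuous_measurable_fun; exact: smooth_continuous.
have mS' : measurable_fun setT ('D_1 S).
  by apply: continuous_measurable_fun; apply: smooth_continuous; exact: smooth_derive.
have mphi k := test_measurable (tphi k).
have mDphi k i := test_measurable (test_function_derive (delta_mx ord0 i) (tphi k)).
have mSu : measurable_fun Omega (fun x => S (u x)) by exact: measurableT_comp.
have mS'u : measurable_fun Omega (fun x => 'D_1 S (u x)) by exact: (measurableT_comp mS').
have mS'phi k : measurable_fun Omega (fun x => 'D_1 S (phi k x)) by exact: (measurableT_comp mS').
have mSphi k : measurable_fun Omega (fun x => S (phi k x)) by exact: (measurableT_comp mS).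
have GE i : (fun x => ('D_1 S (u x) *: G x) ord0 i) = fun x => 'D_1 S (u x) * G x ord0 i.
  by apply/funext => x; rewrite !mxE.
split => //.
- by move=> i; rewrite GE; exact: measurable_funM.
- apply: (@le_lt_trans _ _ (Lint p (fun x => B * u x))).
    apply: le_Lint => //; first exact: measurable_funM.
    by move=> x _; have := SL (u x) 0; rewrite S0 !subr0 normrM (ger0_norm B0).
  by rewrite LintZ// lte_mul_pinfty// lee_fin powR_ge0.
- move=> i; rewrite GE; apply: (@le_lt_trans _ _ (Lint p (fun x => B * G x ord0 i))).
    apply: le_Lint => //; [exact: measurable_funM|exact: measurable_funM|].
    by move=> x _; rewrite !normrM ler_wpM2r// (ger0_norm B0).
  by rewrite LintZ// lte_mul_pinfty// lee_fin powR_ge0.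
exists (fun k x => S (phi k x)); split.
- move=> k; have [K [cK KO f0]] := test_function_suppP (tphi k).
  have [s1 _ _] := tphi k.
  by apply: (test_function_supp (smooth_comp sS s1) cK KO) => x nx; rewrite f0.
- apply: (@cvge0_le R nat \oo _ _ (fun k => Lint p (fun x => u x - phi k x)) (B `^ p)) => //.
    by move=> k; exact: Lint_ge0.
  move=> k; rewrite -[in leRHS](ger0_norm B0) -LintZ//; last exact: measurable_funB.
  apply: le_Lint => //; [exact: measurable_funB| |].
    by apply: measurable_funM => //; exact: measurable_funB.
  by move=> x _; rewrite normrM (ger0_norm B0).
move=> i.
(* The gradient error splits into a bounded factor times a small one, and a small bounded factor
   times the fixed [G]; the latter is the case of [Lint_cvg0_mul]. *)
have -> : (fun k => Lint p (fun x => ('D_1 S (u x) *: G x) ord0 i - 'D_(delta_mx ord0 i) (fun x => S (phi k x)) x)) =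
    (fun k => Lint p (fun x => 'D_1 S (phi k x) * (G x ord0 i - 'D_(delta_mx ord0 i) (phi k) x) +
                              ('D_1 S (u x) - 'D_1 S (phi k x)) * G x ord0 i)).
  apply/funext => k; f_equal; apply/funext => x; have [s1 _ _] := tphi k.
  by rewrite (congr1 (fun f => f x) (derive_smooth_comp (delta_mx ord0 i) sS s1)) !mxE; ring.
have mGi k : measurable_fun Omega (fun x => G x ord0 i - 'D_(delta_mx ord0 i) (phi k) x).
  exact: measurable_funB.
have mdS k : measurable_fun Omega (fun x => 'D_1 S (u x) - 'D_1 S (phi k x)).
  exact: measurable_funB.
have mdu k : measurable_fun Omega (fun x => u x - phi k x) by exact: measurable_funB.
apply: (Lint_cvg0D mO pge0 (f := fun k x => 'D_1 S (phi k x) * (G x ord0 i - 'D_(delta_mx ord0 i) (phi k) x))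
    (g := fun k x => ('D_1 S (u x) - 'D_1 S (phi k x)) * G x ord0 i)).
- by move=> k; exact: measurable_funM.
- by move=> k; exact: measurable_funM.
- apply: (@cvge0_le R nat \oo _ _ (fun k => Lint p (fun x => G x ord0 i - 'D_(delta_mx ord0 i) (phi k) x)) (B `^ p)) => //.
    by move=> k; exact: Lint_ge0.
  move=> k; rewrite -[in leRHS](ger0_norm B0) -LintZ//.
  apply: le_Lint => //; [exact: measurable_funM|exact: measurable_funM|].
  by move=> x _; rewrite !normrM ler_wpM2r// (ger0_norm B0).
- apply: (@Lint_cvg0_mul _ _ _ leb Omega mO p (fun k x => 'D_1 S (u x) - 'D_1 S (phi k x))
    (fun k x => u x - phi k x) (fun x => G x ord0 i) (B + B) L) => //.
  + by rewrite addr_ge0.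
  + by move=> k x _; rewrite (le_trans (ler_normB _ _))// lerD.
Qed.

End sobolev.

(** * Local Lipschitz bounds from W^{1,oo}_loc *)

Section locally_lipschitz.
Variable R : realType.
Local Notation leb1 := (@lebesgue_measure R).

Lemma real_supp_integrable (f : R -> R) (a b : R) : continuous f ->
  (forall t, ~ `[a, b]%classic t -> f t = 0) -> leb1.-integrable setT (EFin \o f).
Proof.
move=> cf f0; apply: (@integrable_supp _ _ _ leb1 setT `[a, b]%classic) => //.
  by move=> t _ nt; rewrite /= f0.
apply: continuous_compact_integrable; first exact: segment_compact.
exact: continuous_subspaceT.
Qed.

Section smooth_step.
Variable e : R.
Hypothesis e0 : 0 < e.

Definition step_density (t : R) : R := flat 0 t * flat 0 (e - t).

(** A smooth Heaviside function that rises on [0, e]. Its height [smooth_step e] is left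
    unnormalised and cancelled at the end of the Lipschitz estimate. *)
Definition smooth_step (t : R) : R := \int[leb1]_(s in `]-oo, t]) step_density s.

Lemma smooth_step_density : smooth step_density.
Proof.
apply: smoothM; first exact: smooth_flat.
apply: (smooth_comp (@smooth_flat R 0%N)).
by apply: smoothB; [exact: smooth_cst|exact: smooth_id].
Qed.

Lemma step_density_ge0 t : 0 <= step_density t.
Proof. by rewrite mulr_ge0 ?flat_ge0. Qed.

Lemma step_density_out t : ~ `[0, e]%classic t -> step_density t = 0.
Proof.
rewrite /= in_itv /= => /negP; rewrite negb_and -!ltNge => /orP[t0|te]; rewrite /step_density.
  by rewrite flat_le0 ?mul0r// ltW.
by rewrite [X in _ * X]flat_le0 ?mulr0// subr_le0 ltW.
Qed.

Lemma integrable_step_density : leb1.-integrable setT (EFin \o step_density).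
Proof.
apply: (@real_supp_integrable _ 0 e); last exact: step_density_out.
exact: smooth_continuous smooth_step_density.
Qed.

Lemma is_derive_smooth_step (t : R) : is_derive t 1 smooth_step (step_density t).
Proof.
have tu : t < t + 1 by rewrite ltrDl.
have iu : leb1.-integrable [set` Interval -oo%O (BRight (t + 1))] (EFin \o step_density).
  by apply: (integrableS _ _ _ integrable_step_density).
have [||d1 d2] := continuous_FTC1 tu iu.
- by rewrite ltNyr.
- exact: smooth_continuous smooth_step_density t.
by apply: DeriveDef; [exact: d1|rewrite -derive1E; exact: d2].
Qed.

Lemma smooth_smooth_step : smooth smooth_step.
Proof. exact: is_derive_smooth_real is_derive_smooth_step smooth_step_density. Qed.

Lemma smooth_step_le0 t : t <= 0 -> smooth_step t = 0.
Proof.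
move=> t0; rewrite /smooth_step (eq_Rintegral _ (g := cst 0)).
  by rewrite Rintegral_cst// mul0r.
move=> s; rewrite inE /= in_itv /= => st.
by rewrite /step_density flat_le0 ?mul0r// (le_trans st).
Qed.

Lemma smooth_step_nd : {homo smooth_step : s t / s <= t}.
Proof.
move=> s t st; apply: (@ger0_derive1_ndecr R smooth_step s t) => //.
- by move=> x _; have [] := is_derive_smooth_step x.
- move=> x _; rewrite derive1E; have [_ ->] := is_derive_smooth_step x.
  exact: step_density_ge0.
- by apply: continuous_subspaceT; exact: smooth_continuous smooth_smooth_step.
Qed.

Lemma smooth_step_ge t : e <= t -> smooth_step t = smooth_step e.
Proof.
move=> et; rewrite /smooth_step (@Rintegral_supp _ _ _ leb1 `]-oo, t]%classic `]-oo, e]%classic)//.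
  by move=> s /=; rewrite !in_itv /= => /le_trans; exact.
move=> s _ /=; rewrite in_itv /= => se; apply: step_density_out.
by rewrite /= in_itv /= => /andP[].
Qed.

Lemma smooth_step_gt0 : 0 < smooth_step e.
Proof.
have [x xe] : exists2 x, x \in `]0, e[ & smooth_step e - smooth_step 0 = step_density x * (e - 0).
  apply: (@MVT R smooth_step step_density) => //.
    by move=> x _; exact: is_derive_smooth_step.
  by apply: continuous_subspaceT; exact: smooth_continuous smooth_smooth_step.
rewrite (smooth_step_le0 (lexx 0)) !subr0 => ->.
move: xe; rewrite in_itv /= => /andP[x0 xe].
rewrite mulr_gt0// /step_density /flat x0 subr_gt0 xe !expr0 !mul1r.
by rewrite mulr_gt0 ?expR_gt0.
Qed.

Lemma smooth_step_bound t : 0 <= smooth_step t <= smooth_step e.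
Proof.
apply/andP; split.
  have [t0|/ltW t0] := leP t 0; first by rewrite smooth_step_le0.
  by rewrite -(smooth_step_le0 (lexx 0)) smooth_step_nd.
have [te|/ltW te] := leP t e; first exact: smooth_step_nd.
by rewrite (smooth_step_ge te).
Qed.

Lemma is_derive_smooth_step_shift (a t : R) :
  is_derive t 1 (fun t => smooth_step (t - a)) (step_density (t - a)).
Proof.
have d : is_derive t 1 (fun t : R => t - a) 1 by apply: is_derive_eq; rewrite subr0.
rewrite -[X in is_derive _ _ _ X]mulr1.
exact: (is_derive_comp_real (s := smooth_step) (f := fun t : R => t - a) (is_derive_smooth_step (t - a)) d).
Qed.

Lemma continuous_step_density_shift (a : R) : continuous (fun t => step_density (t - a)).
Proof.
apply: smooth_continuous; apply: (smooth_comp smooth_step_density).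
by apply: smoothB; [exact: smooth_id|exact: smooth_cst].
Qed.

Lemma step_density_shift_out (a t : R) : ~ `[a, a + e]%classic t -> step_density (t - a) = 0.
Proof.
move=> nt; apply: step_density_out => H; apply: nt; move: H; rewrite /= !in_itv /=.
by rewrite subr_ge0 lerBlDl.
Qed.

Lemma integral_step_density (a : R) : \int[leb1]_t step_density (t - a) = smooth_step e.
Proof.
rewrite (@Rintegral_supp _ _ _ leb1 setT `[a, a + e]%classic)//; last first.
  by move=> t _; exact: step_density_shift_out.
rewrite /Rintegral (@continuous_FTC2 _ _ (fun t => smooth_step (t - a)))//.
- have -> : a + e - a = e by ring.
  by rewrite subrr [X in (_ - X%:E)%E]smooth_step_le0// sube0.
- by rewrite ltrDl.
- by apply: continuous_subspaceT; exact: continuous_step_density_shift.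
- have cs : continuous (fun t => smooth_step (t - a)).
    by move=> t; apply: differentiable_continuous; apply/derivable1_diffP; have [] := is_derive_smooth_step_shift a t.
  split.
  + by move=> t _; have [] := is_derive_smooth_step_shift a t.
  + by apply: cvg_at_right_filter; exact: cs.
  + by apply: cvg_at_left_filter; exact: cs.
- by move=> t _; rewrite derive1E; have [_ ->] := is_derive_smooth_step_shift a t.
Qed.

(** The shifted density lives on [a, a + e] and has mass [smooth_step e], so up to this factor the
    integral averages [f] near [a]. *)
Lemma step_density_average (f : R -> R) (a w : R) : continuous f ->
  (forall t, a <= t <= a + e -> `|f t - f a| <= w) ->
  `|\int[leb1]_t (f t * step_density (t - a)) - f a * smooth_step e| <= w * smooth_step e.
Proof.
move=> cf fw.
have cd := @continuous_step_density_shift a.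
have supp := @step_density_shift_out a.
have i1 : leb1.-integrable setT (fun t => (f t * step_density (t - a))%:E).
  apply: (@real_supp_integrable _ a (a + e)) => [t|t nt]; last by rewrite supp// mulr0.
  by apply: (@continuousM _ _ f (fun t => step_density (t - a))); [exact: cf|exact: cd].
have i2 : leb1.-integrable setT (EFin \o (fun t => step_density (t - a))).
  by apply: (@real_supp_integrable _ a (a + e)).
have i3 (c : R) : leb1.-integrable setT (fun t => (c * step_density (t - a))%:E).
  exact: (integrableZl measurableT c i2).
rewrite -(integral_step_density a) -!RintegralZl// -RintegralB//; last exact: i3.
have i4 : leb1.-integrable setT (fun t => (f t * step_density (t - a) - f a * step_density (t - a))%:E).
  exact: (integrableB measurableT i1 (i3 (f a))).
apply: le_trans (le_normr_Rintegral measurableT i4) _.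
apply: le_Rintegral => //; [exact: integrable_norm|exact: i3|].
move=> t _; rewrite -mulrBl normrM (ger0_norm (step_density_ge0 _)).
have [ta|ta] := pselect (`[a, a + e]%classic t); last by rewrite supp// !mulr0.
by rewrite ler_wpM2r ?step_density_ge0// fw.
Qed.

End smooth_step.

(** The weak derivative is tested with a smooth version of the indicator of [s, t], a difference of
    two steps. The derivative of this test averages [f] near [s] and near [t], while the other side
    is at most the essential bound of [f'] times the length of the interval. *)
Lemma W1oo_loc_lipschitz (f : R -> R) (K : R) : W1oo_loc f ->
  exists2 L : R, 0 <= L & forall s t, `|s| <= K -> `|t| <= K -> `|f s - f t| <= L * `|s - t|.
Proof.
(* The test function lives on [s, t + e] with [e <= 1], hence the bound of [f'] is taken on a range
   larger by 1. *)
move=> [cf [f' [mf' /(_ (K + 1))[C HC] ibp]]].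
pose L := Num.max C 0; have L0 : 0 <= L by rewrite le_max lexx orbT.
exists L => // s t.
wlog st : s t / s <= t.
  move=> H sK tK; have [/H|/ltW/H] := leP s t; first exact.
  by rewrite distrC [`|t - s|]distrC; exact.
move=> sK tK.
rewrite [X in _ <= _ * X]ler0_norm ?subr_le0// opprB.
apply/ler_addgt0Pr => w w0.
have w4 : 0 < w / 4 by lra.
have near_le (a : R) : \forall x \near nbhs a, `|f x - f a| <= w / 4.
  have /cvgrPdist_le/(_ _ w4) := cf a.
  by apply: filterS => x; rewrite distrC.
have /nbhs_ballP[e1 /= e10 H1] := near_le s; have /nbhs_ballP[e2 /= e20 H2] := near_le t.
(* The first two constraints keep both averages within [w / 4] of the point values, the third keeps
   the support in the range of the bound, the last gives [L * e <= w / 4]. The total error is then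
   at most [w]. *)
pose e := Num.min (Num.min (e1 / 2) (e2 / 2)) (Num.min 1 (w / 4 / (L + 1))).
have L1 : 0 < L + 1 by lra.
have e0 : 0 < e by rewrite !lt_min !divr_gt0// ltr01.
have ee1 : e < e1 by rewrite /e !gt_min [e1 / 2 < e1](_ : _ = true)//; lra.
have ee2 : e < e2 by rewrite /e !gt_min [e2 / 2 < e2](_ : _ = true) ?orbT//; lra.
have e1' : e <= 1 by rewrite /e !ge_min lexx !orbT.
have eL : L * e <= w / 4.
  have : e <= w / 4 / (L + 1) by rewrite /e !ge_min lexx !orbT.
  rewrite ler_pdivlMr// => H; apply: le_trans H; rewrite mulrC ler_wpM2l//; lra.
have A1 := @step_density_average e e0 f s (w / 4) cf.
have A2 := @step_density_average e e0 f t (w / 4) cf.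
set c := smooth_step e e in A1 A2.
have c0 : 0 < c by exact: smooth_step_gt0.
have {}A1 := A1 _; have {}A2 := A2 _.
have {A1}/A1 A1 : forall x, s <= x <= s + e -> `|f x - f s| <= w / 4.
  move=> x /andP[sx xs]; apply: H1; rewrite /ball /= ler0_norm; lra.
have {A2}/A2 A2 : forall x, t <= x <= t + e -> `|f x - f t| <= w / 4.
  move=> x /andP[sx xs]; apply: H2; rewrite /ball /= ler0_norm; lra.
pose phi x := smooth_step e (x - s) - smooth_step e (x - t).
have phi0 x : ~ `[s, t + e]%classic x -> phi x = 0.
  rewrite /= in_itv /= => /negP; rewrite negb_and -!ltNge /phi => /orP[xs|xt].
    by rewrite !smooth_step_le0 ?subrr//; lra.
  by rewrite (@smooth_step_ge e (x - s)) ?(@smooth_step_ge e (x - t)) ?subrr//; lra.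
have sphi : smooth phi.
  apply: smoothB; apply: (smooth_comp (@smooth_smooth_step e));
    by apply: smoothB; [exact: smooth_id|exact: smooth_cst].
have tphi : test_function setT phi.
  exact: (test_function_supp sphi (@segment_compact R s (t + e)) (fun _ _ => I) phi0).
have dphi x : derive1 phi x = step_density e (x - s) - step_density e (x - t).
  rewrite derive1E.
  have := is_deriveB (@is_derive_smooth_step_shift e s x) (@is_derive_smooth_step_shift e t x).
  by move=> [_ <-].
have := ibp phi tphi.
under eq_Rintegral do rewrite dphi mulrBr.
have ci (a : R) : leb1.-integrable setT (fun x => (f x * step_density e (x - a))%:E).
  apply: (@real_supp_integrable _ a (a + e)) => [x|x nx]; last by rewrite (@step_density_shift_out e a)// mulr0.
  by apply: (@continuousM _ _ f (fun t => step_density e (t - a))); [exact: cf|exact: continuous_step_density_shift].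
rewrite RintegralB//; [|exact: ci|exact: ci].
set I1 := \int[_]_(_ in _) _ in A1 *; set I2 := \int[_]_(_ in _) _ in A2 *.
set J := \int[_]_(_ in _) _ => E.
have HJ : `|J| <= L * c * (t - s + e).
  pose A : set (measurableTypeR R) := `[s, t + e]%classic.
  have mA : measurable A by exact: measurable_itv.
  have lA : (leb1 A = (t - s + e)%:E)%E.
    by rewrite /A lebesgue_measure_itv /= lte_fin ifT -?EFinB; [congr EFin; ring|lra].
  have mphi : measurable_fun setT phi.
    by apply: continuous_measurable_fun; exact: smooth_continuous sphi.
  have mfp : measurable_fun A (fun x => f' x * phi x).
    by apply: measurable_funS (measurable_funM mf' mphi).
  have phiB x : `|phi x| <= c.
    have /andP[? ?] := @smooth_step_bound e (x - s).
    have /andP[? ?] := @smooth_step_bound e (x - t).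
    by rewrite ler_norml /phi /c; apply/andP; split; lra.
  have bd : {ae leb1, forall x, A x -> `|f' x * phi x| <= L * c}.
    move: HC; apply: (@filterS _ _ (ae_filter_ringOfSetsType leb1)) => x Hx.
    rewrite /A /= in_itv /= => /andP[x1 x2].
    rewrite normrM ler_pM// le_max Hx//.
    move: sK tK; rewrite !ler_norml => /andP[? ?] /andP[? ?]; apply/andP; split; lra.
  have fA : (leb1 A < +oo)%E by rewrite lA ltry.
  have iLc := integrable_cst_fin mA fA (L * c).
  have IA := ae_le_integrable_real mA mfp iLc bd.
  rewrite /J (@Rintegral_supp _ _ _ leb1 setT A)//; last first.
    by move=> x _ nx; rewrite phi0// mulr0.
  apply: le_trans (le_normr_Rintegral mA IA) _.
  rewrite (_ : _ * _ = \int[leb1]_(x in A) (L * c)); last first.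
    by rewrite Rintegral_cst//; congr (_ * _); exact: (congr1 fine (esym lA)).
  exact: (ae_le_Rintegral mA (integrable_norm_real IA) iLc bd).
suff : c * `|f s - f t| <= c * (L * (t - s) + w) by rewrite ler_pM2l.
have -> : c * `|f s - f t| = `|(f s * c) - (f t * c)| by rewrite -mulrBl normrM mulrC (gtr0_norm c0).
have : `|f s * c - f t * c| <= `|I1 - f s * c| + `|I2 - f t * c| + `|J|.
  have -> : f s * c - f t * c = - (I1 - f s * c) + (I2 - f t * c) + (I1 - I2) by ring.
  by rewrite E (le_trans (ler_normD _ _))// normrN lerD2r (le_trans (ler_normD _ _))// normrN.
move=> /le_trans; apply.
have : L * c * e <= w / 4 * c by rewrite mulrAC ler_wpM2r// ltW.
have -> : c * (L * (t - s) + w) = w / 4 * c + w / 4 * c + (L * c * (t - s) + w / 4 * c + w / 4 * c) by field.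
move: HJ; rewrite mulrDr => HJ H; apply: lerD; first exact: lerD.
have := mulr_ge0 (ltW w4) (ltW c0); lra.
Qed.

End locally_lipschitz.

(** * Rescaled approximate signs *)

Section scalar_bounds.
Variable R : realType.
Implicit Types (r t z c : R) (k : nat).

Lemma is_derive_lipschitz (f df : R -> R) (B : R) : 0 <= B ->
  (forall t : R, is_derive t 1 f (df t)) -> (forall t, `|df t| <= B) ->
  forall s t, `|f s - f t| <= B * `|s - t|.
Proof.
move=> B0 fdf dfB s t.
wlog st : s t / s < t.
  move=> H; have [/H//|/H|->] := ltgtP s t; last by rewrite !subrr !normr0 mulr0.
  by rewrite distrC [`|t - s|]distrC.
have cf : {within `[s, t], continuous f}.
  apply: continuous_subspaceT => x; apply: differentiable_continuous.
  by apply/derivable1_diffP; have [] := fdf x.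
have [x _ E] := MVT st (fun x _ => fdf x) cf.
by rewrite distrC [`|s - t|]distrC E normrM ler_wpM2r.
Qed.

Definition dlogistic z := logistic z * (1 - logistic z).

Lemma dlogistic_ge0 z : 0 <= dlogistic z.
Proof. by rewrite mulr_ge0 ?subr_ge0 ?ltW ?logistic_gt0 ?logistic_lt1. Qed.

Lemma dlogistic_le1 z : dlogistic z <= 1.
Proof.
rewrite mulr_ile1 ?subr_ge0 ?(ltW (logistic_gt0 z)) ?(ltW (logistic_lt1 z))//.
by rewrite gerBl ltW// logistic_gt0.
Qed.

Lemma dlogisticE z : dlogistic z = expR (- z) / (1 + expR (- z)) ^+ 2.
Proof.
have H : 1 + expR (- z) != 0 by rewrite gt_eqF// addr_gt0 ?expR_gt0.
by rewrite /dlogistic /logistic; field.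
Qed.

Lemma dlogisticN z : dlogistic (- z) = dlogistic z.
Proof.
rewrite !dlogisticE opprK.
have -> : expR z = (expR (- z))^-1 by rewrite expRN invrK.
have := expR_gt0 (- z); move: (expR (- z)) => E E0.
by field; rewrite !gt_eqF ?addr_gt0.
Qed.

Lemma dlogistic_norm z : dlogistic `|z| = dlogistic z.
Proof. by have [//|] := ger0P z; rewrite dlogisticN. Qed.

Lemma dlogistic_le z : dlogistic z <= expR (- `|z|).
Proof.
rewrite -dlogistic_norm dlogisticE ler_pdivrMr ?exprn_gt0 ?addr_gt0 ?expR_gt0//.
by rewrite ler_peMr ?expR_ge0// exprn_ege1// lerDl expR_ge0.
Qed.

Lemma dlogistic_ge z : expR (- `|z|) / 4 <= dlogistic z.
Proof.
rewrite -dlogistic_norm dlogisticE ler_pM2l ?expR_gt0// lef_pV2 ?posrE ?exprn_gt0 ?addr_gt0 ?expR_gt0//.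
have : expR (- `|z|) <= 1 by rewrite -expR0 ler_expR oppr_le0.
have := expR_ge0 (- `|z|); move: (expR _) => E E0 E1.
by nra.
Qed.

Lemma sqr_expRN t : 0 <= t -> t ^+ 2 * expR (- t) <= 2.
Proof.
move=> t0; rewrite expRN ler_pdivrMr ?expR_gt0//.
have := expR_ge1Dxn 1 t0; rewrite (_ : 2`!%:R = 2 :> R)//.
by move: (expR t) => E; lra.
Qed.

(** Exponential decay beats the square, uniformly in [z]. At [z = k.+1%:R * r] this yields both the
    uniform bound on [dsstep] times |r| and the convergence of [dsstep] to 0 away from the
    origin. *)
Lemma sqr_dlogistic z c : z ^+ 2 * dlogistic (z - c) <= 4 + 2 * c ^+ 2.
Proof.
have H := sqr_expRN (normr_ge0 (z - c)).
have e1 : expR (- `|z - c|) <= 1 by rewrite -expR0 ler_expR oppr_le0.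
have := dlogistic_le (z - c); have := dlogistic_ge0 (z - c).
move: H e1; rewrite real_normK ?num_real//; have := expR_ge0 (- `|z - c|).
move: (expR _) (dlogistic _) => E l E0 HE E1 l0 lE.
apply: (@le_trans _ _ (z ^+ 2 * E)); first by rewrite ler_wpM2l// sqr_ge0.
have : z ^+ 2 <= 2 * (z - c) ^+ 2 + 2 * c ^+ 2 by have := sqr_ge0 (z - 2 * c); nra.
move=> /(ler_wpM2r E0); have := sqr_ge0 c; nra.
Qed.

(** The limit in k gives the positive and negative sets of r the weights 1 - a
    and - a with a = logistic (- c); sending c to +oo or -oo then selects one of
    the two sets. *)
Definition sstep c k r := logistic (k.+1%:R * r - c) - logistic (- c).

Definition dsstep c k r := k.+1%:R * dlogistic (k.+1%:R * r - c).

Lemma sstep0 c k : sstep c k 0 = 0.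
Proof. by rewrite /sstep mulr0 sub0r subrr. Qed.

Lemma is_derive_affine (a c r : R) : is_derive r 1 (fun r : R => a * r - c) a.
Proof. by apply: is_derive_eq; rewrite /GRing.scale /= subr0 mulr1. Qed.

Lemma is_derive_sstep c k r : is_derive r 1 (sstep c k) (dsstep c k r).
Proof.
have d := @is_derive_comp_real _ _ _ (fun r : R => k.+1%:R * r - c) r 1 _ _ (is_derive_logistic (k.+1%:R * r - c)) (is_derive_affine k.+1%:R c r).
have d2 : is_derive r 1 (cst (logistic (- c)) : R -> R) 0 by exact: is_derive_cst.
rewrite /dsstep mulrC -[X in is_derive _ _ _ X]subr0.
exact: (is_deriveB d d2).
Qed.

Lemma smooth_sstep c k : smooth (sstep c k).
Proof.
apply: smoothB; last exact: smooth_cst.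
apply: (smooth_comp (@smooth_logistic R)); apply: smoothB; last exact: smooth_cst.
by apply: smoothM; [exact: smooth_cst|exact: smooth_id].
Qed.

Lemma derive_sstep c k : 'D_1 (sstep c k) = dsstep c k.
Proof. by apply/funext => r; have [_] := is_derive_sstep c k r. Qed.

Lemma dsstep_ge0 c k r : 0 <= dsstep c k r.
Proof. by rewrite mulr_ge0 ?dlogistic_ge0. Qed.

Lemma dsstep_le c k r : `|dsstep c k r| <= k.+1%:R.
Proof. by rewrite ger0_norm ?dsstep_ge0// ler_piMr// dlogistic_le1. Qed.

Lemma sstep_lipschitz c k r t : `|sstep c k r - sstep c k t| <= k.+1%:R * `|r - t|.
Proof. exact: (is_derive_lipschitz _ (is_derive_sstep c k) (dsstep_le c k)). Qed.

Lemma is_derive_dlogistic (t : R) : is_derive t 1 dlogistic (dlogistic t * (1 - 2 * logistic t)).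
Proof.
have d1 := is_derive_logistic t.
have d2 := is_deriveB (is_derive_cst (1 : R) t 1) d1.
have -> : dlogistic t * (1 - 2 * logistic t) = logistic t *: (0 - logistic t * (1 - logistic t)) +
    (cst 1 - @logistic R) t *: (logistic t * (1 - logistic t)).
  by rewrite -[(cst 1 - _) t]/(1 - logistic t) /GRing.scale /= /dlogistic; ring.
exact: (is_deriveM d1 d2).
Qed.

Lemma dsstep_lipschitz c k r t : `|dsstep c k r - dsstep c k t| <= (k.+1%:R ^+ 2) * `|r - t|.
Proof.
rewrite /dsstep -mulrBr normrM (ger0_norm (ler0n _ _)) expr2 -mulrA ler_wpM2l//.
have -> : k.+1%:R * `|r - t| = 1 * `|(k.+1%:R * r - c) - (k.+1%:R * t - c)|.
  by rewrite mul1r -[X in X * _](ger0_norm (ler0n R k.+1)) -normrM; congr `|_|; ring.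
apply: (is_derive_lipschitz ler01 is_derive_dlogistic) => x.
rewrite normrM (ger0_norm (dlogistic_ge0 _)) mulr_ile1 ?dlogistic_ge0 ?dlogistic_le1//.
have := logistic_gt0 x; have := logistic_lt1 x.
by move=> ? ?; rewrite ler_norml; apply/andP; split; lra.
Qed.

Lemma sstep_le1 c k r : `|sstep c k r| <= 1.
Proof.
rewrite /sstep ler_norml.
have := logistic_gt0 (k.+1%:R * r - c); have := logistic_lt1 (k.+1%:R * r - c).
have := logistic_gt0 (- c); have := logistic_lt1 (- c).
by move=> ? ? ? ?; apply/andP; split; lra.
Qed.

Lemma logistic_nd : {homo @logistic R : r t / r <= t}.
Proof.
move=> r t rt; rewrite /logistic lef_pV2 ?posrE ?addr_gt0 ?expR_gt0//.
by rewrite lerD2l ler_expR lerN2.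
Qed.

Lemma sstep_nd c k : {homo sstep c k : r t / r <= t}.
Proof. by move=> r t rt; rewrite lerB// logistic_nd// lerB// ler_wpM2l. Qed.

Definition asign (a r : R) : R := if 0 < r then 1 - a else if r < 0 then - a else 0.

Lemma logistic_cvgy (a c : R) : 0 < a -> logistic (k.+1%:R * a - c) @[k --> \oo] --> (1 : R).
Proof.
move=> a0; apply/cvgrPdist_lt => e e0; near=> k.
rewrite /logistic.
have E0 := expR_gt0 (- (k.+1%:R * a - c)).
have : expR (- (k.+1%:R * a - c)) < e.
  rewrite -[X in _ < X](lnK (x := e)) ?posrE// ltr_expR ltrNl ltrBrDr.
  rewrite -ltr_pdivrMr// (@lt_le_trans _ _ k%:R) ?ler_nat//.
  by near: k; exact: nbhs_infty_gtr.
move: E0; move: (expR _) => E E0 Ee.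
have -> : 1 - (1 + E)^-1 = E / (1 + E) by field; rewrite gt_eqF// addr_gt0.
rewrite ger0_norm ?divr_ge0 ?addr_ge0 ?(ltW E0)//.
by rewrite (le_lt_trans _ Ee)// ler_pdivrMr ?addr_gt0// ler_peMr ?(ltW E0)// lerDl (ltW E0).
Unshelve. all: by end_near. Qed.

Lemma logisticN z : logistic (- z) = 1 - logistic z.
Proof.
rewrite /logistic opprK.
have -> : expR z = (expR (- z))^-1 by rewrite expRN invrK.
have := expR_gt0 (- z); move: (expR (- z)) => E E0.
by field; rewrite !gt_eqF ?addr_gt0.
Qed.

Lemma sstep_cvg c r : sstep c k r @[k --> \oo] --> asign (logistic (- c)) r.
Proof.
rewrite /asign; case: ltgtP => [r0|r0|<-].
- apply: cvgB; last exact: cvg_cst.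
  exact: logistic_cvgy.
- rewrite -[X in _ --> X]add0r; apply: cvgB; last exact: cvg_cst.
  have H : logistic (k.+1%:R * (- r) - (- c)) @[k --> \oo] --> (1 : R).
    by apply: logistic_cvgy; rewrite oppr_gt0.
  have -> : (fun k => logistic (k.+1%:R * r - c)) = fun k => 1 - logistic (k.+1%:R * (- r) - (- c)).
    by apply/funext => k; rewrite -logisticN; congr logistic; ring.
  by rewrite -(subrr 1); apply: cvgB => //; exact: cvg_cst.
- by under eq_fun do rewrite sstep0; exact: cvg_cst.
Qed.

(** The left side depends on [k] and [r] only through their product [k.+1%:R * r]. The factor |r|
    will come from the Lipschitz bound on the flux. *)
Lemma dsstep_mul_le c k r : `|r| * dsstep c k r <= 5 + 2 * c ^+ 2.
Proof.
have -> : `|r| * dsstep c k r = `|k.+1%:R * r| * dlogistic (k.+1%:R * r - c).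
  by rewrite /dsstep normrM (ger0_norm (ler0n _ _)); ring.
move: (k.+1%:R * r) => z.
have := sqr_dlogistic z c; have := dlogistic_le1 (z - c); have := dlogistic_ge0 (z - c).
rewrite -(real_normK (num_real z)); move: (dlogistic _) => l l0 l1.
by have := normr_ge0 z; move: `|z| => y y0; have := sqr_ge0 (y - 1); nra.
Qed.

Lemma dsstep_cvg0 c r : r != 0 -> dsstep c k r @[k --> \oo] --> (0 : R).
Proof.
move=> r0; have r2 : 0 < r ^+ 2 by rewrite exprn_even_gt0.
have H k : `|dsstep c k r| <= (4 + 2 * c ^+ 2) / r ^+ 2 * k.+1%:R^-1.
  rewrite ger0_norm ?dsstep_ge0//.
  have := sqr_dlogistic (k.+1%:R * r) c; rewrite exprMn => H.
  have k0 : 0 < k.+1%:R :> R by [].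
  rewrite mulrAC ler_pdivlMr// ler_pdivlMr// /dsstep; apply: le_trans H.
  by rewrite le_eqVlt; apply/orP; left; apply/eqP; ring.
have c0 : ((4 + 2 * c ^+ 2) / r ^+ 2 * k.+1%:R^-1) @[k --> \oo] --> (0 : R).
  rewrite -(mulr0 ((4 + 2 * c ^+ 2) / r ^+ 2)); apply: cvgMr.
  exact: cvg_harmonic.
apply/cvgr0Pnorm_lt => e e0.
near=> k; apply: le_lt_trans (H k) _.
rewrite (le_lt_trans (ler_norm _))//; near: k.
by move/cvgr0_norm_lt : c0; apply.
Unshelve. all: by end_near. Qed.

Lemma natr_le_expR k : k.+1%:R <= expR k%:R :> R.
Proof. by rewrite -natr1 addrC; exact: expR_ge1Dx. Qed.

(** For |r| at least 1, the factor k + 1 is at most exp k, which the extra decay exp (- k |r|)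
    absorbs. The integrand for [k = 0] thus dominates all others where no Lipschitz bound on the
    flux is available. *)
Lemma dsstep_ratio c k r : 1 <= `|r| ->
  dsstep c k r <= 4 * expR (2 * `|c|) * dsstep c 0 r.
Proof.
move=> r1.
apply: (@le_trans _ _ (k.+1%:R * expR (- `|k.+1%:R * r - c|))).
  by rewrite ler_wpM2l// dlogistic_le.
apply: (@le_trans _ _ (expR (2 * `|c|) * expR (- `|r - c|))); last first.
  rewrite /dsstep !mul1r [leRHS](_ : _ = expR (2 * `|c|) * (4 * dlogistic (r - c))); last by ring.
  rewrite ler_wpM2l ?expR_ge0//.
  by have := dlogistic_ge (r - c); rewrite ler_pdivrMr// mulrC.
apply: (@le_trans _ _ (expR k%:R * expR (- `|k.+1%:R * r - c|))).
  by rewrite ler_wpM2r ?expR_ge0// natr_le_expR.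
rewrite -!expRD ler_expR.
have h1 : k.+1%:R * `|r| - `|c| <= `|k.+1%:R * r - c|.
  rewrite -[X in X * _](ger0_norm (ler0n R k.+1)) -normrM.
  exact: lerB_dist.
have h2 : `|r - c| <= `|r| + `|c| by exact: ler_normB.
have h3 : k%:R * 1 <= k%:R * `|r| by rewrite ler_wpM2l.
by move: h1; rewrite -natr1 => h1; nra.
Qed.

Lemma logisticN_small (e : R) : 0 < e -> exists c, logistic (- c) < e.
Proof.
move=> e0; exists (ln e^-1); rewrite /logistic opprK lnK ?posrE ?invr_gt0//.
rewrite -[X in _ < X]invrK ltf_pV2 ?posrE ?invr_gt0 ?addr_gt0 ?invr_gt0//.
by rewrite ltrDr.
Qed.

End scalar_bounds.

(** * The signed power of the fractional operator *)

Section signed_power.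
Variables (R : realType) (q : R).
Hypothesis q1 : 1 < q.

(** The function J of the overview. The factor [r] makes it vanish at 0 also for q < 2, where the
    other factor is singular. *)
Definition spow (r : R) : R := `|r| `^ (q - 2) * r.

Lemma spow_ge0E (r : R) : 0 <= r -> spow r = r `^ (q - 1).
Proof.
move=> r0; rewrite /spow ger0_norm// mulrC (_ : q - 2 = (q - 1) - 1); last by ring.
by rewrite mulr_powRB1 ?subr_gt0.
Qed.

Lemma spowN r : spow (- r) = - spow r.
Proof. by rewrite /spow normrN mulrN. Qed.

Lemma norm_spow r : `|spow r| = `|r| `^ (q - 1).
Proof.
have [r0|r0] := leP 0 r; first by rewrite spow_ge0E// ger0_norm ?powR_ge0// ger0_norm.
rewrite -[r]opprK spowN !normrN spow_ge0E ?oppr_ge0 ?(ltW r0)//.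
by rewrite ger0_norm ?powR_ge0// ltr0_norm.
Qed.

Lemma spow0 : spow 0 = 0.
Proof. by rewrite /spow mulr0. Qed.

Lemma spow_lt : {homo spow : r t / r < t}.
Proof.
have pos r t : 0 <= r -> r < t -> spow r < spow t.
  move=> r0 rt; rewrite !spow_ge0E//; last by rewrite (le_trans r0)// ltW.
  by apply: gt0_ltr_powR => //; rewrite ?subr_gt0// nnegrE// (le_trans r0)// ltW.
move=> r t rt; have [r0|r0] := leP 0 r; first exact: pos.
have [t0|t0] := leP t 0.
  by rewrite -[r]opprK -[t]opprK spowN (spowN (- t)) ltrN2 pos ?oppr_ge0// ltrN2.
apply: (@lt_trans _ _ 0).
  by rewrite -[r]opprK spowN oppr_lt0 -spow0 pos// oppr_gt0.
by rewrite -spow0 pos.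
Qed.

Lemma spow_le : {homo spow : r t / r <= t}.
Proof. by move=> r t; rewrite le_eqVlt => /predU1P[->//|/spow_lt/ltW]. Qed.

Lemma measurable_spow : measurable_fun setT spow.
Proof.
apply: measurable_funM => //.
by apply: (measurableT_comp (measurable_powR (q - 2))); exact: normr_measurable.
Qed.

End signed_power.

(** The larger of [a] and [b] bounds the product by its own p-th power. This crude form of Young's
    inequality suffices for integrability. *)
Lemma powR_young (R : realType) (p a b : R) : 1 < p -> 0 <= a -> 0 <= b ->
  a `^ (p - 1) * b <= a `^ p + b `^ p.
Proof.
move=> p1 a0 b0; have p0 : 0 < p by lra.
have [ab|ba] := leP a b.
  apply: (@le_trans _ _ (b `^ p)); last by rewrite lerDr powR_ge0.
  rewrite -(mulr_powRB1 b0 p0) mulrC ler_wpM2l// le_powR//; lra.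
apply: (@le_trans _ _ (a `^ p)); last by rewrite lerDl powR_ge0.
by rewrite -(mulr_powRB1 a0 p0) mulrC ler_wpM2r ?powR_ge0// ltW.
Qed.

(** * Inner product and monotonicity of the p-Laplacian *)

Section dot_product.
Variables (R : realType) (n : nat).
Implicit Types v w : 'rV[R]_n.

Lemma dotpC v w : dotp v w = dotp w v.
Proof. by apply: eq_bigr => i _; rewrite mulrC. Qed.

Lemma dotpDr v w z : dotp v (w + z) = dotp v w + dotp v z.
Proof. by rewrite -big_split; apply: eq_bigr => i _; rewrite !mxE mulrDr. Qed.

Lemma dotpZr a v w : dotp v (a *: w) = a * dotp v w.
Proof. by rewrite /dotp mulr_sumr; apply: eq_bigr => i _; rewrite !mxE; ring. Qed.

Lemma dotpNr v w : dotp v (- w) = - dotp v w.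
Proof. by rewrite -scaleN1r dotpZr mulN1r. Qed.

Lemma dotpBr v w z : dotp v (w - z) = dotp v w - dotp v z.
Proof. by rewrite dotpDr dotpNr. Qed.

Lemma dotpBl v w z : dotp (w - z) v = dotp w v - dotp z v.
Proof. by rewrite dotpC dotpBr ![dotp v _]dotpC. Qed.

Lemma enorm0_eq0 v : enorm v = 0 -> v = 0.
Proof.
move=> v0; apply/rowP => i; rewrite mxE; apply/eqP.
by rewrite -normr_le0 -v0 coor_le_enorm.
Qed.

Lemma cauchy_schwarz v w : `|dotp v w| <= enorm v * enorm w.
Proof.
have [v0|v0] := eqVneq (enorm v) 0.
  rewrite (enorm0_eq0 v0) dotpC -(scale0r 0) dotpZr mul0r normr0.
  by rewrite mulr_ge0 ?enorm_ge0.
have vp : 0 < enorm v ^+ 2 by rewrite exprn_gt0// lt_def v0 enorm_ge0.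
(* Up to the factor |v|^2, this vector is the component of [w] orthogonal to [v]. *)
have H := dotp_ge0 (enorm v ^+ 2 *: w - dotp v w *: v).
rewrite -(@ler_pXn2r _ 2) ?nnegrE ?mulr_ge0 ?enorm_ge0//.
rewrite real_normK ?num_real// exprMn.
move: H; rewrite dotpBl !dotpBr !dotpZr ![dotp (_ *: _) _]dotpC !dotpZr.
rewrite (dotpC w v) -!sqr_enorm.
move: (enorm v ^+ 2) (enorm w ^+ 2) (dotp v w) vp => a b x a0.
have -> : a * (a * b) - x * (a * x) - (a * (x * x) - x * (x * a)) = a * (a * b - x ^+ 2) by ring.
by rewrite pmulr_rge0// subr_ge0.
Qed.

(** By Cauchy-Schwarz the expression is at least its value for parallel vectors, which is (a^(p-1) -
    b^(p-1)) (a - b) for the norms a and b. *)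
Lemma plaplace_monotone (p : R) v w : 2 < p ->
  0 <= dotp (enorm v `^ (p - 2) *: v - enorm w `^ (p - 2) *: w) (v - w).
Proof.
move=> p2.
rewrite dotpBl !dotpBr ![dotp (_ *: _) _]dotpC !dotpZr -!sqr_enorm (dotpC w v).
have H x : 0 <= x -> x `^ (p - 2) * x ^+ 2 = x `^ (p - 1) * x.
  move=> x0; rewrite expr2 mulrA [X in X * _]mulrC (_ : p - 2 = (p - 1) - 1); last by ring.
  by rewrite mulr_powRB1//; lra.
have H1 x : 0 <= x -> x `^ (p - 2) * x = x `^ (p - 1).
  move=> x0; rewrite mulrC (_ : p - 2 = (p - 1) - 1); last by ring.
  by rewrite mulr_powRB1//; lra.
have := enorm_ge0 v; have := enorm_ge0 w.
have := cauchy_schwarz v w; rewrite ler_norml => /andP[_].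
move: (enorm v) (enorm w) (dotp v w) => a b x xab b0 a0.
have a2 := powR_ge0 a (p - 2); have b2 := powR_ge0 b (p - 2).
have mono : 0 <= (a `^ (p - 1) - b `^ (p - 1)) * (a - b).
  have [ab|ba] := leP a b.
    by rewrite mulr_le0// subr_le0// le_powR//; lra.
  by rewrite mulr_ge0// subr_ge0 ?(ltW ba)// le_powR//; [lra|exact: ltW].
apply: le_trans mono _.
rewrite -(H1 a a0) -(H1 b b0).
have := ler_wpM2l (addr_ge0 a2 b2) xab.
move: (a `^ _) (b `^ _) => A B; nra.
Qed.

End dot_product.

(** * Essential bounds *)

Section essential_bound.
Variables (R : realType) (n : nat) (D : set 'rV[R]_n).
Local Notation leb := (lebesgue_rV R n).

Lemma in_Loo_bound (u : 'rV[R]_n -> R) : in_Lp leb D +oo%E u ->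
  exists2 M : R, 0 <= M & {ae leb, forall x, D x -> `|u x| <= M}.
Proof.
(* The norm at +oo is 0 by convention if the whole space has measure zero; any bound then holds
   almost everywhere. *)
move=> [_]; rewrite /normLp unlock; case: ifPn => [_ H|/negP mu0 _]; last first.
  exists 0 => //; exists setT; split => //.
  by apply/eqP; rewrite eq_le measure_ge0 andbT leNgt; apply/negP.
have [|M HM] := @ess_supr_bounded _ _ _ leb (fun x => `|patch (fun=> 0) D u x|).
  by apply: le_lt_trans H; apply: le_ess_sup; apply: nearW => x /=.
exists `|M| => //; apply: filterS HM => x + Dx; rewrite /patch mem_set// => uM.
by rewrite (le_trans uM)// ler_norm.
Qed.

Lemma bounded_in_Loo (u : 'rV[R]_n -> R) (M : R) : measurable_fun D u ->
  (forall x, D x -> `|u x| <= M) -> in_Lp leb D +oo%E u.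
Proof.
move=> mu uM; split => //; rewrite /normLp unlock; case: ifPn => // _.
apply: (@le_lt_trans _ _ `|M|%:E); last by rewrite ltry.
apply/ess_supP; apply: nearW => x /=; rewrite lee_fin /patch.
case: ifPn => [/set_mem/uM H|_]; last by rewrite normr0.
by rewrite (le_trans H)// ler_norm.
Qed.

End essential_bound.

(** * The fractional Sobolev space and its form *)

Section fractional_space.
Variables (R : realType) (n : nat) (Omega : set 'rV[R]_n) (s q : R).
Hypothesis q1 : 1 < q.
Local Notation leb := (lebesgue_rV R n).
Local Notation leb2 := (leb \x leb)%E.
Local Notation E := ('rV[R]_n).
Implicit Types (u v phi : E -> R) (z : E * E).
Let q0 : 0 < q. Proof. exact: lt_trans q1. Qed.

Definition gkern z : R := enorm (z.1 - z.2) `^ (n%:R + s * q).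

Lemma gkern_ge0 z : 0 <= gkern z. Proof. exact: powR_ge0. Qed.

Lemma measurable_pair_diff u : measurable_fun setT u ->
  measurable_fun setT (fun z : E * E => u z.1 - u z.2).
Proof.
by move=> mu; apply: measurable_funB; [exact: (measurableT_comp mu)|exact: (measurableT_comp mu)].
Qed.

Lemma measurable_gkernV : measurable_fun setT (fun z => (gkern z)^-1).
Proof.
have -> : (fun z => (gkern z)^-1) = fun z => enorm (z.1 - z.2) `^ (- (n%:R + s * q)).
  by apply/funext => z; rewrite powRN.
apply: (measurableT_comp (measurable_powR _)).
apply: measurable_enorm => i.
rewrite (_ : (fun _ => _) = fun z : E * E => z.1 ord0 i - z.2 ord0 i); last first.
  by apply/funext => z; rewrite !mxE.
apply: measurable_funB.
  exact: (measurableT_comp (@measurable_coor R n i)).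
exact: (measurableT_comp (@measurable_coor R n i)).
Qed.

Definition gdiff u z : R := `|u z.1 - u z.2| `^ q / gkern z.

Lemma gdiff_ge0 u z : 0 <= gdiff u z.
Proof. by rewrite divr_ge0 ?powR_ge0. Qed.

Lemma measurable_gdiff u : measurable_fun setT u -> measurable_fun setT (gdiff u).
Proof.
move=> mu; apply: measurable_funM measurable_gkernV.
apply: (measurableT_comp (measurable_powR _)).
by apply: measurableT_comp => //; exact: measurable_pair_diff.
Qed.

Lemma gagliardo_lty u : measurable_fun setT u ->
  (gagliardo s q u < +oo)%E <-> leb2.-integrable setT (fun z => (gdiff u z)%:E).
Proof.
move=> mu; split=> [|/integrableP[_]].
  rewrite /gagliardo => /lty_poweRy H; have {}H := H (invr_neq0 (lt0r_neq0 q0)).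
  apply/integrableP; split; first by apply/measurable_EFinP; exact: measurable_gdiff.
  by under eq_integral do rewrite gee0_abs ?lee_fin ?gdiff_ge0//.
under eq_integral do rewrite gee0_abs ?lee_fin ?gdiff_ge0//.
by move=> H; exact: poweR_lty.
Qed.

Lemma in_Ws0_measurable u : in_Ws0 Omega s q u -> measurable_fun setT u.
Proof. by move=> [[]]. Qed.

Lemma in_Ws0_Lint u : in_Ws0 Omega s q u -> (Lint leb setT q u < +oo)%E.
Proof. by move=> [[_ H] _ _]; apply/normLp_lty. Qed.

Lemma in_Ws0_gdiff u : in_Ws0 Omega s q u -> leb2.-integrable setT (fun z => (gdiff u z)%:E).
Proof. by move=> Wu; apply/gagliardo_lty; [exact: in_Ws0_measurable|have [] := Wu]. Qed.

Lemma in_Ws0_comp u v (S : R -> R) (B : R) : 0 <= B -> S 0 = 0 -> measurable_fun setT S ->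
  (forall a b, `|S a - S b| <= B * `|a - b|) ->
  in_Ws0 Omega s q u -> in_Ws0 Omega s q v -> in_Ws0 Omega s q (fun x => S (u x - v x)).
Proof.
move=> B0 S0 mS SB Wu Wv.
have mu := in_Ws0_measurable Wu; have mv := in_Ws0_measurable Wv.
have mw : measurable_fun setT (fun x => u x - v x) by exact: measurable_funB.
have mSw : measurable_fun setT (fun x => S (u x - v x)) by exact: (measurableT_comp mS).
have qge0 := ltW q0.
split.
- split => //; apply/normLp_lty => //.
  apply: (@le_lt_trans _ _ (Lint leb setT q (fun x => B * (u x - v x)))).
    apply: le_Lint => //; first exact: measurable_funM.
    by move=> x _; have := SB (u x - v x) 0; rewrite S0 !subr0 normrM (ger0_norm B0).
  rewrite LintZ// lte_mul_pinfty ?lee_fin ?powR_ge0//.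
  by apply: LintB_lty => //; exact: in_Ws0_Lint.
- apply/gagliardo_lty => //.
  have iu := in_Ws0_gdiff Wu; have iv := in_Ws0_gdiff Wv.
  apply: (le_integrable_real measurableT (measurable_gdiff mSw)
    (integrableZ_real measurableT (B `^ q * 2 `^ q) (integrableD_real measurableT iu iv))).
  move=> z _; rewrite ger0_norm ?gdiff_ge0// /gdiff -mulrDl mulrA ler_wpM2r ?invr_ge0 ?gkern_ge0//.
  rewrite -mulrA.
  apply: (@le_trans _ _ ((B * `|(u z.1 - u z.2) - (v z.1 - v z.2)|) `^ q)).
    apply: le_powR => //; apply: le_trans (SB _ _) _.
    by rewrite (_ : u z.1 - v z.1 - _ = u z.1 - u z.2 - (v z.1 - v z.2))//; ring.
  rewrite powRM// ler_wpM2l ?powR_ge0//.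
  by have := powR_normD (u z.1 - u z.2) (- (v z.1 - v z.2)) qge0; rewrite normrN.
- have [_ _ u0] := Wu; have [_ _ v0] := Wv.
  by apply: filterS2 u0 v0 => x ux vx nOx; rewrite ux// vx// subrr.
Qed.

Definition gform u phi z : R :=
  `|u z.1 - u z.2| `^ (q - 2) * (u z.1 - u z.2) * (phi z.1 - phi z.2) / gkern z.

Lemma measurable_gform u phi : measurable_fun setT u -> measurable_fun setT phi ->
  measurable_fun setT (gform u phi).
Proof.
move=> mu mphi; apply: measurable_funM measurable_gkernV.
apply: measurable_funM; last exact: measurable_pair_diff.
exact: (measurableT_comp (@measurable_spow R q) (measurable_pair_diff mu)).
Qed.

(** Young's inequality, applied pointwise, bounds the form by the sum of the two Gagliardo
    integrands. *)
Lemma integrable_gform u phi : in_Ws0 Omega s q u -> in_Ws0 Omega s q phi ->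
  leb2.-integrable setT (fun z => (gform u phi z)%:E).
Proof.
move=> Wu Wphi; have iu := in_Ws0_gdiff Wu; have iphi := in_Ws0_gdiff Wphi.
apply: (le_integrable_real measurableT _ (integrableD_real measurableT iu iphi)).
  by apply: measurable_gform; exact: in_Ws0_measurable.
move=> z _; rewrite /gform /gdiff -mulrDl normrM (ger0_norm (_ : 0 <= (gkern z)^-1)) ?invr_ge0 ?gkern_ge0//.
rewrite ler_wpM2r ?invr_ge0 ?gkern_ge0// normrM.
by rewrite -/(spow q (u z.1 - u z.2)) norm_spow//; exact: powR_young.
Qed.

End fractional_space.

Lemma ae_snd d1 d2 (T1 : measurableType d1) (T2 : measurableType d2) (R : realType)
    (m1 : {sigma_finite_measure set T1 -> \bar R}) (m2 : {sigma_finite_measure set T2 -> \bar R})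
    (P : T2 -> Prop) :
  {ae m2, forall y, P y} -> {ae (m1 \x m2)%E, forall z, P z.2}.
Proof.
move=> [N [mN N0 PN]]; exists (setT `*` N); split.
- exact: measurableX.
- by rewrite product_measure1E// N0 mule0.
- by move=> z /= nP; split => //; exact: PN.
Qed.

(** * Coercivity of the fractional term *)

Section nonlocal_coercivity.
Variables (R : realType) (n : nat) (Omega : set 'rV[R]_n) (s q : R).
Hypotheses (s0 : 0 < s) (q1 : 1 < q) (n0 : (0 < n)%N).
Hypotheses (oO : open Omega) (bO : bounded_set Omega).
Local Notation leb := (lebesgue_rV R n).
Local Notation leb2 := (leb \x leb)%E.
Local Notation E := ('rV[R]_n).
Let mO : measurable Omega := open_measurable_rV oO.
Let fO : (leb Omega < +oo)%E := bounded_lebesgue_lty mO bO.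
Let q0 : 0 < q. Proof. exact: lt_trans q1. Qed.

(** A unit box placed beside a cube that contains [Omega]: off [Omega], but at bounded distance from
    it, so the kernel is bounded below between the two. A coordinate along which they are separated
    exists because [n] is positive. *)
Lemma far_box : exists (B : set E) (k0 : R), [/\ measurable B, leb B = 1%E, 0 < k0,
  forall y, B y -> ~ Omega y & forall x y, Omega x -> B y -> k0 <= (gkern s q (x, y))^-1].
Proof.
have [M M0 OM] := bounded_sub_cube bO.
pose B : set E := box (fun=> M + 1) (fun=> M + 2).
(* Coordinates of a point of [Omega] and of a point of [B] differ by at most [2 * M + 2], and the
   Euclidean norm is at most the sum of their absolute values. *)
pose C : R := (n%:R * (2 * M + 2)) `^ (n%:R + s * q).
have nR : 0 < n%:R :> R by rewrite ltr0n.
have C0 : 0 < C by rewrite powR_gt0// mulr_gt0//; lra.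
exists B, C^-1; split.
- exact: measurable_box.
- rewrite /B (@lebesgue_rV_box _ _ (fun=> `](M + 1), (M + 2)[%classic)); last first.
    by move=> i; exact: measurable_itv.
  rewrite big1// => i _; rewrite lebesgue_measure_itv /= lte_fin ifT; last lra.
  by rewrite -EFinB; congr EFin; ring.
- by rewrite invr_gt0.
- move=> y By Oy; have := By (Ordinal n0); have := OM _ Oy (Ordinal n0).
  by rewrite /= !in_itv /= => /andP[_ ?] /andP[? _]; lra.
- move=> x y Ox By.
  have dist i : 1 <= `|(x - y) ord0 i| <= 2 * M + 2.
    have := By i; have := OM _ Ox i.
    rewrite !mxE /= !in_itv /= => /andP[? ?] /andP[? ?].
    by rewrite ler0_norm; [apply/andP; split; lra|lra].
  have e1 : 0 < enorm (x - y).
    have /andP[d1 _] := dist (Ordinal n0).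
    exact: lt_le_trans (lt_le_trans ltr01 d1) (coor_le_enorm _ _).
  have K0 : 0 < gkern s q (x, y) by rewrite powR_gt0.
  suff KC : gkern s q (x, y) <= C by rewrite lef_pV2.
  apply: le_powR.
  + by rewrite addr_ge0// mulr_ge0 ?ltW.
  + exact: ltW.
  + apply: le_trans (enorm_le_sum _) _.
    rewrite mulr_natl -[X in _ *+ X](card_ord n) -sumr_const; apply: ler_sum => i _.
    by have /andP[] := dist i.
Qed.

Variables (u v : E -> R) (S : R -> R).
Hypotheses (Wu : in_Ws0 Omega s q u) (Wv : in_Ws0 Omega s q v).
Hypotheses (S0 : S 0 = 0) (Snd : {homo S : a b / a <= b}) (S1 : forall a, `|S a| <= 1).
Hypothesis mS : measurable_fun setT S.
Let phi x := S (u x - v x).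
Hypothesis Wphi : in_Ws0 Omega s q phi.
Let mu := in_Ws0_measurable Wu.
Let mv := in_Ws0_measurable Wv.

Lemma integrable_spow (w : E -> R) : in_Ws0 Omega s q w ->
  leb.-integrable Omega (fun x => (spow q (w x))%:E).
Proof.
move=> Ww; have mw := in_Ws0_measurable Ww.
have mwO : measurable_fun Omega w by exact: measurable_funS mw.
have iw : (Lint leb Omega q w < +oo)%E.
  apply: le_lt_trans (in_Ws0_Lint q1 Ww); rewrite !LintE.
  apply: ge0_subset_integral => //.
  exact: measurable_Lint.
have /integrable_Lint iw' := iw.
apply: (le_integrable_real mO _ (integrableD_real mO (integrable_cst_fin mO fO 1) (iw' mO mwO))).
  exact: (measurableT_comp (@measurable_spow R q)).
move=> x _; rewrite norm_spow//.
have := powR_young q1 (normr_ge0 (w x)) (ler01 : 0 <= (1 : R)).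
by rewrite mulr1 powR1 [X in _ <= X -> _]addrC.
Qed.

Lemma spow_diff_sign_ge0 a b : 0 <= (spow q a - spow q b) * S (a - b).
Proof.
have [ab|ba] := leP a b.
  rewrite mulr_le0// ?subr_le0; first exact: spow_le.
  by rewrite -[leRHS]S0 Snd// subr_le0.
rewrite mulr_ge0// ?subr_ge0; first by apply: spow_le => //; exact: ltW.
by rewrite -[leLHS]S0 Snd// subr_ge0 ltW.
Qed.

Lemma integrable_spow_diff :
  leb.-integrable Omega (fun x => ((spow q (u x) - spow q (v x)) * S (u x - v x))%:E).
Proof.
have iu := integrable_spow Wu; have iv := integrable_spow Wv.
have id := integrableB_real mO iu iv.
have id' : leb.-integrable Omega (fun x => `|spow q (u x) - spow q (v x)|%:E).
  exact: (integrable_norm_real id).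
apply: (le_integrable_real mO _ id').
  apply: measurable_funM; first exact: (measurable_integrable_real id).
  apply: (measurableT_comp mS); apply: measurable_funB; exact: measurable_funS (measurableT) _ _.
by move=> x _; rewrite normrM ler_piMr.
Qed.

(** Comparing the increments of [u] and [v] is the same as comparing [u - v] at the two points. As
    [spow] and [S] are nondecreasing, both factors have the same sign. *)
Lemma gform_diff_ge0 z : 0 <= gform s q u phi z - gform s q v phi z.
Proof.
rewrite /gform -mulrBl -mulrBl mulr_ge0 ?invr_ge0 ?gkern_ge0//.
rewrite -/(spow q (u z.1 - u z.2)) -/(spow q (v z.1 - v z.2)) /phi.
have [ab|ba] := leP (u z.1 - v z.1) (u z.2 - v z.2).
  rewrite mulr_le0// subr_le0; last exact: Snd.
  by apply: spow_le => //; lra.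
rewrite mulr_ge0// subr_ge0; last by apply: Snd; exact: ltW.
by apply: spow_le => //; lra.
Qed.

(** The integrand is nonnegative, so it may be kept only for x in [Omega] and y in [B]. There [u],
    [v] and [phi] vanish at y, which leaves a function of x times a kernel at least [k0];
    integrating in y gives the measure 1 of [B]. *)
Lemma nonlocal_coercive (B : set E) (k0 : R) : measurable B -> leb B = 1%E -> 0 < k0 ->
  (forall y, B y -> ~ Omega y) ->
  (forall x y, Omega x -> B y -> k0 <= (gkern s q (x, y))^-1) ->
  k0 * \int[leb]_(x in Omega) ((spow q (u x) - spow q (v x)) * S (u x - v x)) <=
  \int[leb2]_z gform s q u phi z - \int[leb2]_z gform s q v phi z.
Proof.
move=> mB B1 k00 BO kB.
have iu := integrable_gform q1 Wu Wphi; have iv := integrable_gform q1 Wv Wphi.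
have id := integrableB_real measurableT iu iv.
rewrite -RintegralB//.
pose h x := (spow q (u x) - spow q (v x)) * S (u x - v x).
have h0 x : 0 <= h x by exact: spow_diff_sign_ge0.
have ih : leb.-integrable Omega (fun x => (h x)%:E) := integrable_spow_diff.
have mh : measurable_fun setT h.
  apply: measurable_funM; last by apply: (measurableT_comp mS); exact: measurable_funB.
  by apply: measurable_funB; apply: (measurableT_comp (@measurable_spow R q)).
(* The minorant: a product of a function of the first variable and an indicator in the second, so
   Tonelli evaluates its integral. *)
pose g (z : E * E) := k0 * (h z.1 * \1_Omega z.1) * \1_B z.2.
have mg : measurable_fun setT g.
  have m1 : measurable_fun setT (\1_B : E -> R) by exact: measurable_indic.
  have m2 : measurable_fun setT (\1_Omega : E -> R) by exact: measurable_indic.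
  apply: measurable_funM; last exact: (measurableT_comp m1 measurable_snd).
  apply: measurable_funM => //; apply: measurable_funM.
    exact: (measurableT_comp mh measurable_fst).
  exact: (measurableT_comp m2 measurable_fst).
have ind0 (A : set E) x : 0 <= \1_A x :> R by rewrite indicE.
have kh0 x : 0 <= k0 * (h x * \1_Omega x).
  exact: (mulr_ge0 (ltW k00) (mulr_ge0 (h0 x) (ind0 Omega x))).
have g0 z : 0 <= g z by exact: (mulr_ge0 (kh0 z.1) (ind0 B z.2)).
have gD : {ae leb2, forall z, setT z -> (g z)%:E <= (gform s q u phi z - gform s q v phi z)%:E}%E.
  have [_ _ u0] := Wu; have [_ _ v0] := Wv.
  have uv : {ae leb, forall y, (~ Omega y -> u y = 0) /\ (~ Omega y -> v y = 0)}.
    by apply: filterS2 u0 v0 => y a b; split.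
  have := ae_snd leb uv.
  apply: filterS => -[x y] /= uv0 _; rewrite lee_fin.
  have D0 := gform_diff_ge0 (x, y).
  have [Ox|nOx] := pselect (Omega x); last first.
    by rewrite /g /= (indicE _ Omega) (memNset nOx) mulr0 mulr0 mul0r.
  have [By|nBy] := pselect (B y); last first.
    by rewrite /g /= (indicE _ B) (memNset nBy) mulr0.
  rewrite /g /= !indicE !mem_set// !mulr1.
  have [uy vy] : u y = 0 /\ v y = 0 by case: uv0 => a b; split; [apply: a|apply: b]; exact: BO.
  rewrite /gform /phi /= uy vy !subr0 S0 subr0 -mulrBl -mulrBl.
  rewrite -/(spow q (u x)) -/(spow q (v x)) mulrC.
  by apply: ler_wpM2l; [exact: h0|exact: kB].
have le1 : (\int[leb2]_z (g z)%:E <= \int[leb2]_z (gform s q u phi z - gform s q v phi z)%:E)%E.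
  apply: ae_ge0_le_integral => //.
  - by move=> z _; rewrite lee_fin; exact: g0.
  - exact/measurable_EFinP.
  - by move=> z _; rewrite lee_fin gform_diff_ge0.
  - by apply/measurable_EFinP; exact: (measurable_integrable_real id).
have gE : (\int[leb2]_z (g z)%:E = k0%:E * \int[leb]_(x in Omega) (h x)%:E)%E.
  rewrite fubini_tonelli1//; last exact/measurable_EFinP.
  rewrite /fubini_F /=.
  have inner x : (\int[leb]_y (g (x, y))%:E = k0%:E * (h x * \1_Omega x)%:E)%E.
    rewrite /g /=; under eq_integral do rewrite EFinM.
    rewrite ge0_integralZl_EFin//.
    - have -> : (\int[leb]_y (\1_B y)%:E = 1)%E by rewrite integral_indic// setIT; exact: B1.
      by rewrite mule1 EFinM.
    - by apply/measurable_EFinP; exact: measurable_indic.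
  under eq_integral do rewrite inner.
  rewrite ge0_integralZl_EFin//; last exact: ltW.
  - congr (_ * _)%E; rewrite [in RHS]integral_mkcond; apply: eq_integral => x _.
    rewrite patchE indicE; case: (x \in Omega) => /=; rewrite ?mulr1//.
    by rewrite mulr0.
  - by move=> x _; rewrite lee_fin; exact: (mulr_ge0 (h0 x) (ind0 Omega x)).
  - apply/measurable_EFinP; apply: measurable_funM => //; exact: measurable_indic.
have fin1 : (\int[leb]_(x in Omega) (h x)%:E)%E \is a fin_num by exact: integrable_fin_num.
have fin2 : (\int[leb2]_z (gform s q u phi z - gform s q v phi z)%:E)%E \is a fin_num.
  exact: integrable_fin_num.
by move: le1; rewrite gE -(fineK fin1) -(fineK fin2) -EFinM lee_fin.
Qed.

End nonlocal_coercivity.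

(** * The energy space *)

Section energy_space.
Variables (R : realType) (n : nat) (Omega : set 'rV[R]_n) (s p q mu : R).
Hypotheses (p2 : 2 < p) (q1 : 1 < q) (oO : open Omega) (bO : bounded_set Omega).
Local Notation leb := (lebesgue_rV R n).
Local Notation E := ('rV[R]_n).
Local Notation W := (in_W Omega s p q).
Local Notation grad := (weak_gradient Omega).
Implicit Types u v phi : E -> R.
Let mO : measurable Omega := open_measurable_rV oO.
Let fO : (leb Omega < +oo)%E := bounded_lebesgue_lty mO bO.
Let p1' : 1 < p. Proof. by apply: lt_trans p2; rewrite ltr1n. Qed.
Let p1 : 1 <= p. Proof. exact: ltW. Qed.
Let p0 : 0 < p. Proof. exact: lt_trans p1'. Qed.

Lemma in_W_approx u : W u -> approx_W10 Omega p u (grad u).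
Proof.
move=> [W1 _]; have [[_ [G uG] _] _] := W1.
exact: (in_W10_approx oO p1 (weak_gradient_is uG) W1).
Qed.

Lemma in_W_measurable u : W u -> measurable_fun setT u.
Proof. by move=> [_ /in_Ws0_measurable]. Qed.

Lemma in_W_measurable_grad u i : W u -> measurable_fun Omega (fun x => grad u x ord0 i).
Proof. by move=> /in_W_approx []. Qed.

Lemma in_W_enorm_grad u : W u -> (Lint leb Omega p (fun x => enorm (grad u x)) < +oo)%E.
Proof.
move=> Wu; have [_ mG _ iG _] := in_W_approx Wu.
apply: le_lt_trans (Lint_enorm oO p1 mG) _; apply: (Lint_sum_lty mO) => // i.
  exact: measurableT_comp.
by rewrite Lint_norm.
Qed.

Lemma measurable_dotp (F G : E -> 'rV[R]_n) :
  (forall i, measurable_fun Omega (fun x => F x ord0 i)) ->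
  (forall i, measurable_fun Omega (fun x => G x ord0 i)) ->
  measurable_fun Omega (fun x => dotp (F x) (G x)).
Proof. by move=> mF mG; apply: measurable_sum => i; exact: measurable_funM. Qed.

(** Makes the approximate sign of [u - v] an admissible test. Its boundedness matters: the L^1
    operator is tested against bounded functions only. *)
Lemma in_W_sstep u v c k : W u -> W v ->
  let phi x := sstep c k (u x - v x) in
  [/\ W phi, in_Lp leb Omega +oo%E phi &
    {ae leb, forall x, Omega x -> grad phi x = dsstep c k (u x - v x) *: (grad u x - grad v x)}].
Proof.
move=> Wu Wv phi; have [Wu1 Wu2] := Wu; have [Wv1 Wv2] := Wv.
have ap := approx_W10B oO p1 (in_W_approx Wu) (in_W_approx Wv).
have {}ap := @approx_W10_comp _ _ _ oO p p1 _ _ (sstep c k) k.+1%:R (k.+1%:R ^+ 2)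
  (smooth_sstep c k) (sstep0 c k) (ler0n _ _) (sqr_ge0 _) _ (sstep_lipschitz c k) _ ap.
have {}ap : approx_W10 Omega p phi (fun x => dsstep c k (u x - v x) *: (grad u x - grad v x)).
  rewrite -derive_sstep; apply: ap => [t|r t].
    by have := dsstep_le c k t; rewrite -derive_sstep.
  by have := dsstep_lipschitz c k r t; rewrite -derive_sstep.
have mS : measurable_fun setT (sstep c k).
  by apply: continuous_measurable_fun; exact: smooth_continuous (smooth_sstep c k).
have Wphi2 : in_Ws0 Omega s q phi.
  exact: (in_Ws0_comp q1 (ler0n _ _) (sstep0 c k) mS (sstep_lipschitz c k)).
split.
- exact: (conj (approx_in_W10 oO bO p1 ap) Wphi2).
- apply: (@bounded_in_Loo _ _ _ _ 1) => [|x _]; last exact: sstep_le1.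
  by apply: measurable_funTS; exact: in_Ws0_measurable Wphi2.
- exact: (weak_gradientP oO (approx_is_weak_gradient oO bO p1 ap)).
Qed.

Definition lform u phi x : R := enorm (grad u x) `^ (p - 2) * dotp (grad u x) (grad phi x).

Lemma measurable_lform u phi : W u -> W phi -> measurable_fun Omega (lform u phi).
Proof.
move=> Wu Wphi; apply: measurable_funM.
  apply: (measurableT_comp (measurable_powR _)); apply: measurable_enorm => i.
  exact: in_W_measurable_grad.
by apply: measurable_dotp => i; exact: in_W_measurable_grad.
Qed.

Lemma integrable_powR_enorm u : W u ->
  leb.-integrable Omega (fun x => (enorm (grad u x) `^ p)%:E).
Proof.
move=> Wu; have /integrable_Lint H := in_W_enorm_grad Wu.
have {H} : leb.-integrable Omega (fun x => (`|enorm (grad u x)| `^ p)%:E).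
  by apply: H => //; apply: measurable_enorm => i; exact: in_W_measurable_grad.
by under eq_fun do rewrite (ger0_norm (enorm_ge0 _)).
Qed.

Lemma integrable_lform u phi : W u -> W phi ->
  leb.-integrable Omega (fun x => (lform u phi x)%:E).
Proof.
move=> Wu Wphi.
apply: (le_integrable_real mO (measurable_lform Wu Wphi)
  (integrableD_real mO (integrable_powR_enorm Wu) (integrable_powR_enorm Wphi))) => x _.
rewrite /lform normrM (ger0_norm (powR_ge0 _ _)).
apply: le_trans (powR_young p1' (enorm_ge0 _) (enorm_ge0 _)).
have -> : enorm (grad u x) `^ (p - 1) = enorm (grad u x) `^ (p - 2) * enorm (grad u x).
  rewrite [RHS]mulrC (_ : p - 2 = (p - 1) - 1); last by ring.
  by rewrite mulr_powRB1 ?enorm_ge0// subr_gt0.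
by rewrite -mulrA ler_wpM2l ?powR_ge0// cauchy_schwarz.
Qed.

Lemma integrable_enorm_grad u : W u -> leb.-integrable Omega (fun x => (enorm (grad u x))%:E).
Proof.
move=> Wu; apply: (Lint_integrable mO fO p1); last exact: in_W_enorm_grad.
by apply: measurable_enorm => i; exact: in_W_measurable_grad.
Qed.

Lemma form_AE u phi : form_A Omega s p q mu u phi =
  \int[leb]_(x in Omega) lform u phi x + mu * \int[(leb \x leb)%E]_z gform s q u phi z.
Proof. by []. Qed.

(** The gradient of the test is a nonnegative multiple of [grad u - grad v], which reduces the claim
    to [plaplace_monotone]. *)
Lemma lform_sstep_le u v c k : W u -> W v ->
  \int[leb]_(x in Omega) lform v (fun x => sstep c k (u x - v x)) x <=
  \int[leb]_(x in Omega) lform u (fun x => sstep c k (u x - v x)) x.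
Proof.
move=> Wu Wv; have [Wphi _ gphi] := in_W_sstep c k Wu Wv.
apply: (ae_le_Rintegral mO (integrable_lform Wv Wphi) (integrable_lform Wu Wphi)).
apply: filterS gphi => x H Ox; rewrite /lform {}H//.
have PM := plaplace_monotone (grad u x) (grad v x) p2.
have D0 := dsstep_ge0 c k (u x - v x).
move: (dsstep _ _ _) (grad u x) (grad v x) D0 PM => D U V D0 PM.
rewrite dotpBl (dotpC (_ *: U)) (dotpC (_ *: V)) !dotpZr subr_ge0 in PM.
rewrite (dotpC (U - V) U) (dotpC (U - V) V) in PM.
by rewrite !dotpZr !(mulrCA _ D) ler_wpM2l.
Qed.

End energy_space.

Lemma enormB_le (R : realType) (n : nat) (v w : 'rV[R]_n) : enorm (v - w) <= enorm v + enorm w.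
Proof.
rewrite -(@ler_pXn2r _ 2) ?nnegrE ?addr_ge0 ?enorm_ge0// sqr_enorm.
rewrite dotpBr !dotpBl (dotpC w v) -!sqr_enorm.
have := cauchy_schwarz v w; rewrite ler_norml => /andP[+ _].
move: (dotp v w) (enorm v) (enorm w) => a b c; nra.
Qed.

Lemma measurable_ltr_nat d (T : measurableType d) (R : realType) (D : set T) (f g : T -> R) :
  measurable_fun D f -> measurable_fun D g -> measurable_fun D (fun x => (f x < g x)%R%:R : R).
Proof.
move=> mf mg; apply: (measurableT_comp (f := fun b : bool => b%:R : R)); last exact: measurable_fun_ltr.
by [].
Qed.

(** * Accretivity in L^1 *)

Section accretivity.
Variables (R : realType) (n : nat) (Omega : set 'rV[R]_n) (s p q mu : R) (f : 'I_n -> R -> R).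
Hypotheses (p2 : 2 < p) (q1 : 1 < q) (mu0 : 0 < mu) (oO : open Omega) (bO : bounded_set Omega).
Hypothesis f_loc : forall i, W1oo_loc (f i).
Local Notation leb := (lebesgue_rV R n).
Local Notation E := ('rV[R]_n).
Local Notation W := (in_W Omega s p q).
Local Notation grad := (weak_gradient Omega).
Implicit Types u v w phi : E -> R.
Let mO : measurable Omega := open_measurable_rV oO.
Let fO : (leb Omega < +oo)%E := bounded_lebesgue_lty mO bO.

Lemma in_L1_integrable w : in_Lp leb Omega 1%E w -> leb.-integrable Omega (fun x => (w x)%:E).
Proof.
move=> [mw /(@normLp_lty _ _ _ leb Omega _ w ltr01) iw].
exact: (Lint_integrable mO fO (lexx 1) mw iw).
Qed.

Lemma integrable_mul_bounded w (S : E -> R) (B : R) : leb.-integrable Omega (fun x => (w x)%:E) ->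
  measurable_fun Omega S -> (forall x, `|S x| <= B) ->
  leb.-integrable Omega (fun x => (w x * S x)%:E).
Proof.
move=> iw mS SB.
apply: (le_integrable_real mO _ (integrableZ_real mO B (integrable_norm_real iw))).
  exact: (measurable_funM (measurable_integrable_real iw) mS).
by move=> x _; rewrite normrM mulrC ler_wpM2r.
Qed.

Lemma flux_lipschitz (K : R) : exists2 L : R, 0 <= L &
  forall a b, `|a| <= K -> `|b| <= K -> enorm (flux f a - flux f b) <= L * `|a - b|.
Proof.
have [L HL] := choice (fun i => let: ex_intro2 L L0 H := W1oo_loc_lipschitz K (f_loc i) in
  ex_intro (fun L => 0 <= L /\ forall a b, `|a| <= K -> `|b| <= K -> `|f i a - f i b| <= L * `|a - b|)
    L (conj L0 H)).
exists (\sum_i L i); first by apply: sumr_ge0 => i _; have [] := HL i.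
move=> a b aK bK; apply: le_trans (enorm_le_sum _) _; rewrite mulr_suml; apply: ler_sum => i _.
by rewrite !mxE; have [_ ->] := HL i.
Qed.

Lemma measurable_flux u i : measurable_fun Omega u ->
  measurable_fun Omega (fun x => flux f (u x) ord0 i).
Proof.
move=> mu'; rewrite (_ : (fun _ => _) = fun x => f i (u x)); last by apply/funext => x; rewrite mxE.
apply: (measurableT_comp (f := f i)) => //.
by apply: continuous_measurable_fun; have [] := f_loc i.
Qed.

(** Common form of an Euler step and of the stationary problem. As [u] may be unbounded,
    integrability of the flux term is part of the definition. *)
Definition solves u w : Prop :=
  [/\ W u, in_Lp leb Omega 1%E w
    & forall phi, W phi -> in_Lp leb Omega +oo%E phi ->
        leb.-integrable Omega (fun x => (dotp (flux f (u x)) (grad phi x))%:E) /\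
        form_A Omega s p q mu u phi - form_div Omega f u phi = \int[leb]_(x in Omega) (w x * phi x)].

Variables (u1 u2 w1 w2 : E -> R) (M : R).
Hypotheses (S1 : solves u1 w1) (S2 : solves u2 w2).
Hypothesis u2M : {ae leb, forall x, Omega x -> `|u2 x| <= M}.
Variables (B : set E) (k0 : R).
Hypotheses (mB : measurable B) (B1 : leb B = 1%E) (k00 : 0 < k0).
Hypothesis BO : forall y, B y -> ~ Omega y.
Hypothesis kB : forall x y, Omega x -> B y -> k0 <= (gkern s q (x, y))^-1.
Let W1 : W u1. Proof. by have [] := S1. Qed.
Let W2 : W u2. Proof. by have [] := S2. Qed.
Let d x := u1 x - u2 x.
Let Ediff x := (w1 x - w2 x) - mu * k0 * (spow q (u1 x) - spow q (u2 x)).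
Let Fd x := dotp (flux f (u1 x) - flux f (u2 x)) (grad u1 x - grad u2 x).

Let md : measurable_fun setT d.
Proof. exact: (measurable_funB (in_W_measurable W1) (in_W_measurable W2)). Qed.

Let msstep c k : measurable_fun Omega (fun x => sstep c k (d x)).
Proof.
apply: (measurableT_comp (f := sstep c k)); last exact: (measurable_funTS md).
by apply: continuous_measurable_fun; exact: smooth_continuous (smooth_sstep c k).
Qed.

Let mdsstep c k : measurable_fun Omega (fun x => dsstep c k (d x)).
Proof.
apply: (measurableT_comp (f := dsstep c k)); last exact: (measurable_funTS md).
rewrite -derive_sstep.
apply: continuous_measurable_fun; apply: smooth_continuous.
by apply: smooth_derive; exact: smooth_sstep.
Qed.

Let mdflux i : measurable_fun Omega (fun x => (flux f (u1 x) - flux f (u2 x)) ord0 i).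
Proof.
rewrite (_ : (fun _ => _) = fun x => flux f (u1 x) ord0 i - flux f (u2 x) ord0 i); last first.
  by apply/funext => x; rewrite !mxE.
exact: (measurable_funB (measurable_flux i (measurable_funTS (in_W_measurable W1)))
  (measurable_flux i (measurable_funTS (in_W_measurable W2)))).
Qed.

Let mdgrad i : measurable_fun Omega (fun x => (grad u1 x - grad u2 x) ord0 i).
Proof.
rewrite (_ : (fun _ => _) = fun x => grad u1 x ord0 i - grad u2 x ord0 i); last first.
  by apply/funext => x; rewrite !mxE.
exact: (measurable_funB (in_W_measurable_grad p2 oO i W1) (in_W_measurable_grad p2 oO i W2)).
Qed.

Let mFd : measurable_fun Omega Fd.
Proof. exact: (measurable_dotp mdflux mdgrad). Qed.

Let iE : leb.-integrable Omega (fun x => (Ediff x)%:E).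
Proof.
have [_ /in_L1_integrable iw1 _] := S1; have [_ /in_L1_integrable iw2 _] := S2.
apply: (integrableB_real mO (integrableB_real mO iw1 iw2)).
apply: (integrableZ_real mO); apply: (integrableB_real mO).
  by apply: (integrable_spow (s := s) q1 oO bO); have [] := W1.
by apply: (integrable_spow (s := s) q1 oO bO); have [] := W2.
Qed.

Let mgt : measurable_fun Omega (fun x => (u2 x < u1 x)%R%:R : R).
Proof.
by apply: measurable_ltr_nat; apply: measurable_funTS; [exact: (in_W_measurable W2)|exact: (in_W_measurable W1)].
Qed.

Let mlt : measurable_fun Omega (fun x => (u1 x < u2 x)%R%:R : R).
Proof.
by apply: measurable_ltr_nat; apply: measurable_funTS; [exact: (in_W_measurable W1)|exact: (in_W_measurable W2)].
Qed.

(** The two equations are subtracted after testing with [phi]. The local term is dropped by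
    [lform_sstep_le], the fractional one is replaced by its lower bound from [nonlocal_coercive],
    and the flux remains on the left. *)
Lemma flux_sstep_integrable c k :
  leb.-integrable Omega (fun x => (dsstep c k (d x) * Fd x)%:E) /\
  \int[leb]_(x in Omega) (dsstep c k (d x) * Fd x) <=
  \int[leb]_(x in Omega) (Ediff x * sstep c k (d x)).
Proof.
have [Wphi Lphi gphi] := in_W_sstep p2 q1 oO bO c k W1 W2.
set phi := (fun x : E => _) in Wphi Lphi gphi *.
have [_ /in_L1_integrable iw1 /(_ _ Wphi Lphi)[if1 eq1]] := S1.
have [_ /in_L1_integrable iw2 /(_ _ Wphi Lphi)[if2 eq2]] := S2.
have iF := integrableB_real mO if1 if2.
have mF : measurable_fun Omega (fun x => dsstep c k (d x) * Fd x).
  exact: (measurable_funM (mdsstep c k) mFd).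
have aeF : {ae leb, forall x, Omega x ->
    dotp (flux f (u1 x)) (grad phi x) - dotp (flux f (u2 x)) (grad phi x) = dsstep c k (d x) * Fd x}.
  apply: filterS gphi => x H Ox; rewrite -dotpBl {}H//.
  by rewrite dotpZr.
have iF' := ae_eq_integrable_real mO mF iF aeF.
split; first exact: iF'.
rewrite -(ae_eq_Rintegral mO (measurable_integrable_real iF) mF aeF) RintegralB//.
have ib w : leb.-integrable Omega (fun x => (w x)%:E) ->
    leb.-integrable Omega (fun x => (w x * phi x)%:E).
  by move=> iw; apply: (integrable_mul_bounded iw (msstep c k)) => x; exact: sstep_le1.
have Wu1 : in_Ws0 Omega s q u1 by have [] := W1.
have Wu2 : in_Ws0 Omega s q u2 by have [] := W2.
have iJ := integrableB_real mO (integrable_spow q1 oO bO Wu1) (integrable_spow q1 oO bO Wu2).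
have -> : \int[leb]_(x in Omega) (Ediff x * sstep c k (d x)) =
  \int[leb]_(x in Omega) (w1 x * phi x) - \int[leb]_(x in Omega) (w2 x * phi x) -
  mu * k0 * \int[leb]_(x in Omega) ((spow q (u1 x) - spow q (u2 x)) * phi x).
  rewrite -RintegralZl//; last exact: ib iJ.
  rewrite -RintegralB//; [|exact: ib iw1|exact: ib iw2].
  rewrite -RintegralB//; first last.
  - exact: (integrableZ_real mO _ (ib _ iJ)).
  - exact: (integrableB_real mO (ib _ iw1) (ib _ iw2)).
  by apply: eq_Rintegral => x _; rewrite /Ediff /phi /d; ring.
have L := lform_sstep_le p2 q1 oO bO c k W1 W2.
have mS : measurable_fun setT (sstep c k).
  by apply: continuous_measurable_fun; exact: smooth_continuous (smooth_sstep c k).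
have G := nonlocal_coercive q1 oO bO Wu1 Wu2 (sstep0 c k) (sstep_nd c k) (sstep_le1 c k) mS
  (proj2 Wphi) mB B1 k00 BO kB.
rewrite -/phi in L G.
move: G; rewrite -(ler_pM2l mu0) mulrA mulrBr => G.
rewrite -eq1 -eq2 !form_AE /form_div.
have key (a1 a2 g1 g2 F1 F2 K : R) : a2 <= a1 -> K <= g1 - g2 ->
    F1 - F2 <= a1 + g1 - - F1 - (a2 + g2 - - F2) - K.
  move=> a12 Kg; rewrite -subr_ge0.
  rewrite (_ : _ - (F1 - F2) = (a1 - a2) + (g1 - g2 - K)); last by ring.
  by rewrite addr_ge0 ?subr_ge0.
exact: key L G.
Qed.

Lemma flux_sstep_cvg0 c :
  \int[leb]_(x in Omega) (dsstep c k (d x) * Fd x) @[k --> \oo] --> (0 : R).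
Proof.
(* Where |d| is at most 1, the bound on [u2] gives this bound on [u1]. *)
have [L L0 HL] := flux_lipschitz (`|M| + 1).
have C0 : 0 <= L * (5 + 2 * c ^+ 2) by rewrite mulr_ge0// addr_ge0// mulr_ge0// sqr_ge0.
pose C1 := L * (5 + 2 * c ^+ 2).
pose C2 := 4 * expR (2 * `|c|).
have C20 : 0 <= C2 by rewrite mulr_ge0// expR_ge0.
have ig1 := integrable_enorm_grad p2 oO bO W1; have ig2 := integrable_enorm_grad p2 oO bO W2.
have [iF0 _] := flux_sstep_integrable c 0.
(* Where |d| <= 1 the Lipschitz bound on the flux compensates [dsstep c k];
   elsewhere the integrand is dominated by its value for k = 0. *)
pose g x := C1 * (enorm (grad u1 x) + enorm (grad u2 x)) + C2 * `|dsstep c 0 (d x) * Fd x|.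
have ig : leb.-integrable Omega (fun x => (g x)%:E).
  apply: (integrableD_real mO (integrableZ_real mO C1 (integrableD_real mO ig1 ig2))).
  exact: (integrableZ_real mO C2 (integrable_norm_real iF0)).
have [] := @Rintegral_dominated_cvg _ _ _ leb Omega mO
  (fun k x => dsstep c k (d x) * Fd x) (cst 0) g.
- by move=> k; exact: (measurable_funM (mdsstep c k) mFd).
- exact: measurable_cst.
(* The pointwise limit is 0: [Fd] vanishes where [d] does, and elsewhere [dsstep] tends to 0. *)
- apply: nearW => x Ox; have [d0|d0] := eqVneq (d x) 0.
    rewrite (_ : (fun k => _) = cst 0); first exact: cvg_cst.
    apply/funext => k; have /eqP := d0; rewrite subr_eq0 => /eqP e.
    by rewrite /Fd e subrr dotpC -(scale0r (0 : E)) dotpZr mul0r mulr0.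
  rewrite /= -(mul0r (Fd x)); apply: cvgMl; exact: dsstep_cvg0.
- exact: ig.
- apply: filterS u2M => x H Ox k; have {}H := H Ox.
  have D0 := dsstep_ge0 c k (d x).
  have e1 := enorm_ge0 (grad u1 x); have e2 := enorm_ge0 (grad u2 x).
  have g2 : 0 <= C2 * `|dsstep c 0 (d x) * Fd x| by exact: mulr_ge0.
  have g1 : 0 <= C1 * (enorm (grad u1 x) + enorm (grad u2 x)) by exact: (mulr_ge0 C0 (addr_ge0 e1 e2)).
  have [d1|d1] := leP `|d x| 1; last first.
    apply: (@le_trans _ _ (C2 * `|dsstep c 0 (d x) * Fd x|)); last by rewrite lerDr.
    rewrite (normrM (dsstep c k (d x))) (normrM (dsstep c 0 (d x))) mulrA ler_wpM2r//.
    rewrite !ger0_norm ?dsstep_ge0//.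
    by apply: dsstep_ratio; exact: ltW.
  apply: (@le_trans _ _ (C1 * (enorm (grad u1 x) + enorm (grad u2 x)))); last by rewrite lerDl.
  have u2K : `|u2 x| <= `|M| + 1.
    by rewrite (le_trans H)// (le_trans (ler_norm _))// lerDl.
  have u1K : `|u1 x| <= `|M| + 1.
    rewrite (_ : u1 x = u2 x + d x); last by rewrite /d; ring.
    by rewrite (le_trans (ler_normD _ _))// lerD// (le_trans H)// ler_norm.
  have FL := HL _ _ u1K u2K.
  have FB : `|Fd x| <= L * `|d x| * (enorm (grad u1 x) + enorm (grad u2 x)).
    apply: le_trans (cauchy_schwarz _ _) _.
    by apply: ler_pM; rewrite ?enorm_ge0//; exact: enormB_le.
  rewrite normrM ger0_norm//.
  apply: (@le_trans _ _ (dsstep c k (d x) * (L * `|d x| * (enorm (grad u1 x) + enorm (grad u2 x))))).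
    by rewrite ler_wpM2l.
  rewrite mulrA ler_wpM2r ?addr_ge0// mulrCA ler_wpM2l// mulrC.
  exact: dsstep_mul_le.
by move=> _; rewrite /Rintegral integral0.
Qed.

(** Limit of [flux_sstep_integrable]: the flux side tends to 0, and the other side converges by
    domination because [sstep] is bounded by 1. *)
Lemma accretive_asign c :
  0 <= \int[leb]_(x in Omega) (Ediff x * asign (logistic (- c)) (d x)).
Proof.
have [] := @Rintegral_dominated_cvg _ _ _ leb Omega mO
  (fun k x => Ediff x * sstep c k (d x)) (fun x => Ediff x * asign (logistic (- c)) (d x))
  (fun x => `|Ediff x|).
- by move=> k; exact: (measurable_funM (measurable_integrable_real iE) (msstep c k)).
- apply: (measurable_funM (measurable_integrable_real iE)).
  rewrite (_ : (fun x => _) = fun x => (1 - logistic (- c)) * (u2 x < u1 x)%R%:R -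
      logistic (- c) * (u1 x < u2 x)%R%:R); last first.
    apply/funext => x; rewrite /asign subr_gt0 subr_lt0; case: ltgtP => _ /=; ring.
  exact: (measurable_funB (measurable_funM (@measurable_cst _ _ _ _ Omega (1 - logistic (- c))) mgt)
    (measurable_funM (@measurable_cst _ _ _ _ Omega (logistic (- c))) mlt)).
- apply: nearW => x Ox; apply: cvgMr; exact: sstep_cvg.
- exact: (integrable_norm_real iE).
- by apply: nearW => x Ox k; rewrite normrM ler_piMr// sstep_le1.
move=> _ cE; apply: (ler_cvg_to (flux_sstep_cvg0 c) cE).
by apply: nearW => k; have [] := flux_sstep_integrable c k.
Qed.

Lemma accretive_lt0_gt0 :
  0 <= \int[leb]_(x in Omega) (Ediff x * (u2 x < u1 x)%R%:R) /\
  \int[leb]_(x in Omega) (Ediff x * (u1 x < u2 x)%R%:R) <= 0.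
Proof.
have bool1 (b : bool) : `|b%:R| <= 1 :> R by case: b; rewrite ?normr1 ?normr0.
have ipos : leb.-integrable Omega (fun x => (Ediff x * (u2 x < u1 x)%R%:R)%:E).
  by apply: (integrable_mul_bounded iE mgt) => x; exact: bool1.
have ineg : leb.-integrable Omega (fun x => (Ediff x * (u1 x < u2 x)%R%:R)%:E).
  by apply: (integrable_mul_bounded iE mlt) => x; exact: bool1.
set P := (X in 0 <= X /\ _); set N := (X in _ /\ X <= 0).
have H c : 0 <= (1 - logistic (- c)) * P - logistic (- c) * N.
  rewrite -RintegralZl// -RintegralZl// -RintegralB//; first last.
  - exact: integrableZ_real.
  - exact: integrableZ_real.
  have := accretive_asign c; congr (0 <= _).
  apply: eq_Rintegral => x _; rewrite /asign subr_gt0 subr_lt0.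
  by case: ltgtP => _ /=; ring.
split; rewrite leNgt; apply/negP => neg.
  (* With a weight below this threshold, the correction to [P] is smaller than half its absolute
     value, so the combination in [H] would be negative. *)
  have e0 : 0 < - P / (2 * (1 + `|N| + `|P|)).
    by rewrite divr_gt0 ?oppr_gt0// mulr_gt0// ltr_pwDl// ltr_pwDl.
  have [c] := logisticN_small e0.
  rewrite ltr_pdivlMr ?mulr_gt0 ?ltr_pwDl//; have := H c; have := logistic_gt0 (- c).
  have := ler_norm N; have := ler_norm (- N); rewrite normrN (ltr0_norm neg).
  have := normr_ge0 N.
  move: (logistic _) => a; nra.
have e0 : 0 < N / (2 * (1 + `|P| + `|N|)).
  by rewrite divr_gt0// mulr_gt0// ltr_pwDl// ltr_pwDl.
have [c] := logisticN_small e0.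
(* Passing from [c] to [- c] exchanges the weights of [P] and [N], so now the weight of [P] is the
   small one. *)
rewrite ltr_pdivlMr ?mulr_gt0 ?ltr_pwDl//; have := H (- c); have := logistic_gt0 (- c).
rewrite opprK -[c]opprK (logisticN (- c)) opprK.
have := ler_norm P; have := ler_norm (- P); rewrite normrN (gtr0_norm neg).
have := normr_ge0 P.
move: (logistic _) => a; nra.
Qed.

End accretivity.

Lemma Rintegral_eq0 d (T : measurableType d) (R : realType)
    (mu : {measure set T -> \bar R}) (D : set T) (f : T -> R) :
  (forall x, f x = 0) -> \int[mu]_(x in D) f x = 0.
Proof.
by move=> f0; rewrite (_ : f = cst 0) ?/Rintegral ?integral0//; apply/funext.
Qed.

(** * The stationary solution and zero as solutions of elliptic problems *)

Section resolvent.
Variables (R : realType) (n : nat) (Omega : set 'rV[R]_n) (s p q mu : R) (f : 'I_n -> R -> R).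
Hypotheses (p2 : 2 < p) (q1 : 1 < q) (oO : open Omega) (bO : bounded_set Omega).
Hypotheses (f_loc : forall i, W1oo_loc (f i)) (f0 : forall i, f i 0 = 0).
Local Notation leb := (lebesgue_rV R n).
Local Notation E := ('rV[R]_n).
Local Notation W := (in_W Omega s p q).
Local Notation grad := (weak_gradient Omega).
Local Notation solves := (solves Omega s p q mu f).
Implicit Types u v w phi : E -> R.
Let mO : measurable Omega := open_measurable_rV oO.
Let fO : (leb Omega < +oo)%E := bounded_lebesgue_lty mO bO.

Lemma integrable_in_L1 w : leb.-integrable Omega (fun x => (w x)%:E) -> in_Lp leb Omega 1%E w.
Proof.
move=> iw; split; first exact: (measurable_integrable_real iw).
apply/(@normLp_lty _ _ _ leb Omega _ w ltr01); rewrite LintE.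
have /integrableP[_] := iw.
by under [X in _ -> (X < _)%E]eq_integral do rewrite powRr1//.
Qed.

Lemma bounded_integrable w (M : R) : measurable_fun Omega w ->
  {ae leb, forall x, Omega x -> `|w x| <= M} -> leb.-integrable Omega (fun x => (w x)%:E).
Proof.
by move=> mw wM; exact: (ae_le_integrable_real mO mw (integrable_cst_fin mO fO M) wM).
Qed.

Lemma flux0 : flux f 0 = 0.
Proof. by apply/rowP => i; rewrite !mxE f0. Qed.

(** The solution is bounded, so the Lipschitz bound and [f 0 = 0] bound the flux, and its product
    with a gradient is integrable. *)
Lemma stationary_solves h u : in_Lp leb Omega +oo%E h ->
  weak_stationary Omega s p q mu f h u -> solves u h.
Proof.
move=> hb [Wu ub sol]; have [M M0 uM] := in_Loo_bound ub.
split=> //.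
  have [K _ hK] := in_Loo_bound hb.
  by apply: integrable_in_L1; apply: bounded_integrable hK; case: hb.
move=> phi Wphi Lphi; split; last by rewrite sol//; ring.
have [L L0 HL] := flux_lipschitz f_loc M.
have mf : measurable_fun Omega (fun x => dotp (flux f (u x)) (grad phi x)).
  apply: measurable_dotp => i; last exact: (in_W_measurable_grad p2 oO i Wphi).
  exact: (measurable_flux f_loc i (measurable_funTS (in_W_measurable Wu))).
apply: (ae_le_integrable_real mO mf
  (integrableZ_real mO (L * M) (integrable_enorm_grad p2 oO bO Wphi))).
apply: filterS uM => x H Ox; apply: le_trans (cauchy_schwarz _ _) _.
rewrite ler_wpM2r ?enorm_ge0//.
have := HL (u x) 0 (H Ox); rewrite normr0 flux0 !subr0 => /(_ M0) /le_trans; apply.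
by rewrite ler_wpM2l// H.
Qed.

Lemma zero_solves u : W u -> solves (fun=> 0) (fun=> 0).
Proof.
(* The zero function enters the energy space, together with its gradient, as [sstep] of [u - u]. *)
move=> Wu; have [W0 _ g0] := in_W_sstep p2 q1 oO bO 0 0 Wu Wu.
have E0 : (fun x => sstep 0 0 (u x - u x)) = (fun=> 0).
  by apply/funext => x; rewrite subrr sstep0.
rewrite E0 in W0 g0.
split=> //; first by apply: integrable_in_L1; exact: integrable_cst_fin.
move=> phi Wphi _.
have d0 (v : E) : dotp 0 v = 0 by rewrite dotpC -(scale0r (0 : E)) dotpZr mul0r.
split.
  under eq_fun do rewrite flux0 d0.
  exact: integrable_cst_fin.
rewrite form_AE /form_div.
have -> : \int[leb]_(x in Omega) lform Omega p (fun=> 0) phi x = 0.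
  rewrite (ae_eq_Rintegral mO (g := cst 0)); first by rewrite /Rintegral integral0.
  - exact: (measurable_lform p2 oO W0 Wphi).
  - exact: measurable_cst.
  - apply: filterS g0 => x H Ox; by rewrite /lform H// (subrr (grad u x)) scaler0 d0 mulr0.
rewrite !Rintegral_eq0 => [|x|x|z].
- by rewrite mulr0 oppr0 subr0 addr0.
- by rewrite mul0r.
- by rewrite flux0 d0.
- by rewrite /gform !subrr mulr0 !mul0r.
Qed.

End resolvent.

(** * One step of the implicit Euler scheme *)

Section pointwise_step.
Variable R : realType.
Implicit Types a b : R.

Let pos_ge0 (r : R) : 0 <= Num.max r 0. Proof. by rewrite le_max lexx orbT. Qed.
Let pos_ge (r : R) : r <= Num.max r 0. Proof. by rewrite le_max lexx. Qed.

(** Where [V < U] the Euler equation expresses [U - V], and the zero-order term has a favourable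
    sign and is dropped. Elsewhere the left side is 0 and the right side nonnegative. *)
Lemma step_up_pointwise (tau kappa a b U U' V h' h Ja Jb : R) : 0 < tau -> 0 <= kappa ->
  (b < a) = (V < U) -> (b < a -> Jb <= Ja) ->
  Num.max (U - V) 0 <= Num.max (U' - V) 0 + tau * `|h' - h| -
    tau * ((h' - (U - U') / tau - h - kappa * (Ja - Jb)) * (b < a)%R%:R).
Proof.
move=> tau0 kappa0 E HJ.
have P := pos_ge (U' - V); have P0 := pos_ge0 (U' - V).
have H : tau * (h' - h) <= tau * `|h' - h| by rewrite ler_pM2l// ler_norm.
have H0 : 0 <= tau * `|h' - h| by rewrite mulr_ge0// ltW.
case: (boolP (b < a)) HJ E => [_ /(_ isT) HJ /esym VU|_ _ /esym/negbT].
  rewrite max_l ?subr_ge0 ?(ltW VU)//= mulr1.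
  have -> : tau * (h' - (U - U') / tau - h - kappa * (Ja - Jb)) =
      tau * (h' - h) - (U - U') - tau * (kappa * (Ja - Jb)) by field; rewrite gt_eqF.
  have : 0 <= tau * (kappa * (Ja - Jb)) by rewrite !mulr_ge0 ?subr_ge0// ltW.
  lra.
rewrite -leNgt => UV; rewrite max_r ?subr_le0//= mulr0 mulr0; lra.
Qed.

(** On [U < V] the zero-order term is kept: it becomes the dissipation on the left. Allowing
    [hz <= h] covers comparison from below with the stationary solution, where [hz = h], and with
    zero, where [hz = 0]. *)
Lemma step_down_pointwise (tau kappa a b U U' V h' hz h Ja Jb : R) : 0 < tau -> 0 <= kappa ->
  hz <= h -> (a < b) = (U < V) -> (a < b -> Ja <= Jb) -> (b <= a -> Jb <= Ja) ->
  Num.max (V - U) 0 + tau * kappa * Num.max (Jb - Ja) 0 <=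
    Num.max (V - U') 0 + tau * `|h' - h| +
    tau * ((h' - (U - U') / tau - hz - kappa * (Ja - Jb)) * (a < b)%R%:R).
Proof.
move=> tau0 kappa0 hzh E HJ HJ'.
have P := pos_ge (V - U'); have P0 := pos_ge0 (V - U').
have H : - (tau * `|h' - h|) <= tau * (h' - hz).
  rewrite -mulrN ler_pM2l//; have := ler_norm (- (h' - h)); rewrite normrN; lra.
have H0 : 0 <= tau * `|h' - h| by rewrite mulr_ge0// ltW.
case: (boolP (a < b)) HJ E => [ab /(_ isT) HJ /esym UV|].
  rewrite max_l ?subr_ge0 ?(ltW UV)// max_l ?subr_ge0//= mulr1.
  have -> : tau * (h' - (U - U') / tau - hz - kappa * (Ja - Jb)) =
      tau * (h' - hz) - (U - U') - tau * (kappa * (Ja - Jb)) by field; rewrite gt_eqF.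
  lra.
rewrite -leNgt => ba _ /esym/negbT; rewrite -leNgt => VU.
rewrite max_r ?subr_le0// max_r ?subr_le0 ?HJ'//= !mulr0; lra.
Qed.

End pointwise_step.

Section implicit_step.
Variables (R : realType) (n : nat) (Omega : set 'rV[R]_n) (s p q mu : R) (f : 'I_n -> R -> R).
Variable beta : R -> R.
Hypotheses (s0 : 0 < s) (p2 : 2 < p) (q1 : 1 < q) (mu0 : 0 < mu) (n0 : (0 < n)%N).
Hypotheses (oO : open Omega) (bO : bounded_set Omega).
Hypothesis f_loc : forall i, W1oo_loc (f i).
Hypotheses (beta_lt : {homo beta : t t' / t < t'}) (beta_bij : bijective beta).
Local Notation leb := (lebesgue_rV R n).
Local Notation E := ('rV[R]_n).
Local Notation solves := (solves Omega s p q mu f).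
Local Notation is_A := (is_A Omega s p q mu f beta).
Local Notation binv := (beta_inv Omega beta).
Implicit Types u v w h : E -> R.
Let mO : measurable Omega := open_measurable_rV oO.

(** The zero-order term [kappa * (J u1 - J u2)] is what the fractional operator
    contributes on top of accretivity. *)
Definition strictly_accretive (kappa : R) : Prop :=
  forall u1 u2 w1 w2 (M : R), solves u1 w1 -> solves u2 w2 ->
  {ae leb, forall x, Omega x -> `|u2 x| <= M} ->
  let Ed x := w1 x - w2 x - kappa * (spow q (u1 x) - spow q (u2 x)) in
  0 <= \int[leb]_(x in Omega) (Ed x * (u2 x < u1 x)%R%:R) /\
  \int[leb]_(x in Omega) (Ed x * (u1 x < u2 x)%R%:R) <= 0.

Lemma accretive : exists2 kappa : R, 0 < kappa & strictly_accretive kappa.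
Proof.
have [B [k0 [mB B1 k00 BO kB]]] := far_box s0 q1 n0 bO.
exists (mu * k0); first exact: mulr_gt0.
move=> u1 u2 w1 w2 M S1 S2 u2M.
exact: (accretive_lt0_gt0 p2 q1 mu0 oO bO f_loc S1 S2 u2M mB B1 k00 BO kB).
Qed.

Lemma beta_invK v x : Omega x -> beta (binv v x) = v x.
Proof.
move=> Ox; rewrite /beta_inv patchE mem_set//=; apply: pinvK.
have [g _ gK] := beta_bij; apply/mem_set; exists (g (v x)) => //; exact: gK.
Qed.

Lemma is_A_solves v w : is_A v w -> solves (binv v) w.
Proof. by move=> [_ Wv Lw H]; split. Qed.

Lemma is_A_W v w : is_A v w -> in_Ws0 Omega s q (binv v).
Proof. by move=> [_ [_ Wv] _ _]. Qed.

Lemma beta_ltE t t' : (t < t') = (beta t < beta t').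
Proof.
apply/idP/idP => [|bt]; first exact: beta_lt.
by rewrite ltNge le_eqVlt; apply/negP => /predU1P[e|/beta_lt /ltW]; [move: bt; rewrite e ltxx|rewrite leNgt bt].
Qed.

Lemma integrable_pos w : leb.-integrable Omega (fun x => (w x)%:E) ->
  leb.-integrable Omega (fun x => (Num.max (w x) 0)%:E).
Proof.
move=> iw; apply: (le_integrable_real mO _ (integrable_norm_real iw)).
  by apply: measurable_maxr; [exact: (measurable_integrable_real iw)|exact: measurable_cst].
by move=> x _; rewrite ger0_norm ?le_max ?lexx ?orbT// ge_max ler_norm normr_ge0.
Qed.

Variable kappa : R.
Hypothesis kappa0 : 0 < kappa.
Hypothesis acc : strictly_accretive kappa.

(** An Euler step of length [tau] leads from [U'] to [U] with source [h'], an approximation of [h];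
    the comparison function [u2] solves the elliptic problem with right-hand side [hz]. *)
Variables (tau M : R) (U U' h' h hz u2 : E -> R).
Hypotheses (tau0 : 0 < tau) (AU : is_A U (fun x => h' x - (U x - U' x) / tau)).
Hypotheses (S2 : solves u2 hz) (u2M : {ae leb, forall x, Omega x -> `|u2 x| <= M}).
Hypotheses (iU' : leb.-integrable Omega (fun x => (U' x)%:E))
  (ih' : leb.-integrable Omega (fun x => (h' x)%:E))
  (ih : leb.-integrable Omega (fun x => (h x)%:E))
  (iV : leb.-integrable Omega (fun x => (beta (u2 x))%:E)).
Let u1 := binv U.
Let S1 := is_A_solves AU.

Let iU : leb.-integrable Omega (fun x => (U x)%:E).
Proof. by apply: (in_L1_integrable oO bO); have [] := AU. Qed.

Let iE : leb.-integrable Omega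
  (fun x => (h' x - (U x - U' x) / tau - hz x - kappa * (spow q (u1 x) - spow q (u2 x)))%:E).
Proof.
have [[_ W1] /(in_L1_integrable oO bO) i1 _] := S1.
have [[_ W2] /(in_L1_integrable oO bO) i2 _] := S2.
apply: (integrableB_real mO (integrableB_real mO i1 i2)).
by apply: (integrableZ_real mO); apply: (integrableB_real mO); exact: (integrable_spow (s := s) q1 oO bO).
Qed.

Let iEb (b : E -> bool) : measurable_fun Omega (fun x => (b x)%:R : R) -> leb.-integrable Omega
  (fun x => ((h' x - (U x - U' x) / tau - hz x - kappa * (spow q (u1 x) - spow q (u2 x))) * (b x)%:R)%:E).
Proof.
by move=> mb; apply: (@integrable_mul_bounded _ _ _ oO _ _ 1 iE mb) => x; case: (b x); rewrite ?normr1 ?normr0.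
Qed.

Let mu1 : measurable_fun Omega u1.
Proof. by apply: measurable_funTS; have [W1 _ _] := S1; exact: (in_W_measurable W1). Qed.

Let mu2 : measurable_fun Omega u2.
Proof. by apply: measurable_funTS; have [W2 _ _] := S2; exact: (in_W_measurable W2). Qed.

Let ihh : leb.-integrable Omega (fun x => `|h' x - h x|%:E).
Proof. exact: (integrable_norm_real (integrableB_real mO ih' ih)). Qed.

(** After integrating [step_up_pointwise], accretivity on the set where [u2 < u1] gives the sign of
    the last term. *)
Lemma step_up : {ae leb, forall x, Omega x -> hz x = h x} ->
  \int[leb]_(x in Omega) (Num.max (U x - beta (u2 x)) 0) <=
  \int[leb]_(x in Omega) (Num.max (U' x - beta (u2 x)) 0) + tau * \int[leb]_(x in Omega) (`|h' x - h x|).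
Proof.
move=> hzh; have [A _] := acc S1 S2 u2M.
have i1 := integrable_pos (integrableB_real mO iU iV).
have i2 := integrable_pos (integrableB_real mO iU' iV).
have i3 := iEb (measurable_ltr_nat mu2 mu1).
have i12 := integrableD_real mO i2 (integrableZ_real mO tau ihh).
have i3' := integrableZ_real mO tau i3.
apply: (@le_trans _ _ (\int[leb]_(x in Omega) (Num.max (U' x - beta (u2 x)) 0 + tau * `|h' x - h x| -
  tau * ((h' x - (U x - U' x) / tau - hz x - kappa * (spow q (u1 x) - spow q (u2 x))) *
    (u2 x < u1 x)%R%:R)))).
  apply: (ae_le_Rintegral mO i1 (integrableB_real mO i12 i3')).
  apply: filterS hzh => x + Ox => ->//.
  apply: step_up_pointwise => //; first exact: ltW.
    by rewrite beta_ltE beta_invK.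
  by move=> ?; apply: spow_le => //; exact: ltW.
rewrite (RintegralB mO i12 i3') (RintegralD mO i2 (integrableZ_real mO tau ihh)).
rewrite (RintegralZl tau mO ihh) (RintegralZl tau mO i3).
by rewrite gerBl mulr_ge0// ltW.
Qed.

(** Integrated form of [step_down_pointwise], with accretivity now used on the set where [u1 < u2].
    The term with [kappa] will drive the convergence. *)
Lemma step_down : {ae leb, forall x, Omega x -> hz x <= h x} ->
  \int[leb]_(x in Omega) (Num.max (beta (u2 x) - U x) 0) +
    tau * kappa * \int[leb]_(x in Omega) (Num.max (spow q (u2 x) - spow q (binv U x)) 0) <=
  \int[leb]_(x in Omega) (Num.max (beta (u2 x) - U' x) 0) + tau * \int[leb]_(x in Omega) (`|h' x - h x|).
Proof.
move=> hzh; have [_ A] := acc S1 S2 u2M.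
have [[_ W1] _ _] := S1; have [[_ W2] _ _] := S2.
have i1 := integrable_pos (integrableB_real mO iV iU).
have i2 := integrable_pos (integrableB_real mO iV iU').
have iJ := integrable_pos (integrableB_real mO (integrable_spow q1 oO bO W2) (integrable_spow q1 oO bO W1)).
have i3 := iEb (measurable_ltr_nat mu1 mu2).
have i12 := integrableD_real mO i2 (integrableZ_real mO tau ihh).
have i3' := integrableZ_real mO tau i3.
have iJ' := integrableZ_real mO (tau * kappa) iJ.
rewrite -(RintegralZl (tau * kappa) mO iJ) -(RintegralD mO i1 iJ').
apply: (@le_trans _ _ (\int[leb]_(x in Omega) (Num.max (beta (u2 x) - U' x) 0 + tau * `|h' x - h x| +
  tau * ((h' x - (U x - U' x) / tau - hz x - kappa * (spow q (u1 x) - spow q (u2 x))) *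
    (u1 x < u2 x)%R%:R)))).
  apply: (ae_le_Rintegral mO (integrableD_real mO i1 iJ') (integrableD_real mO i12 i3')).
  apply: filterS hzh => x hx Ox.
  apply: step_down_pointwise => //; [exact: ltW|exact: hx|..].
  - by rewrite beta_ltE beta_invK.
  - by move=> ?; apply: spow_le => //; exact: ltW.
  - by move=> ?; exact: spow_le.
rewrite (RintegralD mO i12 i3') (RintegralD mO i2 (integrableZ_real mO tau ihh)).
rewrite (RintegralZl tau mO ihh) (RintegralZl tau mO i3).
by rewrite gerDl pmulr_rle0.
Qed.

End implicit_step.

(** * Sums over time steps and L^1 norms *)

Section partial_sums.
Variables (R : realDomainType) (N : nat) (a b : nat -> R).

Lemma le_sum_steps i m : (forall j, (j < N)%N -> a j.+1 <= a j + b j) ->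
  (i <= m)%N -> (m <= N)%N -> a m <= a i + \sum_(i <= j < m) b j.
Proof.
move=> ab; elim: m => [|m IH]; first by rewrite leqn0 => /eqP-> _; rewrite big_geq// addr0.
rewrite leq_eqVlt => /predU1P[-> _|im mN]; first by rewrite big_geq// addr0.
rewrite big_nat_recr//= addrA (le_trans (ab _ mN))// lerD2r; apply: IH => //.
exact: ltnW.
Qed.

Lemma le_partial_sum i m : (forall j, (j < N)%N -> 0 <= b j) -> (i <= m)%N -> (m <= N)%N ->
  \sum_(i <= j < m) b j <= \sum_(0 <= j < N) b j.
Proof.
move=> b0 im mN.
have pos l r : (r <= N)%N -> 0 <= \sum_(l <= j < r) b j.
  move=> rN; rewrite big_nat_cond; apply: sumr_ge0 => j /andP[/andP[_ jr] _].
  by apply: b0; exact: leq_trans rN.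
rewrite (@big_cat_nat _ _ _ m 0 N)//= (@big_cat_nat _ _ _ i 0 m)//=.
by rewrite -addrA addrC -addrA lerDl addr_ge0// pos// (leq_trans im).
Qed.

End partial_sums.

Section L1_norm.
Variables (R : realType) (n : nat) (Omega : set 'rV[R]_n).
Hypotheses (oO : open Omega).
Local Notation leb := (lebesgue_rV R n).
Local Notation E := ('rV[R]_n).
Local Notation "''I' F" := (\int[leb]_(x in Omega) F x) (at level 10, F at level 9).
Implicit Types w : E -> R.
Let mO : measurable Omega := open_measurable_rV oO.

Lemma normLp1E w : leb.-integrable Omega (fun x => (w x)%:E) ->
  normLp leb Omega 1%E w = ('I (fun x => `|w x|))%:E.
Proof.
move=> iw; rewrite (normLpE leb Omega w ltr01) invr1 poweRe1; last exact: Lint_ge0.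
rewrite LintE /Rintegral fineK.
  by apply: eq_integral => x _; rewrite powRr1.
exact: (integrable_fin_num mO (integrable_norm_real iw)).
Qed.

Lemma Rintegral_small_ae_le0 w : leb.-integrable Omega (fun x => (w x)%:E) ->
  (forall e, 0 < e -> 'I (fun x => Num.max (w x) 0) <= e) ->
  {ae leb, forall x, Omega x -> w x <= 0}.
Proof.
move=> iw H; have ip := integrable_pos oO iw.
have p0 x : 0 <= Num.max (w x) 0 by rewrite le_max lexx orbT.
have : (\int[leb]_(x in Omega) `|(Num.max (w x) 0)%:E| = 0)%E.
  have fin := integrable_fin_num mO ip.
  under eq_integral do rewrite gee0_abs ?lee_fin//.
  rewrite -(fineK fin); congr EFin; apply/eqP; rewrite eq_le; apply/andP; split.
    by apply/ler_addgt0Pr => e e0; rewrite add0r; exact: H.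
  by apply: fine_ge0; apply: integral_ge0 => x _; rewrite lee_fin.
have mp : measurable_fun Omega (fun x => (Num.max (w x) 0)%:E) by have /integrableP[] := ip.
move/(@ae_eq_integral_abs _ _ _ leb Omega mO _ mp); apply: filterS => x /= H0 Ox.
by have [<-] := H0 Ox; rewrite le_max lexx.
Qed.

Lemma le_Rintegral_pos (a b c : E -> R) : leb.-integrable Omega (fun x => (a x)%:E) ->
  leb.-integrable Omega (fun x => (b x)%:E) -> leb.-integrable Omega (fun x => (c x)%:E) ->
  (forall x, a x = b x + c x) ->
  \int[leb]_(x in Omega) Num.max (a x) 0 <=
  \int[leb]_(x in Omega) Num.max (b x) 0 + \int[leb]_(x in Omega) `|c x|.
Proof.
move=> ia ib ic abc; have ib' := integrable_pos oO ib; have ic' := integrable_norm_real ic.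
rewrite -(RintegralD mO ib' ic').
apply: (ae_le_Rintegral mO (integrable_pos oO ia) (integrableD_real mO ib' ic')).
apply: nearW => x _; rewrite ge_max addr_ge0 ?le_max ?lexx ?orbT// andbT abc.
by rewrite lerD ?ler_norm// le_max lexx.
Qed.

End L1_norm.

(** * Uniform continuity of beta measured by the signed power *)

Section modulus.
Variables (R : realType) (beta : R -> R) (q : R).
Hypotheses (q1 : 1 < q) (beta_lt : {homo beta : t t' / t < t'}) (beta0 : beta 0 = 0).
Hypothesis beta_holder : exists2 alpha : R, 0 < alpha <= 1 &
  forall K : R, exists C : R, forall t t', `|t| <= K -> `|t'| <= K ->
    `|beta t - beta t'| <= C * `|t - t'| `^ alpha.

Let beta_le : {homo beta : t t' / t <= t'}.
Proof. by move=> t t'; rewrite le_eqVlt => /predU1P[->//|/beta_lt /ltW]. Qed.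

(** If a - b exceeds a threshold, [spow q a - spow q b] is bounded below by a
    positive constant; otherwise the Hölder bound makes the left side small. *)
Lemma beta_le_spow (M k : R) : 0 < M -> 0 < k -> exists2 C : R, 0 < C &
  forall a b : R, 0 <= b -> b <= a -> a <= M -> beta a - beta b <= k + C * (spow q a - spow q b).
Proof.
move=> M0 k0; have [al /andP[al0 _] /(_ M)[H0 HH0]] := beta_holder.
pose H := Num.max H0 1.
have H1 : 0 < H by rewrite lt_max ltr01 orbT.
have HH t t' : `|t| <= M -> `|t'| <= M -> `|beta t - beta t'| <= H * `|t - t'| `^ al.
  by move=> tM t'M; apply: le_trans (HH0 _ _ tM t'M) _; rewrite ler_wpM2r ?powR_ge0// le_max lexx.
(* At distance [r0] the Hölder bound equals [k]. Taking the minimum with [M / 2] keeps [r / M] below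
   1. *)
pose r0 := (k / H) `^ al^-1.
pose r := Num.min r0 (M / 2).
have r00 : 0 < r0 by rewrite powR_gt0// divr_gt0.
have rpos : 0 < r by rewrite lt_min r00 divr_gt0.
have rM : r <= M / 2 by rewrite ge_min lexx orbT.
have rk : H * r `^ al <= k.
  apply: (@le_trans _ _ (H * r0 `^ al)).
    by rewrite ler_pM2l// le_powR ?ge_min ?lexx// ltW.
  rewrite -powRrM mulVf ?gt_eqF// powRr1; last by rewrite divr_ge0// ltW.
  by rewrite mulrCA divff ?gt_eqF// mulr1.
have qm : 0 < q - 1 by rewrite subr_gt0.
have rM1 : r / M < 1 by rewrite ltr_pdivrMr// mul1r (le_lt_trans rM)// ltr_pdivrMr// ltr_pMr// ltr1n.
have th0 : 0 <= 1 - r / M by rewrite subr_ge0 ltW.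
have c1 : (1 - r / M) `^ (q - 1) < 1.
  have := @gt0_ltr_powR _ (q - 1) qm (1 - r / M) 1; rewrite powR1 !nnegrE.
  by apply => //; rewrite gtrBl divr_gt0.
(* If [a - b > r] then, since [a <= M], [b] is at most [a * (1 - r / M)]. As also [a >= r], the
   difference of signed powers is at least this constant, whether [q] is below or above 2. *)
pose c0 := r `^ (q - 1) * (1 - (1 - r / M) `^ (q - 1)).
have c00 : 0 < c0 by rewrite mulr_gt0 ?powR_gt0// subr_gt0.
(* With this factor, [c0] is already worth the full variation of [beta] on [0, M]. *)
exists ((beta M - beta 0) / c0); first by rewrite divr_gt0// subr_gt0 beta_lt.
move=> a b b0 ba aM.
have J0 : 0 <= spow q a - spow q b by rewrite subr_ge0 spow_le.
have C0 : 0 <= (beta M - beta 0) / c0 by rewrite divr_ge0 ?subr_ge0 ?ltW ?beta_lt.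
have a0 := le_trans b0 ba.
have [abr|abr] := leP (a - b) r.
  apply: (@le_trans _ _ k); last by rewrite lerDl mulr_ge0.
  apply: le_trans rk; apply: le_trans (ler_norm _) _.
  apply: le_trans (HH _ _ _ _) _; first by rewrite ger0_norm.
    by rewrite ger0_norm// (le_trans ba).
  by rewrite ler_pM2l// ger0_norm ?subr_ge0// le_powR ?subr_ge0// ltW.
have Jc : c0 <= spow q a - spow q b.
  rewrite !spow_ge0E//.
  have ra : r <= a by rewrite ltW// (lt_le_trans abr)// gerBl.
  have bth : b <= a * (1 - r / M).
    rewrite mulrBr mulr1 lerBrDr -lerBrDl (le_trans _ (ltW abr))//.
    by rewrite mulrCA ler_piMr ?(ltW rpos)// ler_pdivrMr// mul1r.
  apply: (@le_trans _ _ (a `^ (q - 1) * (1 - (1 - r / M) `^ (q - 1)))).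
    by rewrite ler_wpM2r ?subr_ge0 ?(ltW c1)// le_powR ?(ltW qm)// ltW.
  rewrite mulrBr mulr1 lerD2l lerN2 -powRM//.
  by apply: le_powR => //; exact: ltW.
apply: (@le_trans _ _ ((beta M - beta 0) / c0 * c0)).
  rewrite divfK ?gt_eqF//.
  by rewrite lerB// beta_le.
apply: (@le_trans _ _ ((beta M - beta 0) / c0 * (spow q a - spow q b))); first by rewrite ler_wpM2l.
by rewrite lerDr ltW.
Qed.

(** Extends the bound of [beta_le_spow] to every real [b], since Euler iterates may be negative or
    exceed the stationary solution. The last term pays for negative values. *)
Definition spow_modulus (M k C : R) : Prop :=
  forall a b : R, 0 <= a -> a <= M -> Num.max (beta a - beta b) 0 <=
    k + C * Num.max (spow q a - spow q b) 0 + Num.max (- beta b) 0.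

Lemma spow_modulus_exists (M k : R) : 0 < M -> 0 < k ->
  exists2 C : R, 0 < C & spow_modulus M k C.
Proof.
move=> M0 k0; have [C C0 HC] := beta_le_spow M0 k0; exists C => // a b a0 aM.
have p0 (x : R) : 0 <= Num.max x 0 by rewrite le_max lexx orbT.
have r0 : 0 <= k + C * Num.max (spow q a - spow q b) 0 by rewrite addr_ge0 ?(ltW k0)// mulr_ge0// ltW.
have [ab|ba] := leP a b.
  by rewrite max_r ?subr_le0 ?beta_le// addr_ge0.
rewrite max_l ?subr_ge0 ?beta_le ?(ltW ba)//.
rewrite max_l; last by rewrite subr_ge0; apply: spow_le => //; exact: ltW.
have [b0|b0] := leP 0 b.
  by apply: le_trans (HC _ _ b0 (ltW ba) aM) _; rewrite lerDl.
(* For negative [b], the bound is used between [a] and 0, and the rest of the increment of [beta] is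
   the last term. *)
have := HC a 0 (lexx 0) a0 aM; rewrite beta0 spow0 !subr0 => Ha.
rewrite max_l; last by rewrite oppr_ge0 -beta0 beta_le// ltW.
rewrite lerD2r (le_trans Ha)// lerD2l ler_pM2l// lerBrDr gerDl.
by rewrite -(spow0 q) spow_le// ltW.
Qed.

End modulus.

(** * Estimates along the scheme and for the mild solution *)

Section implicit_scheme.
Variables (R : realType) (n : nat) (Omega : set 'rV[R]_n) (s p q mu : R) (f : 'I_n -> R -> R).
Variable beta : R -> R.
Hypothesis q1 : 1 < q.
Hypotheses (oO : open Omega) (bO : bounded_set Omega).
Hypotheses (beta_lt : {homo beta : t t' / t < t'}) (beta_bij : bijective beta) (beta0 : beta 0 = 0).
Local Notation leb := (lebesgue_rV R n).
Local Notation E := ('rV[R]_n).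
Local Notation solves := (solves Omega s p q mu f).
Local Notation binv := (beta_inv Omega beta).
Let mO : measurable Omega := open_measurable_rV oO.
Let fO : (leb Omega < +oo)%E := bounded_lebesgue_lty mO bO.
Let max0 (r : R) : 0 <= Num.max r 0. Proof. by rewrite le_max lexx orbT. Qed.

Variable kappa : R.
Hypothesis kappa0 : 0 < kappa.
Hypothesis acc : strictly_accretive Omega s p q mu f kappa.

Variables (h ustat v0 : E -> R) (M : R).
Hypotheses (Sstat : solves ustat h) (Szero : solves (fun=> 0) (fun=> 0)).
Hypothesis ustat_bd : {ae leb, forall x, Omega x -> 0 <= ustat x <= M}.
Hypothesis h_ge0 : {ae leb, forall x, Omega x -> 0 <= h x}.
Hypothesis iV : leb.-integrable Omega (fun x => (beta (ustat x))%:E).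
Hypothesis iv0 : leb.-integrable Omega (fun x => (v0 x)%:E).
Hypothesis v0_bd : {ae leb, forall x, Omega x -> 0 <= v0 x <= beta (ustat x)}.

Let ih : leb.-integrable Omega (fun x => (h x)%:E).
Proof. by apply: (in_L1_integrable oO bO); have [] := Sstat. Qed.

Let ustat_norm : {ae leb, forall x, Omega x -> `|ustat x| <= M}.
Proof. by apply: filterS ustat_bd => x H Ox; have /andP[u0 uM] := H Ox; rewrite ger0_norm. Qed.

Section approximate.
Variables T eps : R.
Variables (N : nat) (t_ : nat -> R) (h_ U_ : nat -> E -> R).
Hypotheses (t0 : t_ 0%N = 0) (tN : t_ N = T).
Hypothesis tinc : forall i, (i < N)%N -> t_ i < t_ i.+1.
Hypothesis Lh : forall i, (i < N)%N -> in_Lp leb Omega 1%E (h_ i.+1).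
Hypothesis sumh : (\sum_(i < N) \int[@lebesgue_measure R]_(tau in ooitv (t_ i) (t_ i.+1))
  normLp leb Omega 1 (fun x => h x - h_ i.+1 x)%R < eps%:E)%E.
Hypothesis LU0 : in_Lp leb Omega 1%E (U_ 0%N).
Hypothesis U0v0 : (normLp leb Omega 1 (fun x => U_ 0%N x - v0 x)%R <= eps%:E)%E.
Hypothesis AU : forall i, (i < N)%N -> is_A Omega s p q mu f beta (U_ i.+1)
  (fun x => h_ i.+1 x - (U_ i.+1 x - U_ i x) / (t_ i.+1 - t_ i)).

Let tau j := t_ j.+1 - t_ j.
Let e j := \int[leb]_(x in Omega) (`|h_ j.+1 x - h x|).

Let tau0 j : (j < N)%N -> 0 < tau j.
Proof. by move=> jN; rewrite subr_gt0 tinc. Qed.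

Let e0 j : 0 <= e j.
Proof. by apply: Rintegral_ge0 => x _. Qed.

Let ih_ j : (j < N)%N -> leb.-integrable Omega (fun x => (h_ j.+1 x)%:E).
Proof. by move=> jN; apply: (in_L1_integrable oO bO); exact: Lh. Qed.

Lemma scheme_integrable i : (i <= N)%N -> leb.-integrable Omega (fun x => (U_ i x)%:E).
Proof.
case: i => [_|i iN]; first exact: (in_L1_integrable oO bO).
by apply: (in_L1_integrable oO bO); have [] := AU iN.
Qed.

Let sume : \sum_(0 <= j < N) tau j * e j < eps.
Proof.
rewrite big_mkord -lte_fin; apply: le_lt_trans sumh.
rewrite -sumEFin; apply: lee_sum => i _.
have iN := ltn_ord i.
rewrite (normLp1E oO (integrableB_real mO ih (ih_ iN))).
have mI : measurable (ooitv (t_ i) (t_ i.+1)) by exact: measurable_itv.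
(* The source does not depend on time, so each time integral is a constant times the length of the
   step. *)
have -> : (\int[@lebesgue_measure R]_(_ in ooitv (t_ i) (t_ i.+1))
    (\int[leb]_(x in Omega) `|h x - h_ i.+1 x|)%:E =
    (\int[leb]_(x in Omega) `|h x - h_ i.+1 x|)%:E * lebesgue_measure (ooitv (t_ i) (t_ i.+1)))%E.
  exact: integral_cst.
rewrite /ooitv lebesgue_measure_itv /= lte_fin tinc//.
rewrite -EFinB -EFinM lee_fin mulrC ler_pM2r ?tau0//.
rewrite le_eqVlt; apply/orP; left; apply/eqP.
by apply: eq_Rintegral => x _; rewrite distrC.
Qed.

Let sume_le i m : (i <= m)%N -> (m <= N)%N -> \sum_(i <= j < m) tau j * e j <= eps.
Proof.
move=> im mN; apply: le_trans (ltW sume); apply: le_partial_sum => // j jN.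
by rewrite mulr_ge0// ltW// tau0.
Qed.

Let iU0 := integrable_norm_real (integrableB_real mO (scheme_integrable (leq0n N)) iv0).

Let U0_le : \int[leb]_(x in Omega) (`|U_ 0%N x - v0 x|) <= eps.
Proof.
move: U0v0; rewrite (normLp1E oO) ?lee_fin//.
exact: (integrableB_real mO (scheme_integrable (leq0n N)) iv0).
Qed.

Let sum_bound (a : nat -> R) i m : (forall j, (j < N)%N -> a j.+1 <= a j + tau j * e j) ->
  (i <= m)%N -> (m <= N)%N -> a m <= a i + eps.
Proof.
move=> ae im mN; apply: le_trans (le_sum_steps ae im mN) _.
by rewrite lerD2l sume_le.
Qed.

(** One [eps] is the error on the initial datum, which lies below the stationary state, the other
    the accumulated error on the source. *)
Lemma scheme_le_stat : \int[leb]_(x in Omega) (Num.max (U_ N x - beta (ustat x)) 0) <= eps + eps.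
Proof.
pose a i := \int[leb]_(x in Omega) (Num.max (U_ i x - beta (ustat x)) 0).
apply: (@le_trans _ _ (a 0%N + eps)).
  apply: (sum_bound (a := a)) => // j jN.
  apply: (step_up q1 oO bO beta_lt beta_bij kappa0 acc (tau0 jN) (AU jN) Sstat ustat_norm
    (scheme_integrable (ltnW jN)) (ih_ jN) ih iV).
  exact: nearW.
rewrite lerD2r; apply: le_trans U0_le.
apply: (ae_le_Rintegral mO _ iU0).
  exact: (integrable_pos oO (integrableB_real mO (scheme_integrable (leq0n N)) iV)).
apply: filterS v0_bd => x H Ox; have /andP[_ v0V] := H Ox.
rewrite ge_max normr_ge0 andbT (le_trans _ (ler_norm _))//.
by rewrite lerD2l lerN2.
Qed.

(** Comparison with the zero solution, whose right-hand side 0 lies below [h]. The two errors are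
    those of [scheme_le_stat]. *)
Lemma scheme_ge0 i : (i <= N)%N -> \int[leb]_(x in Omega) (Num.max (- U_ i x) 0) <= eps + eps.
Proof.
move=> iN; pose a i := \int[leb]_(x in Omega) (Num.max (- U_ i x) 0).
apply: (@le_trans _ _ (a 0%N + eps)).
  apply: (sum_bound (a := a)) => // j jN.
  have i0 : leb.-integrable Omega (fun=> (beta ((fun=> 0) (0 : E)))%:E) by exact: integrable_cst_fin.
  (* The sign of [M] is known only at points where it bounds |ustat|. *)
  have z0 : {ae leb, forall x, Omega x -> `|(0 : R)| <= M}.
    apply: filterS ustat_norm => x H Ox; rewrite normr0; exact: le_trans (H Ox).
  have := step_down q1 oO bO beta_lt beta_bij kappa0 acc (tau0 jN) (AU jN) Szero z0
    (scheme_integrable (ltnW jN)) (ih_ jN) ih i0 h_ge0.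
  rewrite beta0; under eq_Rintegral do rewrite sub0r.
  under [in leRHS]eq_Rintegral do rewrite sub0r.
  apply: le_trans; rewrite lerDl mulr_ge0 ?mulr_ge0 ?(ltW kappa0) ?(ltW (tau0 jN))//.
  exact: Rintegral_ge0.
rewrite lerD2r; apply: le_trans U0_le.
apply: (ae_le_Rintegral mO _ iU0).
  exact: (integrable_pos oO (integrableN_real (scheme_integrable (leq0n N)))).
apply: filterS v0_bd => x H Ox; have /andP[v00 _] := H Ox.
rewrite ge_max normr_ge0 andbT distrC (le_trans _ (ler_norm _))//.
by rewrite lerDr.
Qed.

(** The deficit [dd] almost decreases, so its final value bounds it from below at every earlier
    step, up to [eps]. The modulus converts this into dissipation of at least [X / C] at each step,
    and the steps have total length [T]. On the right, one [eps] comes from the initial datum and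
    one from the source. *)
Lemma scheme_decay (k C : R) : 0 < C ->
  spow_modulus beta q M k C ->
  kappa * T * (\int[leb]_(x in Omega) (Num.max (beta (ustat x) - U_ N x) 0) - k * fine (leb Omega) - 3 * eps) <=
  C * (\int[leb]_(x in Omega) (beta (ustat x)) + 2 * eps).
Proof.
move=> C0 HC.
pose dd i := \int[leb]_(x in Omega) (Num.max (beta (ustat x) - U_ i x) 0).
pose jj i := \int[leb]_(x in Omega) (Num.max (spow q (ustat x) - spow q (binv (U_ i) x)) 0).
(* Of the three [eps], one is the possible increase of [dd] and two bound the negative part of the
   iterate. No sign of [X] is needed. *)
pose X := dd N - k * fine (leb Omega) - 3 * eps.
have Wstat : in_Ws0 Omega s q ustat by have [[]] := Sstat.
have stp j : (j < N)%N -> dd j.+1 + tau j * kappa * jj j.+1 <= dd j + tau j * e j.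
  move=> jN.
  apply: (step_down q1 oO bO beta_lt beta_bij kappa0 acc (tau0 jN) (AU jN) Sstat ustat_norm
    (scheme_integrable (ltnW jN)) (ih_ jN) ih iV).
  by apply: nearW => x _.
have jj0 j : 0 <= jj j by apply: Rintegral_ge0 => x _; exact: max0.
have ddN i : (i <= N)%N -> dd N <= dd i + eps.
  move=> iN; apply: (sum_bound (a := dd)) => // j jN.
  apply: le_trans (stp _ jN); rewrite lerDl mulr_ge0// mulr_ge0 ?ltW//.
  exact: tau0.
have iJ j : (j < N)%N -> leb.-integrable Omega
    (fun x => (Num.max (spow q (ustat x) - spow q (binv (U_ j.+1) x)) 0)%:E).
  move=> jN; apply: (integrable_pos oO); apply: (integrableB_real mO).
    exact: (integrable_spow q1 oO bO Wstat).
  exact: (integrable_spow q1 oO bO (is_A_W (AU jN))).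
have Xjj j : (j < N)%N -> X <= C * jj j.+1.
  move=> jN.
  have iUj := scheme_integrable jN.
  have iNU := integrable_pos oO (integrableN_real iUj).
  have ik := integrable_cst_fin mO fO k.
  have ikJ := integrableD_real mO ik (integrableZ_real mO C (iJ _ jN)).
  have : dd j.+1 <= \int[leb]_(x in Omega) (k + C * Num.max (spow q (ustat x) - spow q (binv (U_ j.+1) x)) 0 +
      Num.max (- U_ j.+1 x) 0).
    apply: (ae_le_Rintegral mO (integrable_pos oO (integrableB_real mO iV iUj))
      (integrableD_real mO ikJ iNU)).
    apply: filterS ustat_bd => x H Ox; have /andP[u0 uM] := H Ox.
    by have := HC _ (binv (U_ j.+1) x) u0 uM; rewrite beta_invK.
  rewrite (RintegralD mO ikJ iNU) (RintegralD mO ik (integrableZ_real mO C (iJ _ jN))).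
  rewrite (RintegralZl C mO (iJ _ jN)) -/(jj j.+1) Rintegral_cst//.
  have := scheme_ge0 jN; have := ddN _ jN; rewrite /X.
  move: (dd N) (dd j.+1) (jj j.+1) (Rintegral _ _ _) (k * _) => A1 A2 A3 A4 A5; lra.
(* Multiplying by [C] lets [X] replace the dissipation, so the sum over the steps telescopes to
   [kappa * X * T]. *)
have stp' j : (j < N)%N -> C * dd j.+1 <= C * dd j + (C * (tau j * e j) - kappa * X * tau j).
  move=> jN; have tk : 0 <= tau j * kappa by rewrite mulr_ge0 ?ltW ?tau0.
  have H1 : C * (dd j.+1 + tau j * kappa * jj j.+1) <= C * (dd j + tau j * e j).
    by rewrite ler_pM2l// stp.
  have H2 : tau j * kappa * X <= tau j * kappa * (C * jj j.+1) by rewrite ler_wpM2l// Xjj.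
  have -> : C * dd j + (C * (tau j * e j) - kappa * X * tau j) =
    C * (dd j + tau j * e j) - tau j * kappa * X by ring.
  rewrite lerBrDr; apply: le_trans H1.
  by rewrite [leRHS]mulrDr lerD2l; apply: le_trans H2 _; rewrite mulrCA.
have := @le_sum_steps _ N (fun i => C * dd i) _ 0%N N stp' (leq0n N) (leqnn N).
rewrite sumrB -!mulr_sumr telescope_sumr// t0 tN subr0.
have CS : C * (\sum_(0 <= j < N) tau j * e j) <= C * eps by rewrite ler_pM2l// ltW.
have d0N : 0 <= C * dd N.
  by rewrite mulr_ge0 ?(ltW C0)//; apply: Rintegral_ge0 => x _; exact: max0.
have d00 : C * dd 0%N <= C * (\int[leb]_(x in Omega) (beta (ustat x)) + eps).
  rewrite ler_pM2l//; apply: le_trans (_ : _ <= \int[leb]_(x in Omega) (beta (ustat x) + `|U_ 0%N x - v0 x|)) _.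
    apply: (ae_le_Rintegral mO _ (integrableD_real mO iV iU0)).
      exact: (integrable_pos oO (integrableB_real mO iV (scheme_integrable (leq0n N)))).
    apply: filterS v0_bd => x H Ox; have /andP[v00 v0V] := H Ox.
    have := ler_norm (- (U_ 0%N x - v0 x)); rewrite normrN => Hn.
    have Vn : 0 <= beta (ustat x) by exact: le_trans v0V.
    rewrite ge_max addr_ge0// andbT; lra.
  by rewrite (RintegralD mO iV iU0) lerD2l.
rewrite -/X -/(dd N) => H.
have -> : kappa * T * X = kappa * X * T by ring.
move: H CS d0N d00; rewrite !mulrDr.
move: (C * dd N) (C * dd 0%N) (C * (\sum_(_ <= _ < _) _)) (C * Rintegral _ _ _) (kappa * X * T) => *.
lra.
Qed.

End approximate.
(** The order bounds are exact because [eps] is arbitrary in them. In the last estimate [k] and [C]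
    are independent of [T] and [eps]; the fourth [eps] is the distance of the mild solution to the
    scheme at time [T]. *)
Lemma mild_estimates (T : R) (v : R -> E -> R) : 0 < T ->
  mild_solution Omega s p q mu f beta T (fun _ => h) v0 v ->
  [/\ leb.-integrable Omega (fun x => (v T x)%:E),
      {ae leb, forall x, Omega x -> 0 <= v T x <= beta (ustat x)} &
      forall k C : R, 0 < C ->
        spow_modulus beta q M k C ->
        forall eps : R, 0 < eps ->
        kappa * T * (\int[leb]_(x in Omega) (Num.max (beta (ustat x) - v T x) 0) -
          k * fine (leb Omega) - 4 * eps) <=
        C * (\int[leb]_(x in Omega) (beta (ustat x)) + 2 * eps)].
Proof.
move=> T0 [_ _ [vL _] approx].
have TT : 0 <= T <= T by rewrite lexx ltW.
have ivT : leb.-integrable Omega (fun x => (v T x)%:E).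
  by apply: (in_L1_integrable oO bO); exact: vL.
(* The last iterate serves as [w]: an approximate solution takes the value [U_ N] at time [T]. *)
have key eps : 0 < eps -> exists w : E -> R,
    [/\ leb.-integrable Omega (fun x => (w x)%:E),
        \int[leb]_(x in Omega) `|w x - v T x| <= eps,
        \int[leb]_(x in Omega) (Num.max (w x - beta (ustat x)) 0) <= eps + eps,
        \int[leb]_(x in Omega) (Num.max (- w x) 0) <= eps + eps &
        forall k C : R, 0 < C ->
        spow_modulus beta q M k C ->
        kappa * T * (\int[leb]_(x in Omega) (Num.max (beta (ustat x) - w x) 0) -
          k * fine (leb Omega) - 3 * eps) <=
        C * (\int[leb]_(x in Omega) (beta (ustat x)) + 2 * eps)].
  move=> e0; have [Vt [N [t_ [h_ [U_ [[t0 tN tinc] [Lh sumh] [LU0 U0v0] AU [_ VT]]]]]]] := approx _ e0.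
  move=> /(_ _ TT); rewrite VT => Uv.
  have iUN := scheme_integrable LU0 AU (leqnn N).
  have tinc' i : (i < N)%N -> t_ i < t_ i.+1 by move=> /tinc[].
  exists (U_ N); split => //.
  - move: Uv; rewrite (normLp1E oO (integrableB_real mO iUN ivT)) lte_fin.
    exact: ltW.
  - exact: (scheme_le_stat tinc' Lh sumh LU0 U0v0 AU).
  - exact: (scheme_ge0 tinc' Lh sumh LU0 U0v0 AU (leqnn N)).
  - by move=> k C C0 HC; exact: (scheme_decay t0 tN tinc' Lh sumh LU0 U0v0 AU C0 HC).
split => //.
  have up : {ae leb, forall x, Omega x -> v T x - beta (ustat x) <= 0}.
    apply: (Rintegral_small_ae_le0 oO (integrableB_real mO ivT iV)) => e e0.
    (* One third for the distance to the scheme, two for the errors of the scheme. *)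
    have e30 : 0 < e / 3 by rewrite divr_gt0.
    have [w [iw wv wV _ _]] := key _ e30.
    apply: le_trans (le_Rintegral_pos oO (integrableB_real mO ivT iV) (integrableB_real mO iw iV)
      (integrableB_real mO ivT iw) _) _; first by move=> x; ring.
    by under [X in _ + X]eq_Rintegral do rewrite distrC; move: wv wV; lra.
  have down : {ae leb, forall x, Omega x -> - v T x <= 0}.
    apply: (Rintegral_small_ae_le0 oO (integrableN_real ivT)) => e e0.
    have e30 : 0 < e / 3 by rewrite divr_gt0.
    have [w [iw wv _ w0 _]] := key _ e30.
    apply: le_trans (le_Rintegral_pos oO (integrableN_real ivT) (integrableN_real iw)
      (integrableB_real mO iw ivT) _) _; first by move=> x; ring.
    by move: wv w0; lra.
  apply: filterS2 up down => x H1 H2 Ox; have := H1 Ox; have := H2 Ox.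
  by rewrite oppr_le0 subr_le0 => -> ->.
move=> k C C0 HC eps e0; have [w [iw wv _ _ H]] := key _ e0.
apply: le_trans (H _ _ C0 HC); rewrite ler_pM2l ?mulr_gt0//.
have E x : beta (ustat x) - v T x = beta (ustat x) - w x + (w x - v T x) by ring.
have := le_Rintegral_pos oO (integrableB_real mO iV ivT) (integrableB_real mO iV iw)
  (integrableB_real mO iw ivT) E.
move: wv.
move: (Rintegral _ _ _) (Rintegral _ _ _) (Rintegral _ _ _) (k * _) => A1 A2 A3 A4; lra.
Qed.

End implicit_scheme.

(** * Decay of the deficit and convergence *)

(** For fixed [k] the right side does not depend on [T] while the left grows linearly, so the
    bracket cannot stay away from 0. *)
Lemma decay_near (R : realType) (D : R -> R) (kappa V Om : R) : 0 < kappa -> 0 <= Om -> 0 <= V ->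
  (forall k : R, 0 < k -> exists2 C : R, 0 < C & forall T eps : R, 0 < T -> 0 < eps ->
    kappa * T * (D T - k * Om - 4 * eps) <= C * (V + 2 * eps)) ->
  forall e : R, 0 < e -> \forall T \near +oo, D T < e.
Proof.
move=> kappa0 Om0 V0 H e e0.
have O1 : 0 < Om + 1 by rewrite ltr_wpDl.
(* This [k] costs at most [e / 4], and [eps = e / 16] costs another [e / 4]: if [D T >= e], the
   bracket is at least [e / 2]. *)
have k0 : 0 < e / 4 / (Om + 1) by rewrite !divr_gt0.
have [C C0 HC] := H _ k0.
have e16 : 0 < e / 16 by rewrite divr_gt0.
have kOm : e / 4 / (Om + 1) * Om <= e / 4.
  rewrite -mulrA ler_piMr ?divr_ge0 ?(ltW e0)//.
  by rewrite mulrC ler_pdivrMr// mul1r lerDl.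
pose B := C * (V + 2 * (e / 16)).
near=> T.
have T0 : 0 < T by near: T; exact: nbhs_pinfty_gt.
have TB : B / (kappa * (e / 2)) < T by near: T; apply: nbhs_pinfty_gt; exact: num_real.
rewrite ltNge; apply/negP => De.
have := HC T _ T0 e16; rewrite -/B leNgt => /negP; apply.
rewrite ltr_pdivrMr ?mulr_gt0// ?divr_gt0// in TB.
apply: lt_le_trans TB _; rewrite (_ : T * _ = kappa * T * (e / 2)); last by ring.
rewrite ler_pM2l ?mulr_gt0//.
move: kOm De; move: (e / 4 / _ * _) => A; lra.
Unshelve. all: by end_near.
Qed.


Theorem theorem1p8 (R : realType) (d : nat) (Omega : set 'rV[R]_d)
  (s p q mu : R) (f : 'I_d -> R -> R) (beta : R -> R)
  (h ustat u0 : 'rV[R]_d -> R) (u : R -> 'rV[R]_d -> R)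
  (d_gt0 : (0 < d)%N)
  (Omega_dom : smooth_bounded_domain Omega)
  (s01 : 0 < s < 1) (p_gt2 : 2 < p) (q_gt1 : 1 < q) (mu_gt0 : 0 < mu)
  (f_loc : forall i, W1oo_loc (f i)) (f0 : forall i, f i 0 = 0)
  (beta_ass : beta_assumptions p beta)
  (beta_odd : forall r, beta (- r) = - beta r)
  (h_bdd : in_Lp (lebesgue_rV R d) Omega +oo%E h)
  (h_ge0 : {ae lebesgue_rV R d, forall x, Omega x -> 0 <= h x})
  (ustat_sol : weak_stationary Omega s p q mu f h ustat)
  (ustat_ge0 : {ae lebesgue_rV R d, forall x, Omega x -> 0 <= ustat x})
  (u0_W : in_W Omega s p q u0)
  (u0_bdd : in_Lp (lebesgue_rV R d) Omega +oo%E u0)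
  (u0_itv : {ae lebesgue_rV R d, forall x, Omega x -> 0 <= u0 x <= ustat x})
  (u_sol : global_weak_mild_solution Omega s p q mu f beta
             (fun _ x _ => h x) u0 u) :
  forall gamma : R, 1 <= gamma ->
    normLp (lebesgue_rV R d) Omega gamma%:E (fun x => u t x - ustat x)
      @[t --> +oo] --> 0%E.
Proof.
move=> gamma gamma1.
have [s0 _] := andP s01.
have [_ oO _ bO _] := Omega_dom.
have mO := open_measurable_rV oO; have fO := bounded_lebesgue_lty mO bO.
have [[beta_lt beta_bij] beta_holder beta0 beta_lower _] := beta_ass.
have beta_le : {homo beta : t t' / t <= t'}.
  by move=> t t'; rewrite le_eqVlt => /predU1P[->//|/beta_lt /ltW].
have [kappa kappa0 acc] := accretive (mu := mu) s0 p_gt2 q_gt1 mu_gt0 d_gt0 oO bO f_loc.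
have [Wstat Lstat _] := ustat_sol.
have [M0 M00 ustatM] := in_Loo_bound Lstat.
(* The added 1 makes the bound positive, as the modulus and the lower bound on the increments of
   [beta] require. *)
pose M := M0 + 1; have M1 : 0 < M by rewrite ltr_wpDl.
have ustat_bd : {ae lebesgue_rV R d, forall x, Omega x -> 0 <= ustat x <= M}.
  apply: filterS2 ustat_ge0 ustatM => x H1 H2 Ox; rewrite H1//=.
  by rewrite (le_trans (ler_norm _))// (le_trans (H2 Ox))// lerDl.
have Sstat := stationary_solves p_gt2 oO bO f_loc f0 h_bdd ustat_sol.
have Szero := zero_solves mu p_gt2 q_gt1 oO bO f0 Wstat.
have mbeta : measurable_fun setT beta by exact: nondecreasing_measurable.
have mustat : measurable_fun Omega ustat := measurable_funTS (in_W_measurable Wstat).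
have mV : measurable_fun Omega (fun x => beta (ustat x)) by exact: (measurableT_comp mbeta).
have iV : (lebesgue_rV R d).-integrable Omega (fun x => (beta (ustat x))%:E).
  apply: (bounded_integrable oO bO (M := beta M) mV).
  apply: filterS ustat_bd => x H Ox; have /andP[u0x uM] := H Ox.
  have b0 := beta_le _ _ u0x; rewrite beta0 in b0.
  by rewrite (ger0_norm b0); exact: beta_le.
have mild T (T0 : 0 < T) := proj2 (proj2 u_sol T T0).
have iv0 : (lebesgue_rV R d).-integrable Omega (fun x => (beta (u0 x))%:E).
  by apply: (in_L1_integrable oO bO); have [] := mild 1 ltr01.
have v0_bd : {ae lebesgue_rV R d, forall x, Omega x -> 0 <= beta (u0 x) <= beta (ustat x)}.
  apply: filterS u0_itv => x H Ox; have /andP[H1 H2] := H Ox.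
  have b0 := beta_le _ _ H1; rewrite beta0 in b0.
  by rewrite b0; exact: beta_le.
have est T (T0 : 0 < T) := mild_estimates q_gt1 oO bO beta_lt beta_bij beta0 kappa0 acc
  Sstat Szero ustat_bd h_ge0 iV iv0 v0_bd T0 (mild T T0).
pose D T := \int[lebesgue_rV R d]_(x in Omega) (Num.max (beta (ustat x) - beta (u T x)) 0).
have IV0 : 0 <= \int[lebesgue_rV R d]_(x in Omega) (beta (ustat x)).
  apply: (ae_Rintegral_ge0 mO mV); apply: filterS ustat_bd => x H Ox.
  have /andP[H1 _] := H Ox; have b0 := beta_le _ _ H1.
  by rewrite beta0 in b0.
have Om0 : 0 <= fine (lebesgue_rV R d Omega) by exact: fine_ge0 (measure_ge0 _ _).
have Dsmall : forall e : R, 0 < e -> \forall T \near +oo, D T < e.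
  apply: (decay_near kappa0 Om0 IV0) => k k0.
  have [C C0 HC] := spow_modulus_exists q_gt1 beta_lt beta0 beta_holder M1 k0.
  by exists C => [//|T eps T0 eps0]; have [_ _ H] := est T T0; exact: (H _ _ C0 HC _ eps0).
have [c c0 Hc] := beta_lower M M1.
(* Since [0 <= ustat - u <= M], the power gamma is at most M^(gamma - 1) times the difference, and
   dividing by [c] passes from the difference to the increment of [beta]. *)
pose K := M `^ (gamma - 1) / c.
have K0 : 0 <= K by rewrite divr_ge0 ?powR_ge0 ?ltW.
have [g betaK gK] := beta_bij.
(* Monotonicity of the inverse transfers both measurability and the order bounds from [beta (u t)]
   to [u t]. *)
have gnd : {homo g : a b / a <= b}.
  move=> a b ab; rewrite leNgt; apply/negP => /beta_lt.
  by rewrite !gK ltNge ab.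
have mg : measurable_fun setT g by exact: nondecreasing_measurable.
have gamma0 : 0 < gamma := lt_le_trans ltr01 gamma1.
apply/(normLp_cvg0 (lebesgue_rV R d) Omega _ _ gamma0).
apply/cvge0P => [t|e e0]; first exact: Lint_ge0.
have K1 : 0 < K + 1 by rewrite ltr_wpDl.
have eK : 0 < e / (K + 1) by rewrite divr_gt0.
near=> t.
have t0 : 0 < t by near: t; exact: nbhs_pinfty_gt.
have Dt : D t < e / (K + 1) by near: t; exact: Dsmall.
have [ivt vt_bd _] := est t t0.
have mut : measurable_fun Omega (u t).
  rewrite (_ : u t = fun x => g (beta (u t x))); last by apply/funext => x; rewrite betaK.
  exact: (measurableT_comp mg (measurable_integrable_real ivt)).
have ipos := integrable_pos oO (integrableB_real mO iV ivt).
have D0 : 0 <= D t by apply: Rintegral_ge0 => x _; rewrite le_max lexx orbT.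
apply: (@le_lt_trans _ _ (K * D t)%:E); last first.
  rewrite lte_fin; apply: (@le_lt_trans _ _ ((K + 1) * D t)).
    by rewrite ler_wpM2r// lerDl.
  by rewrite mulrC -ltr_pdivlMr.
rewrite EFinM /D /Rintegral fineK; last exact: (integrable_fin_num mO ipos).
rewrite LintE -ge0_integralZl_EFin//; first last.
- by have /integrableP[] := ipos.
- by move=> x _; rewrite lee_fin le_max lexx orbT.
apply: ae_ge0_le_integral => //.
- by apply: measurable_Lint; exact: measurable_funB.
- by move=> x _; rewrite lee_fin mulr_ge0// le_max lexx orbT.
- by have /integrableP[] := integrableZ_real mO K ipos.
apply: filterS2 ustat_bd vt_bd => x H1 H2 Ox; have /andP[us0 usM] := H1 Ox.
have /andP[vt0 vtV] := H2 Ox.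
have ux0 : 0 <= u t x by have := gnd _ _ vt0; rewrite betaK -{1}beta0 betaK.
have uxs : u t x <= ustat x by have := gnd _ _ vtV; rewrite !betaK.
rewrite -EFinM lee_fin max_l ?subr_ge0//.
have dd0 : 0 <= ustat x - u t x by rewrite subr_ge0.
rewrite distrC ger0_norm// -(mulr_powRB1 dd0 gamma0) mulrC.
apply: (@le_trans _ _ (M `^ (gamma - 1) * (ustat x - u t x))).
  apply: ler_wpM2r => //; apply: le_powR => //; first by rewrite subr_ge0.
  by apply: le_trans usM; rewrite gerBl.
rewrite /K -mulrA ler_wpM2l ?powR_ge0// ler_pdivlMl//.
by apply: Hc => //; rewrite (le_trans _ ux0)// oppr_le0 ltW.
Unshelve. all: by end_near.
Qed.
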